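(* Assume either that $k$ is a field of characteristic $p\ge0$ and $q\in k$ is a root of unity with $\ell:=\mathrm{ord}(q^2)>1$, or that $k$ has characteristic $p>0$, $q=1$, and put $\ell:=p$. For $n\ge 0$ let $\Lambda_n=[0,n]\cap(n+2\mathbb{Z})$, let $D_n(m)$, $m\in\Lambda_n$, be the simple modules of the Temperley-Lieb algebra $TL_n(q+q^{-1})$ over $k$, and let $Q_n(q+q^{-1})$ be the Jones algebra. Set $d_n(m)=\dim_k D_n(m)$ if $m\in\Lambda_n\cap[0,\ell-2]$ and $d_n(m)=0$ otherwise. Then the simple modules $D_n(m)$ with $m\in\Lambda_n\cap[0,\ell-2]$ are modules for $Q_n(q+q^{-1})$ and form, up to isomorphism, the complete list of simple modules for $Q_n(q+q^{-1})$. Their dimensions satisfy, and are determined by (together with $d_0(m)=\delta_{0,m}$), $$d_n(m)=d_{n-1}(m-1)+d_{n-1}(m+1)\qquad (n\ge1,\ 0\le m\le \ell-2).$$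
   Context: $TL_n(\delta)$ is the Temperley-Lieb algebra over $k$ on $n$ strands with loop parameter $\delta$. $U_q=U_q(sl_2)$ is Lusztig's quantum group for $sl_2$ over $k$ (divided power form specialized at $q$; finite dimensional type 1 modules); for $q=1$ its representation theory is that of the algebraic group $SL_2$ over $k$. $\Delta_q(m)$ is the Weyl module of highest weight $m\ge0$, $\nabla_q(m)=\Delta_q(m)^*$, $V_q=\Delta_q(1)$, and $T_q(m)$ is the indecomposable tilting module of highest weight $m$ (tilting: both the module and its dual have Weyl filtrations). One identifies $TL_n(q+q^{-1})\simeq\mathrm{End}_{U_q}(V_q^{\otimes n})$. This algebra is cellular with cell modules $C_n(m)=\mathrm{Hom}_{U_q}(\Delta_q(m),V_q^{\otimes n})$, and $D_n(m)$ is the quotient of $C_n(m)$ by $\{f:h\circ f=0\ \text{for all } h\in\mathrm{Hom}_{U_q}(V_q^{\otimes n},\nabla_q(m))\}$, which is the simple head of $C_n(m)$ when nonzero; lists of simple modules refer to the nonzero $D_n(m)$. The fusion category is the quotient of the category of tilting modules by the tensor ideal of negligible modules (tilting modules all of whose indecomposable summands are $T_q(m)$ with $m\ge\ell-1$); its objects may be regarded as tilting modules whose indecomposable summands are $T_q(m)$ with $0\le m\le\ell-2$, with tensor product $Q_1\,\underline{\otimes}\,Q_2=\mathrm{pr}(Q_1\otimes Q_2)$, where $\mathrm{pr}$ discards all summands $T_q(m)$ with $m\ge\ell-1$. The Jones algebra is $Q_n(q+q^{-1})=\mathrm{End}_{U_q}(V_q^{\underline{\otimes}n})$ (here $V_q$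 is first replaced by $\mathrm{pr}(V_q)$, and $V_q^{\underline\otimes n}=\mathrm{pr}(V_q^{\otimes n})$); it is a quotient of $TL_n(q+q^{-1})=\mathrm{End}_{U_q}(V_q^{\otimes n})$. *)

(* Defs.v *)
From HB Require Import structures.
From mathcomp Require Import all_boot all_order all_algebra.
From mathcomp Require Import generic_quotient ring_quotient mxtens.
From mathcomp Require Import boolp classical_sets.

Set Implicit Arguments.
Unset Strict Implicit.
Unset Printing Implicit Defensive.

Import GRing.Theory.

Local Open Scope ring_scope.
Local Open Scope quotient_scope.

Definition nonzero_module (R : pzRingType) (W : lmodType R) : Prop :=
  exists x : W, x != 0.

Definition simple_module (R : pzRingType) (W : lmodType R) : Prop :=
  nonzero_module W /\
  forall S : submodClosed W,
    (forall x, x \in S -> x = 0) \/ (forall x, x \in S).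

Definition lmod_iso (R : pzRingType) (W1 W2 : lmodType R) : Prop :=
  exists f : {linear W1 -> W2}, bijective f.

(* [W] is isomorphic to the restriction of [W'] along [phi]. *)
Definition is_restriction (R R' : pzRingType) (phi : R -> R')
    (W' : lmodType R') (W : lmodType R) : Prop :=
  exists f : {additive W' -> W},
    bijective f /\ forall a x, f (phi a *: x) = a *: f x.

Section QuotientModule.
Variables (R : pzRingType) (V : lmodType R) (S : submodClosed V).

Definition lquot_pred : {pred V} := fun x => x \in S.

Fact lquot_zmod_closed : zmod_closed lquot_pred.
Proof.
split; first exact: rpred0.
by move=> x y Sx Sy; rewrite unfold_in rpredD // -scaleN1r rpredZ.
Qed.

HB.instance Definition _ :=
  GRing.isZmodClosed.Build V lquot_pred lquot_zmod_closed.

Definition lquot : Type := Quotient.quot lquot_pred.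

HB.instance Definition _ := Choice.on lquot.
HB.instance Definition _ := GRing.Zmodule.on lquot.
HB.instance Definition _ := EqQuotient.on lquot.

Definition lquot_scale (a : R) (x : lquot) : lquot :=
  \pi_lquot (a *: repr x).

Lemma pi_lquot_scale a (x : V) :
  lquot_scale a (\pi_lquot x) = \pi_lquot (a *: x).
Proof.
apply/eqP; rewrite -(Quotient.idealrBE lquot_pred) -scalerBr.
apply: rpredZ; rewrite -[_ \in S]/(_ \in lquot_pred) Quotient.idealrBE.
by rewrite reprK.
Qed.

Lemma pi_lquotD (x y : V) : \pi_lquot (x + y) = \pi_lquot x + \pi_lquot y.
Proof. exact: (Quotient.pi_add lquot_pred x y). Qed.

Fact lquot_scaleA a b x :
  lquot_scale a (lquot_scale b x) = lquot_scale (a * b) x.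
Proof. by rewrite -[x]reprK (pi_lquot_scale b) !pi_lquot_scale scalerA. Qed.

Fact lquot_scale1 : left_id 1 lquot_scale.
Proof. by move=> x; rewrite -[x]reprK pi_lquot_scale scale1r. Qed.

Fact lquot_scaleDr : right_distributive lquot_scale +%R.
Proof.
move=> a x y; rewrite -[x]reprK -[y]reprK.
by rewrite -pi_lquotD !pi_lquot_scale scalerDr pi_lquotD.
Qed.

Fact lquot_scaleDl x : {morph lquot_scale^~ x : a b / a + b}.
Proof.
by move=> a b; rewrite -[x]reprK !pi_lquot_scale scalerDl pi_lquotD.
Qed.

HB.instance Definition _ := GRing.Zmodule_isLmodule.Build R lquot
  lquot_scaleA lquot_scale1 lquot_scaleDr lquot_scaleDl.

End QuotientModule.

Section GaussianBinomial.
Variables (k : fieldType) (q : k).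

(* Symmetric Gaussian binomials: the value at [v = q] of the Laurent
   polynomial [n]! / ([t]! [n - t]!), where [n] = (v^n - v^-n) / (v - v^-1),
   given by its Pascal recursion since [t]! may vanish at [q]. *)
Fixpoint qbinn (n t : nat) : k :=
  match n, t with
  | _, 0 => 1
  | 0, _.+1 => 0
  | n'.+1, t'.+1 => q ^+ t * qbinn n' t + q ^- (n' - t') * qbinn n' t'
  end.

(* For a negative upper index, [-a; t] = (-1)^t [a + t - 1; t]. *)
Definition qbin (n : int) (t : nat) : k :=
  match n with
  | Posz n' => qbinn n' t
  | Negz n' => (-1) ^+ t * qbinn (n' + t) t
  end.

End GaussianBinomial.

Section QuantumGroup.
Variables (k : fieldType).

(* Operators act on column vectors. Basis vector [i] has weight [uwt i];
   [uE r], [uF r] are the divided powers E^(r), F^(r). On a type 1 module the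
   remaining generators K and [K; c; t] act on the weight space of weight [w]
   by [q^w] and by the Gaussian binomial [w + c; t], so that they are
   determined by the weights. The defining relations are in [is_uqmod]. *)
Record uqrep := UqRep {
  udim : nat;
  uwt : 'I_udim -> int;
  uE : nat -> 'M[k]_udim;
  uF : nat -> 'M[k]_udim
}.

Arguments uwt : clear implicits.

Variable q : k.

Definition uK (M : uqrep) (c : int) : 'M[k]_(udim M) :=
  diag_mx (\row_i q ^ (c * uwt M i)).

Definition uKbin (M : uqrep) (c : int) (t : nat) : 'M[k]_(udim M) :=
  diag_mx (\row_i qbin q (uwt M i + c) t).

Record is_uqmod (M : uqrep) : Prop := IsUqMod {
  uE_wt : forall r i j, uE M r j i != 0 -> uwt M j = uwt M i + (2 * r)%:Z;
  uF_wt : forall r i j, uF M r j i != 0 -> uwt M j = uwt M i - (2 * r)%:Z;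
  uE0 : uE M 0 = 1%:M;
  uF0 : uF M 0 = 1%:M;
  uEE : forall r s, uE M r *m uE M s = qbinn q (r + s) r *: uE M (r + s);
  uFF : forall r s, uF M r *m uF M s = qbinn q (r + s) r *: uF M (r + s);
  uEF : forall r s, uE M r *m uF M s =
    \sum_(t < (minn r s).+1)
      uF M (s - t) *m uKbin M ((2 * t)%:Z - r%:Z - s%:Z) t *m uE M (r - t)
}.

Definition is_uqhom (M N : uqrep) (f : 'M[k]_(udim N, udim M)) : Prop :=
  [/\ forall i j, f i j != 0 -> uwt N i = uwt M j,
      forall r, f *m uE M r = uE N r *m f &
      forall r, f *m uF M r = uF N r *m f].

(* The tensor product, for the coproduct with
   E |-> E (x) 1 + K (x) E and F |-> F (x) K^-1 + 1 (x) F. *)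
Definition utens (M N : uqrep) : uqrep := {|
  udim := udim M * udim N;
  uwt := fun p => uwt M (mxtens_unindex p).1 + uwt N (mxtens_unindex p).2;
  uE := fun r => \sum_(i < r.+1) q ^+ (i * (r - i)) *:
          ((uE M (r - i) *m uK M i%:Z) *t uE N i);
  uF := fun r => \sum_(i < r.+1) q ^+ (i * (r - i)) *:
          (uF M i *t (uF N (r - i) *m uK N (- i%:Z)))
|}.

(* The dual module, for the antipode S of that coproduct:
   S(E^(r)) = (-1)^r q^(r(r-1)) K^-r E^(r) and
   S(F^(r)) = (-1)^r q^(-r(r-1)) F^(r) K^r. *)
Definition udual (M : uqrep) : uqrep := {|
  udim := udim M;
  uwt := fun i => - uwt M i;
  uE := fun r =>
    (((-1) ^+ r * q ^+ (r * r.-1)) *: (uK M (- r%:Z) *m uE M r))^T;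
  uF := fun r =>
    (((-1) ^+ r * q ^- (r * r.-1)) *: (uF M r *m uK M r%:Z))^T
|}.

(* The Weyl module of highest weight m, in its standard basis x_0, ..., x_m
   (x_i = F^(i) x_0): F^(r) x_i = [i + r; r] x_(i+r) and
   E^(r) x_i = [m - i + r; r] x_(i-r). *)
Definition weyl (m : nat) : uqrep := {|
  udim := m.+1;
  uwt := fun i => m%:Z - (2 * i)%:Z;
  uE := fun r => \matrix_(j, i)
    (if (i == j + r :> nat)%N then qbinn q (m - i + r) r else 0);
  uF := fun r => \matrix_(j, i)
    (if (j == i + r :> nat)%N then qbinn q (i + r) r else 0)
|}.

Definition nabla (m : nat) : uqrep := udual (weyl m).

Fixpoint Vpow (n : nat) : uqrep :=
  if n is n'.+1 then utens (Vpow n') (weyl 1) else weyl 0.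

Definition short_exact (M' M M'' : uqrep)
    (f : 'M[k]_(udim M, udim M')) (g : 'M[k]_(udim M'', udim M)) : Prop :=
  [/\ is_uqhom f, is_uqhom g,
      injective (fun u : 'cV[k]_(udim M') => f *m u),
      (forall w : 'cV[k]_(udim M''), exists v, g *m v = w) &
      forall v : 'cV[k]_(udim M), g *m v = 0 <-> exists u, f *m u = v].

Inductive weyl_filtered : uqrep -> Prop :=
| WeylFiltered0 M : udim M = 0%N -> weyl_filtered M
| WeylFilteredS M' M m f g :
    weyl_filtered M' -> @short_exact M' M (weyl m) f g -> weyl_filtered M.

Definition tilting (M : uqrep) : Prop :=
  [/\ is_uqmod M, weyl_filtered M & weyl_filtered (udual M)].

Definition biproduct (M X Y : uqrep)
    (iX : 'M[k]_(udim M, udim X)) (pX : 'M[k]_(udim X, udim M))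
    (iY : 'M[k]_(udim M, udim Y)) (pY : 'M[k]_(udim Y, udim M)) : Prop :=
  [/\ is_uqhom iX, is_uqhom pX, is_uqhom iY & is_uqhom pY] /\
  [/\ pX *m iX = 1%:M, pY *m iY = 1%:M & iX *m pX + iY *m pY = 1%:M].

Definition is_dsum (M X Y : uqrep) : Prop :=
  exists iX pX iY pY, @biproduct M X Y iX pX iY pY.

Definition indecomposable (M : uqrep) : Prop :=
  udim M <> 0%N /\
  forall X Y, is_dsum M X Y -> udim X = 0%N \/ udim Y = 0%N.

Definition has_highest_weight (M : uqrep) (m : nat) : Prop :=
  (exists i, uwt M i = m%:Z) /\
  forall i, (uwt M i <= m%:Z)%R.

(* M is (isomorphic to) T_q(m). *)
Definition is_indec_tilting (m : nat) (M : uqrep) : Prop :=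
  [/\ tilting M, indecomposable M & has_highest_weight M m].

(* M is a tilting module all of whose indecomposable summands are T_q(m)
   with m in the given set. *)
Definition tilting_with (S : pred nat) (M : uqrep) : Prop :=
  tilting M /\
  forall X Y, is_dsum M X Y -> indecomposable X ->
    exists2 m, S m & is_indec_tilting m X.

Variable l : nat.

Definition negligible : uqrep -> Prop := tilting_with (fun m => (l - 1 <= m)%N).

Definition fusion_object : uqrep -> Prop :=
  tilting_with (fun m => (m <= l - 2)%N).

(* A decomposition of M exhibiting the summand pr(M). *)
Record fusion_pr (M : uqrep) := FusionPr {
  pr_obj : uqrep;
  pr_neg : uqrep;
  pr_in : 'M[k]_(udim M, udim pr_obj);
  pr_out : 'M[k]_(udim pr_obj, udim M);
  neg_in : 'M[k]_(udim M, udim pr_neg);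
  neg_out : 'M[k]_(udim pr_neg, udim M);
  pr_biproduct : biproduct pr_in pr_out neg_in neg_out;
  pr_objP : fusion_object pr_obj;
  pr_negP : negligible pr_neg
}.

End QuantumGroup.

Arguments uwt {k} u i.
Arguments pr_obj {k q l M}.

Section Hom.
Variable k : fieldType.
Implicit Types M N P : uqrep k.

Definition uqhom_pred M N : {pred 'M[k]_(udim N, udim M)} :=
  fun f => `[< is_uqhom f >].

Lemma uqhomP M N (f : 'M[k]_(udim N, udim M)) :
  reflect (is_uqhom f) (f \in @uqhom_pred M N).
Proof. exact: asboolP. Qed.

Lemma is_uqhom_comp M N P
    (g : 'M[k]_(udim P, udim N)) (f : 'M[k]_(udim N, udim M)) :
  is_uqhom g -> is_uqhom f -> is_uqhom (g *m f).
Proof.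
move=> [gw gE gF] [fw fE fF]; split=> [i j|r|r].
- rewrite mxE => nz; have [h|] := pselect (exists h, g i h * f h j != 0).
    case: h => h; rewrite mulf_eq0 negb_or => /andP[/gw -> /fw ->] //.
  move=> no; case/eqP: nz; rewrite big1 // => h _; apply/eqP.
  by apply: contrapT => /negP H; apply: no; exists h.
- by rewrite -mulmxA fE !mulmxA gE.
- by rewrite -mulmxA fF !mulmxA gF.
Qed.

Fact uqhom_submod_closed M N : submod_closed (@uqhom_pred M N).
Proof.
split.
  apply/uqhomP; split=> [i j|r|r]; rewrite ?mul0mx ?mulmx0 //.
  by rewrite mxE eqxx.
move=> a f g /uqhomP[fw fE fF] /uqhomP[gw gE gF]; apply/uqhomP.
split=> [i j|r|r].
- rewrite !mxE; have [/eqP f0|/fw //] := boolP (f i j == 0).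
  by rewrite f0 mulr0 add0r => /gw.
- by rewrite mulmxDl mulmxDr -scalemxAl -scalemxAr fE gE.
- by rewrite mulmxDl mulmxDr -scalemxAl -scalemxAr fF gF.
Qed.

HB.instance Definition _ M N := GRing.isSubmodClosed.Build k
  'M[k]_(udim N, udim M) (@uqhom_pred M N) (uqhom_submod_closed M N).

Record uqend M := UqEnd {
  uqend_mx :> 'M[k]_(udim M);
  _ : uqend_mx \in @uqhom_pred M M
}.

HB.instance Definition _ M := [isSub for @uqend_mx M].
HB.instance Definition _ M := [Choice of uqend M by <:].

Fact uqend_mulr_closed M : mulr_closed (@uqhom_pred M M).
Proof.
split; first apply/uqhomP.
  split=> [i j|r|r]; rewrite -[1]/(1%:M) ?mulmx1 ?mul1mx //.
  by rewrite mxE; have [->|] := eqVneq i j; rewrite //= eqxx.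
by move=> f g /uqhomP hf /uqhomP hg; apply/uqhomP; exact: is_uqhom_comp.
Qed.

HB.instance Definition _ M := GRing.isMulClosed.Build 'M[k]_(udim M)
  (@uqhom_pred M M) (uqend_mulr_closed M).
HB.instance Definition _ M := GRing.SubChoice_isSubPzRing.Build
  'M[k]_(udim M) (@uqhom_pred M M) (uqend M) (subringClosedP _).
HB.instance Definition _ M := [SubZmodule_isSubLmodule of
  uqend M by <:].

(* Hom(M, N), as a left module over End(N). *)
Record uqhom M N := UqHom {
  uqhom_mx :> 'M[k]_(udim N, udim M);
  _ : uqhom_mx \in @uqhom_pred M N
}.

HB.instance Definition _ M N := [isSub for @uqhom_mx M N].
HB.instance Definition _ M N := [Choice of uqhom M N by <:].
HB.instance Definition _ M N := [SubChoice_isSubZmodule of uqhom M N by <:].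

Fact uqhom_comp_subproof M N (a : uqend N) (f : uqhom M N) :
  val a *m val f \in @uqhom_pred M N.
Proof.
by apply/uqhomP/is_uqhom_comp; apply/uqhomP; [apply: (valP a)|apply: (valP f)].
Qed.

Definition uqhom_scale M N (a : uqend N) (f : uqhom M N) : uqhom M N :=
  UqHom (uqhom_comp_subproof a f).

Fact uqhom_scaleA M N (a b : uqend N) (f : uqhom M N) :
  uqhom_scale a (uqhom_scale b f) = uqhom_scale (a * b) f.
Proof. by apply: val_inj; rewrite /= mulmxA. Qed.

Fact uqhom_scale1 M N : left_id 1 (@uqhom_scale M N).
Proof. by move=> f; apply: val_inj; rewrite /= mul1mx. Qed.

Fact uqhom_scaleDr M N : right_distributive (@uqhom_scale M N) +%R.
Proof. by move=> a f g; apply: val_inj; rewrite /= mulmxDr. Qed.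

Fact uqhom_scaleDl M N (f : uqhom M N) :
  {morph (@uqhom_scale M N)^~ f : a b / a + b}.
Proof. by move=> a b; apply: val_inj; rewrite /= mulmxDl. Qed.

HB.instance Definition _ M N := GRing.Zmodule_isLmodule.Build (uqend N)
  (uqhom M N) (@uqhom_scaleA M N) (@uqhom_scale1 M N) (@uqhom_scaleDr M N)
  (@uqhom_scaleDl M N).

(* W has dimension d over k, a scalar c acting as c times the identity of
   End(M). *)
Definition has_kdim M (W : lmodType (uqend M)) (d : nat) : Prop :=
  exists f : 'rV[k]_d -> W, bijective f /\
    forall (c : k) x y, f (c *: x + y) = (c *: (1 : uqend M)) *: f x + f y.

Definition kdim M (W : lmodType (uqend M)) : nat :=
  xget 0%N [set d | has_kdim W d]%classic.

End Hom.

Section TemperleyLieb.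
Variables (k : fieldType) (q : k).

(* TL_n(q + q^-1), through its identification with the endomorphism algebra
   of V_q^(x)n. *)
Definition TL (n : nat) : pzRingType := uqend (Vpow q n).

(* The cell module C_n(m), and below it the simple head D_n(m) or 0. *)
Definition cell (n m : nat) : lmodType (TL n) := uqhom (weyl q m) (Vpow q n).

Definition cell_rad_pred (n m : nat) : {pred cell n m} :=
  fun f => `[< forall h : 'M[k]_(udim (nabla q m), udim (Vpow q n)),
                 is_uqhom h -> h *m uqhom_mx f = 0 >].

Fact cell_rad_submod_closed n m : submod_closed (@cell_rad_pred n m).
Proof.
split; first by apply/asboolP => h _; rewrite mulmx0.
move=> a f g /asboolP rf /asboolP rg; apply/asboolP => h hh.
rewrite [uqhom_mx _]/= mulmxDr rg // addr0 mulmxA rf //.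
by apply: is_uqhom_comp => //; apply/uqhomP/(valP a).
Qed.

HB.instance Definition _ n m := GRing.isSubmodClosed.Build (TL n) (cell n m)
  (@cell_rad_pred n m) (cell_rad_submod_closed n m).

Definition cell_rad n m : submodClosed (cell n m) := @cell_rad_pred n m.

Definition Dmod (n m : nat) : lmodType (TL n) := lquot (cell_rad n m).

Definition Lambda (n : nat) : pred nat :=
  [pred m | (m <= n)%N && (m == n %[mod 2])%N].

Variable l : nat.

(* Lambda_n intersected with [0, l - 2]; truncated subtraction is harmless as
   2 <= l throughout. *)
Definition Lambda_l (n : nat) : pred nat :=
  [pred m | (m \in Lambda n) && (m <= l - 2)%N].

(* d_n(m), indexed by all integers m so that d_n(-1) = 0 makes sense. *)
Definition jones_dim (n : nat) (m : int) : nat :=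
  if m is Posz m' then if m' \in Lambda_l n then kdim (Dmod n m') else 0%N
  else 0%N.

(* The Jones algebra Q_n(q + q^-1) = End(pr(V_q^(x)n)); pr is only defined up
   to isomorphism, hence the dependence on a decomposition [J]. *)
Definition jones n (J : fusion_pr q l (Vpow q n)) : pzRingType :=
  uqend (pr_obj J).

Fact TL_to_jones_subproof n (J : fusion_pr q l (Vpow q n)) (a : TL n) :
  pr_out J *m uqend_mx a *m pr_in J \in @uqhom_pred k (pr_obj J) (pr_obj J).
Proof.
have [[hi ho _ _] _] := pr_biproduct J.
apply/uqhomP/is_uqhom_comp => //; apply: is_uqhom_comp => //.
exact/uqhomP/(valP a).
Qed.

Definition TL_to_jones n (J : fusion_pr q l (Vpow q n)) (a : TL n) : jones J :=
  UqEnd (TL_to_jones_subproof J a).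

End TemperleyLieb.

(* Main.v *)
Require Import Defs.
From HB Require Import structures.
From mathcomp Require Import all_boot all_order all_algebra.
From mathcomp Require Import generic_quotient mxtens.
From mathcomp Require Import boolp classical_sets.
From mathcomp Require Import zify ring.

(** Write W m for the Weyl module of highest weight m, V for W 1, V^n for its
    n-fold tensor power, [j] for the quantum integer.

    Both cases of the hypothesis say that l is the quantum characteristic of q,
    the least positive integer with [l] = 0 ([quantum_char_root]).  Then the
    Gaussian binomials [m; i] with i <= m < l are nonzero, and this allows one
    to split W m off any module whose largest weight is m < l
    ([top_weyl_retract]).  Hence a module with weights at most l - 2 is a direct
    sum of modules W m with m <= l - 2, which are simple, pairwise without
    nonzero maps and with scalar endomorphisms.

    The summand pr(V^n) is built by induction on n ([fusion_splitS]): tensor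
    pr(V^n) with V and split off the copies of the Steinberg module W (l - 1).
    What is discarded lies in the radical of the quantum trace form, because
    the quantum dimension of W (l - 1) is [l] = 0 and because the quantum trace
    of an endomorphism of M (x) V is that of its partial trace on M
    ([ptrace_hom], [qtrace_null_tens]).  As W m has quantum dimension
    [m + 1] <> 0 for m <= l - 2, it is not a summand of what is discarded, which
    is therefore negligible ([fusion_split_pr]).

    That the summands of V^n are tilting modules is a matter of counting
    ([Vpow_retract_tilting]).  Let c_m(M) be the number of independent
    functionals of weight m on M that vanish on the images of all F^(r), r > 0.
    Dividing by submodules generated by vectors of maximal weight shows that
    dim M <= sum_m (m + 1) c_m(M), and that equality forces a Weyl filtration.
    Equality holds for V^n and its dual since
    c_w(M (x) V) <= c_(w-1)(M) + c_(w+1)(M), and it passes to direct summands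
    since the right-hand side is superadditive.

    For m <= l - 2 the inclusion of pr(V^n) in V^n induces an isomorphism from
    Hom(W m, pr(V^n)) to D_n(m) ([jres_can]): W m is isomorphic to its dual, a
    nonzero map from W m to pr(V^n) has a left inverse, whereas the negligible
    summand only contributes to the radical of the cell form.  By semisimplicity
    of pr(V^n) the nonzero ones among these Hom-spaces are the simple modules of
    the algebra of endomorphisms of pr(V^n).  The dimension of
    Hom(W m, pr(V^n)) is the multiplicity of W m, that is the drop of the weight
    multiplicities of pr(V^n) from m to m + 2 ([weyl_hom_dim]).  Tensoring with V
    shifts weights by 1 and by -1, and Steinberg modules have no drop at
    m <= l - 2, whence the recursion ([jones_dimS]). *)

Set Implicit Arguments.
Unset Strict Implicit.
Unset Printing Implicit Defensive.

Import GRing.Theory Num.Theory Order.TTheory.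

Local Open Scope ring_scope.

(** * Gaussian binomials *)

Section QBin.
Variables (k : fieldType) (q : k).
Hypothesis q0 : q != 0.

Lemma qbinn0 n : qbinn q n 0 = 1.
Proof. by case: n. Qed.

Lemma qbinnS n t : qbinn q n.+1 t.+1 =
  q ^+ t.+1 * qbinn q n t.+1 + q ^- (n - t) * qbinn q n t.
Proof. by []. Qed.

Lemma qbinn_small n t : (n < t)%N -> qbinn q n t = 0.
Proof.
elim: n t => [|n IH] [|t] //= lt; rewrite !IH ?mulr0 ?addr0 //.
by rewrite ltnW.
Qed.

Lemma qbinnn n : qbinn q n n = 1.
Proof.
elim: n => [|n IH] //; rewrite qbinnS IH qbinn_small // subnn mulr0 add0r.
by rewrite expr0 invr1 mulr1.
Qed.

Lemma qzM (a b : int) x : q ^ a * (q ^ b * x) = q ^ (a + b) * x.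
Proof. by rewrite mulrA -expfzDr. Qed.

Lemma qbinn_pascal n t : qbinn q n.+1 t.+1 =
  q ^ (t.+1%:Z) * qbinn q n t.+1 + q ^ (t%:Z - n%:Z) * qbinn q n t.
Proof.
rewrite qbinnS; case: (leqP t n) => h; last first.
  by rewrite [qbinn q n t]qbinn_small // !mulr0.
by rewrite -opprB subzn // -exprnN.
Qed.

(** Gaussian binomials are invariant under q |-> q^-1, which turns this rule into
    the previous one. *)
Lemma qbinn_pascal' n t : qbinn q n.+1 t.+1 =
  q ^ (- t.+1%:Z) * qbinn q n t.+1 + q ^ (n%:Z - t%:Z) * qbinn q n t.
Proof.
elim: n t => [|n IH] [|t].
- by rewrite !qbinn_pascal qbinn_small // !mulr0 !add0r.
- by rewrite !qbinn_pascal !qbinn_small // !mulr0.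
- rewrite qbinn_pascal [in LHS]IH [in RHS]qbinn_pascal !qbinn0 !mulr1.
  rewrite !mulrDr !qzM -!expfzDr // subrr addNr !expr0z !mul1r.
  rewrite -!addrA; congr (_ + _).
  by rewrite [in RHS]addrC; congr (_ + _); congr (q ^ _); lia.
- rewrite qbinn_pascal [in LHS]IH [X in _ + _ * X = _]IH.
  rewrite [qbinn q n.+1 t.+2 in RHS]qbinn_pascal
          [qbinn q n.+1 t.+1 in RHS]qbinn_pascal.
  rewrite !mulrDr !qzM.
  rewrite [in RHS]addrACA.
  by congr (_ + _ + (_ + _)); congr (q ^ _ * _); lia.
Qed.

Lemma qbinn_exact_pos (a : int) n t : a = n%:Z -> qbin q a t = qbinn q n t.
Proof. by move=> ->. Qed.

Lemma qbin_neg n t : qbin q (- n.+1%:Z) t = (-1) ^+ t * qbinn q (n + t) t.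
Proof. by rewrite -NegzE. Qed.

Lemma qbin_0 a : qbin q a 0 = 1.
Proof. by case: a => n /=; rewrite ?qbinn0 ?mulr1. Qed.

Lemma qbin_pascal (a : int) t : qbin q (a + 1) t.+1 =
  q ^ (t.+1%:Z) * qbin q a t.+1 + q ^ (t%:Z - a) * qbin q a t.
Proof.
case: a => n.
  have -> : n%:Z + 1 = n.+1%:Z by lia.
  exact: qbinn_pascal.
case: n => [|n].
  have -> : Negz 0 + 1 = 0%:Z by [].
  have -> : Negz 0 = - 1%:Z by [].
  rewrite !qbin_neg !add0n !qbinnn !mulr1 exprS mulN1r mulrN opprK.
  have -> : t%:Z + 1%:Z = t.+1%:Z by lia.
  by rewrite addNr.
have -> : Negz n.+1 = - n.+2%:Z by lia.
have -> : - n.+2%:Z + 1 = - n.+1%:Z by lia.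
rewrite !qbin_neg exprS mulN1r.
have -> : (n.+1 + t.+1 = (n + t).+2)%N by lia.
have -> : (n.+1 + t = (n + t).+1)%N by lia.
have -> : (n + t.+1 = (n + t).+1)%N by lia.
rewrite [qbinn q (n + t).+2 _]qbinn_pascal'.
have h1 : q ^ t.+1%:Z * q ^ (- t.+1%:Z) = 1.
  by rewrite -expfzDr // subrr.
have -> : q ^ (t%:Z - - n.+2%:Z) = q ^ t.+1%:Z * q ^ ((n + t).+1%:Z - t%:Z).
  by rewrite -expfzDr //; congr (q ^ _); lia.
rewrite -[LHS]mul1r -h1.
move: (q ^ t.+1%:Z) (q ^ _) (q ^ _) => x y z; ring.
Qed.

Lemma qbin_pascal' (a : int) t : qbin q (a + 1) t.+1 =
  q ^ (- t.+1%:Z) * qbin q a t.+1 + q ^ (a - t%:Z) * qbin q a t.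
Proof.
case: a => n.
  have -> : n%:Z + 1 = n.+1%:Z by lia.
  exact: qbinn_pascal'.
case: n => [|n].
  have -> : Negz 0 + 1 = 0%:Z by [].
  have -> : Negz 0 = - 1%:Z by [].
  rewrite !qbin_neg !add0n !qbinnn !mulr1 exprS mulN1r mulrN.
  have -> : - 1%:Z - t%:Z = - t.+1%:Z by lia.
  by rewrite addNr.
have -> : Negz n.+1 = - n.+2%:Z by lia.
have -> : - n.+2%:Z + 1 = - n.+1%:Z by lia.
rewrite !qbin_neg exprS mulN1r.
have -> : (n.+1 + t.+1 = (n + t).+2)%N by lia.
have -> : (n.+1 + t = (n + t).+1)%N by lia.
have -> : (n + t.+1 = (n + t).+1)%N by lia.
rewrite [qbinn q (n + t).+2 _]qbinn_pascal.
have h1 : q ^ (- t.+1%:Z) * q ^ t.+1%:Z = 1.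
  by rewrite -expfzDr // addNr.
have -> : q ^ (- n.+2%:Z - t%:Z) = q ^ (- t.+1%:Z) * q ^ (t%:Z - (n + t).+1%:Z).
  by rewrite -expfzDr //; congr (q ^ _); lia.
rewrite -[LHS]mul1r -h1.
move: (q ^ t.+1%:Z) (q ^ _) (q ^ _) => x y z; ring.
Qed.

(** Vandermonde's convolution for two upper indices of sum 0.  It makes the
    coefficients of the formula for E^(r) F^(s) and those of the formula for
    F^(s) E^(r) inverse to each other. *)
Lemma qbin_vandermonde (a : int) (v : nat) :
  \sum_(t < v.+1) qbin q a t * qbin q (- a) (v - t) = (v == 0%N)%:R.
Proof.
wlog [n ->] : a / exists n, a = Posz n.
  move=> H; case: (leP 0 a) => [|lt]; first by case: a => // n _; apply: H; exists n.
  rewrite -(H (- a)); last by case: a lt => // n _; exists n.+1; rewrite NegzE opprK.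
  rewrite (reindex_inj rev_ord_inj) /=; apply: eq_bigr => i _.
  by rewrite opprK subSS subKn 1?mulrC // -ltnS.
elim: n => [|n IH].
  case: v => [|v]; first by rewrite big_ord1 oppr0 !qbin_0 mulr1.
  rewrite oppr0 big1 // => [[[|t] lt]] _ /=; rewrite ?mul0r //.
  by rewrite mulr0.
case: v IH => [|v] IH; first by rewrite big_ord1 subn0 !qbin_0 mulr1.
rewrite big_ord_recl qbin_0 mul1r subn0.
have -> : n.+1%:Z = n%:Z + 1 by lia.
pose S (c d : nat -> k) w := \sum_(t < w.+1) c t * d (w - t)%N.
pose A t := q ^ (- t%:Z) * qbin q n t.
pose B t := qbin q (- (n%:Z + 1)) t.
transitivity (S A B v.+1 + q ^ n%:Z * S A B v).
  have A0 : A 0%N = 1 by rewrite /A qbin_0 mulr1.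
  rewrite {1}/S [in RHS]big_ord_recl (A0 : A ord0 = 1) mul1r subn0 -addrA; congr (_ + _).
  rewrite mulr_sumr -big_split; apply: eq_bigr => i _.
  rewrite lift0 qbin_pascal' subSS mulrDl; congr (_ + _).
  by rewrite /A !mulrA; congr (_ * _ * _); rewrite -expfzDr.
transitivity (q ^ (- v.+1%:Z) * \sum_(t < v.+2) qbin q n t * qbin q (- n%:Z) (v.+1 - t)).
  rewrite /S [in LHS]big_ord_recr /= [in LHS]mulr_sumr [LHS]addrAC -big_split /=.
  rewrite [RHS]mulr_sumr [RHS]big_ord_recr /= !subnn !qbin_0 !mulr1.
  congr (_ + _); last by rewrite /A /B qbin_0 mulr1.
  apply: eq_bigr => i _; rewrite /A /B.
  have -> : (v.+1 - i = (v - i).+1)%N by have := ltn_ord i; lia.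
  have -> : - n%:Z = - (n%:Z + 1) + 1 by lia.
  rewrite qbin_pascal.
  have -> : q ^ (- v.+1%:Z) = q ^ (- i%:Z) * q ^ (- (v - i).+1%:Z).
    by rewrite -expfzDr //; congr (q ^ _); have := ltn_ord i; lia.
  have h1 : q ^ (- (v - i).+1%:Z) * q ^ ((v - i).+1%:Z) = 1.
    by rewrite -expfzDr // addNr.
  have -> : q ^ n%:Z = q ^ (- (v - i).+1%:Z) * q ^ ((v - i)%:Z - - (n%:Z + 1)).
    by rewrite -expfzDr //; congr (q ^ _); lia.
  rewrite -[X in X + _ = _]mul1r -h1 -[qbinn q n i]/(qbin q n i).
  move: (qbin _ _ _) (qbin _ _ _) (qbin _ _ _) => x y z.
  move: (q ^ _) (q ^ _) (q ^ _) (q ^ _) => b c d e; ring.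
by rewrite IH mulr0.
Qed.

Lemma qbinn_sym n t : (t <= n)%N -> qbinn q n t = qbinn q n (n - t).
Proof.
elim: n t => [|n IH] [|t] // le; first by rewrite subn0 qbinnn qbinn0.
rewrite subSS qbinn_pascal; case: (ltnP t n) => lt; last first.
  have -> : t = n by lia.
  by rewrite qbinn_small // mulr0 add0r subrr expr0z mul1r subnn qbinn0 qbinnn.
have -> : (n - t = (n - t.+1).+1)%N by lia.
rewrite qbinn_pascal' IH // (IH t) ?(ltnW lt) // addrC.
have -> : (n - t = (n - t.+1).+1)%N by lia.
by congr (q ^ _ * _ + q ^ _ * _); lia.
Qed.

(** Both sides are the Gaussian trinomial of a, b, c.  As factorials may vanish at
    q, the proof uses Pascal's rule only. *)
Lemma qbinn_trinomial a b c :
  qbinn q (a + b + c) (a + b) * qbinn q (a + b) a =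
  qbinn q (a + b + c) a * qbinn q (b + c) b.
Proof.
have [N] := ubnP (a + b + c); elim: N a b c => // N IH a b c lt.
case: a lt => [|a] lt; first by rewrite !add0n !qbinn0 mul1r mulr1.
case: b lt => [|b] lt; first by rewrite addn0 qbinnn qbinn0.
case: c lt => [|c] lt; first by rewrite !addn0 !qbinnn mul1r mulr1.
have IHa := IH a b.+1 c.+1 ltac:(lia).
have IHb := IH a.+1 b c.+1 ltac:(lia).
have IHc := IH a.+1 b.+1 c ltac:(lia).
move: IHa IHb IHc.
set n := (a + b + c).+2.
have -> : (a + b.+1 + c.+1 = n)%N by rewrite /n; lia.
have -> : (a.+1 + b + c.+1 = n)%N by rewrite /n; lia.
have -> : (a.+1 + b.+1 + c = n)%N by rewrite /n; lia.
have -> : (a.+1 + b.+1 + c.+1 = n.+1)%N by rewrite /n; lia.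
have -> : (a.+1 + b.+1 = (a + b).+2)%N by lia.
have -> : (a.+1 + b = (a + b).+1)%N by lia.
have -> : (a + b.+1 = (a + b).+1)%N by lia.
have -> : (b + c.+1 = (b + c).+1)%N by lia.
have -> : (b.+1 + c = (b + c).+1)%N by lia.
have -> : (b.+1 + c.+1 = (b + c).+2)%N by lia.
move=> IHa IHb IHc.
(* Pascal's rule leaves three products on each side, which match by the three
   induction hypotheses. *)
rewrite [qbinn q n.+1 _]qbinn_pascal mulrDl.
rewrite [X in _ + X](_ : _ = q ^ ((a + b).+1%:Z - n%:Z) * qbinn q n (a + b).+1
   * (q ^ a.+1%:Z * qbinn q (a + b).+1 a.+1 +
      q ^ (a%:Z - (a + b).+1%:Z) * qbinn q (a + b).+1 a)); last first.
  by rewrite [qbinn q (a + b).+2 _]qbinn_pascal.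
rewrite [qbinn q n.+1 _]qbinn_pascal [in RHS]mulrDl.
rewrite [X in _ = X + _](_ : _ = q ^ a.+1%:Z * qbinn q n a.+1
   * (q ^ b.+1%:Z * qbinn q (b + c).+1 b.+1 +
      q ^ (b%:Z - (b + c).+1%:Z) * qbinn q (b + c).+1 b)); last first.
  by rewrite [qbinn q (b + c).+2 _]qbinn_pascal.
have e1 : q ^ (a + b).+2%:Z = q ^ a.+1%:Z * q ^ b.+1%:Z.
  by rewrite -expfzDr //; congr (q ^ _); lia.
have e2 : q ^ ((a + b).+1%:Z - n%:Z) * q ^ a.+1%:Z =
          q ^ a.+1%:Z * q ^ (b%:Z - (b + c).+1%:Z).
  by rewrite -!expfzDr //; congr (q ^ _); rewrite /n; lia.
have e3 : q ^ ((a + b).+1%:Z - n%:Z) * q ^ (a%:Z - (a + b).+1%:Z) =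
          q ^ (a%:Z - n%:Z).
  by rewrite -!expfzDr //; congr (q ^ _); rewrite /n; lia.
rewrite e1 -e3; move: e2 IHa IHb IHc.
do ![move: (qbinn _ _ _)] => x1 x2 x3 x4 x5 x6 x7 x8 x9.
do ![move: (q ^ _)] => y1 y2 y3 y4 y5 e a1 b1 c1 d1.
transitivity (y4 * y2 * (x3 * x2) + y5 * y4 * (e * x6) + y5 * y1 * (e * x9)).
  by ring.
by rewrite a1 b1 c1 d1; ring.
Qed.

Lemma qbinn_unbounded_neq0 t B : exists2 n, (B <= n)%N & qbinn q n t != 0.
Proof.
elim: t => [|t [n le nz]]; first by exists B; rewrite // qbinn0 oner_neq0.
have [z|] := eqVneq (qbinn q n t.+1) 0; last by exists n.
exists n.+1; first exact: leqW.
by rewrite qbinn_pascal z mulr0 add0r mulf_neq0 ?expfz_neq0.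
Qed.

(** On a vector of highest weight - n - 1 these are the scalars of E^(r) F^(r);
    they exclude negative highest weights in finite dimension. *)
Lemma qbin_neg_neq0 (n B : nat) :
  exists2 r, (B <= r)%N & qbin q (- n.+1%:Z) r != 0.
Proof.
have [m le nz] := qbinn_unbounded_neq0 n (n + B).
exists (m - n)%N; first lia.
rewrite qbin_neg mulf_neq0 ?signr_eq0 // qbinn_sym ?leq_addl //.
by rewrite subnKC ?subKn //; lia.
Qed.

Lemma qbin_small (a : int) t : 0 <= a -> a < t%:Z -> qbin q a t = 0.
Proof. by case: a => n // _ lt; apply: qbinn_small. Qed.

Lemma qintS n : qbinn q n.+1 1 = q * qbinn q n 1 + q ^ (- n%:Z).
Proof. by rewrite qbinn_pascal qbinn0 mulr1 sub0r. Qed.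

Lemma qint_sub n : qbinn q n 1 * (q - q^-1) = q ^ n%:Z - q ^ (- n%:Z).
Proof.
elim: n => [|n IH]; first by rewrite mul0r oppr0 subrr.
have e1 : q ^ n.+1%:Z = q * q ^ n%:Z by rewrite -[X in X * _]expr1z -expfzDr.
have e2 : q ^ (- n.+1%:Z) = q^-1 * q ^ (- n%:Z).
  by rewrite -exprN1 -expfzDr //; congr (q ^ _); lia.
rewrite qintS mulrDl -mulrA IH e1 e2; ring.
Qed.

(** The left-hand side is the quantum dimension of the Weyl module of highest
    weight n. *)
Lemma qint_trace n : \sum_(i < n.+1) q ^ ((2 * i)%:Z - n%:Z) = qbinn q n.+1 1.
Proof.
elim: n => [|n IH]; first by rewrite big_ord1 qbinnn subrr expr0z.
rewrite qintS big_ord_recl addrC -IH mulr_sumr; congr (_ + _); last first.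
  by congr (q ^ _); rewrite muln0; lia.
apply: eq_bigr => i _; rewrite -[X in X * _]expr1z -expfzDr // lift0.
by congr (q ^ _); lia.
Qed.

(** The quantum characteristic of q: in both cases of the hypothesis on q, only
    this property of l matters. *)
Definition quantum_char (l : nat) : Prop :=
  [/\ (1 < l)%N, qbinn q l 1 = 0 &
      forall j, (0 < j < l)%N -> qbinn q j 1 != 0].

(** Induction from the identity [m + 1; i + 1] [i + 1] = [m + 1] [m; i]. *)
Lemma quantum_char_binn l m i : quantum_char l ->
  (i <= m < l)%N -> qbinn q m i != 0.
Proof.
move=> [_ _ nz]; elim: i m => [|i IH] [|m] /andP[le lt] //.
- by rewrite qbinn0 oner_neq0.
- by rewrite qbinn0 oner_neq0.
have := qbinn_trinomial 1 i (m - i).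
rewrite !add1n addSn subnKC //.
move=> e; have : qbinn q m.+1 1 * qbinn q m i != 0.
  by rewrite mulf_neq0 ?nz ?IH // (ltnW lt) andbT.
by rewrite -e mulf_eq0 negb_or => /andP[].
Qed.

End QBin.

(** If q^2 is a primitive root of unity, [j] (q - q^-1) = q^j - q^-j vanishes
    exactly when q^(2j) = 1; if q = 1, then [j] is the image of j in k. *)
Lemma quantum_char_root (k : fieldType) (q : k) (l : nat) :
  (l.-primitive_root (q ^+ 2) /\ (1 < l)%N) \/ (q = 1 /\ l \in [pchar k]) ->
  q != 0 /\ quantum_char q l.
Proof.
case=> [[pr lt]|[-> ch]].
  have q0 : q != 0.
    apply/eqP => q0; have := prim_expr_order pr.
    rewrite q0 expr2 mul0r expr0n; case: l lt {pr} => //= l _ /eqP.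
    by rewrite eq_sym oner_eq0.
  have qq : q - q^-1 != 0.
    rewrite subr_eq0; apply/eqP => e.
    have e2 : q ^+ 2 = 1 by rewrite expr2 {1}e mulVf.
    have := prim_order_dvd pr 1; rewrite expr1 e2 eqxx dvdn1 => /eqP l1.
    by rewrite l1 in lt.
  have key j : (qbinn q j 1 == 0) = (l %| j)%N.
    rewrite -(inj_eq (mulIf qq)) mul0r qint_sub // subr_eq0.
    rewrite (prim_order_dvd pr) -exprM.
    rewrite -(inj_eq (mulIf (expfz_neq0 (j%:Z) q0))) -!expfzDr // addNr expr0z.
    by rewrite -PoszD addnn -mul2n.
  split=> //; split=> // [|j /andP[j0 jl]].
    by apply/eqP; rewrite key.
  by rewrite key gtnNdvd.
split; first exact: oner_neq0.
have key j : qbinn (1 : k) j 1 = j%:R.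
  by elim: j => // j IH; rewrite qintS ?oner_neq0 // exp1rz IH mul1r -natr1.
split; first exact: prime_gt1 (pcharf_prime ch).
  by rewrite key; apply: pcharf0.
by move=> j /andP[j0 jl]; rewrite key -(dvdn_pcharf ch) gtnNdvd.
Qed.

(** * Homomorphisms, kernels and direct summands *)

Section Operators.
Variable k : fieldType.
Implicit Types M N S : uqrep k.

Definition wfun M (h : int -> k) : 'M[k]_(udim M) :=
  diag_mx (\row_i h (uwt M i)).

Definition wproj M (w : int) : 'M[k]_(udim M) :=
  wfun M (fun x => (x == w)%:R).

Lemma mul_wfun M p (A : 'M[k]_(p, udim M)) h i j :
  (A *m wfun M h) i j = A i j * h (uwt M j).
Proof. by rewrite mul_mx_diag !mxE. Qed.

Lemma wfun_mul M p (A : 'M[k]_(udim M, p)) h i j :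
  (wfun M h *m A) i j = h (uwt M i) * A i j.
Proof. by rewrite mul_diag_mx !mxE. Qed.

Lemma wfun_proj M h w : wfun M h *m wproj M w = h w *: wproj M w.
Proof.
apply/matrixP => i j; rewrite mul_wfun !mxE.
have [->|] := eqVneq i j; last by rewrite !mulr0n mul0r mulr0.
by have [->|] := eqVneq (uwt M j) w; rewrite ?mulr0 ?mulr1 ?mul0rn ?mulr0 //= mulr1n mulr1.
Qed.

Lemma proj_wfun M h w : wproj M w *m wfun M h = h w *: wproj M w.
Proof. by apply: trmx_inj; rewrite trmx_mul !tr_diag_mx wfun_proj linearZ /= tr_diag_mx. Qed.

Lemma wproj_proj M w w' :
  wproj M w *m wproj M w' = if w == w' then wproj M w else 0.
Proof.
rewrite wfun_proj [in RHS]eq_sym; case: eqP => [->|_]; first by rewrite scale1r.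
by rewrite scale0r.
Qed.

Lemma wproj_ext M p (A B : 'M[k]_(p, udim M)) :
  (forall w, A *m wproj M w = B *m wproj M w) -> A = B.
Proof.
move=> H; apply/matrixP => i j; have /matrixP/(_ i j) := H (uwt M j).
by rewrite !mul_wfun eqxx !mulr1.
Qed.

Lemma tr_wfun M h : (wfun M h)^T = wfun M h.
Proof. exact: tr_diag_mx. Qed.

Definition weights M : seq int := undup [seq uwt M i | i <- enum 'I_(udim M)].

Lemma mem_weights M i : uwt M i \in weights M.
Proof. by rewrite mem_undup; apply: map_f; rewrite mem_enum. Qed.

Lemma sum_wproj M : \sum_(w <- weights M) wproj M w = 1%:M.
Proof.
apply/matrixP => i j; rewrite summxE.
rewrite (bigD1_seq (uwt M j)) ?undup_uniq ?mem_weights //= big1 ?addr0 => [|w ne].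
  by rewrite !mxE; have [->|] := eqVneq i j; rewrite ?eqxx.
by rewrite !mxE; have [->|//] := eqVneq i j; rewrite eq_sym (negPf ne).
Qed.

(** The torus is represented by the projections onto weight spaces, so that
    homomorphisms are exactly the linear maps that commute with all generators. *)
Variant gen := GenP of int | GenE of nat | GenF of nat.

Definition act M (g : gen) : 'M[k]_(udim M) :=
  match g with GenP w => wproj M w | GenE r => uE M r | GenF r => uF M r end.

Lemma hom_wfun M N (f : 'M[k]_(udim N, udim M)) h :
  is_uqhom f -> f *m wfun M h = wfun N h *m f.
Proof.
move=> [fw _ _]; apply/matrixP => i j; rewrite mul_wfun wfun_mul mulrC.
by have [->|/fw ->//] := eqVneq (f i j) 0; rewrite !mulr0.
Qed.

Lemma graded_wproj M N (f : 'M[k]_(udim N, udim M)) (d : int) :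
  (forall i j, f i j != 0 -> uwt N i = uwt M j + d) <->
  (forall w, f *m wproj M w = wproj N (w + d) *m f).
Proof.
split=> H.
  move=> w; apply/matrixP => i j; rewrite mul_wfun wfun_mul mulrC.
  have [->|/H ->] := eqVneq (f i j) 0; first by rewrite !mulr0.
  by rewrite (inj_eq (addIr _)).
move=> i j nz; have /matrixP/(_ i j) := H (uwt M j).
rewrite mul_wfun wfun_mul eqxx mulr1.
by case: eqP => // _ /eqP; rewrite mul0r (negPf nz).
Qed.

Lemma uqhomE M N (f : 'M[k]_(udim N, udim M)) :
  is_uqhom f <-> forall g, f *m act M g = act N g *m f.
Proof.
split=> [fh [w|r|r]|H]; rewrite /= ?hom_wfun //; try by case: fh.
split=> [i j|r|r]; [|exact: (H (GenE r))|exact: (H (GenF r))].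
rewrite -[uwt M j]addr0; apply/graded_wproj: i j => w.
by rewrite addr0; apply: (H (GenP w)).
Qed.

Lemma uqhom_id M : is_uqhom (1%:M : 'M[k]_(udim M)).
Proof. by apply/uqhomE => g; rewrite mul1mx mulmx1. Qed.

Lemma uqhom_0 M N : is_uqhom (0 : 'M[k]_(udim N, udim M)).
Proof. by apply/uqhomE => g; rewrite mul0mx mulmx0. Qed.

Lemma uqhomD M N (f g : 'M[k]_(udim N, udim M)) :
  is_uqhom f -> is_uqhom g -> is_uqhom (f + g).
Proof.
by move=> /uqhomE hf /uqhomE hg; apply/uqhomE => a; rewrite mulmxDl mulmxDr hf hg.
Qed.

Lemma uqhomZ M N c (f : 'M[k]_(udim N, udim M)) :
  is_uqhom f -> is_uqhom (c *: f).
Proof.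
by move=> /uqhomE hf; apply/uqhomE => a; rewrite -scalemxAl hf -scalemxAr.
Qed.

Lemma uqhomB M N (f g : 'M[k]_(udim N, udim M)) :
  is_uqhom f -> is_uqhom g -> is_uqhom (f - g).
Proof.
by move=> hf hg; apply: uqhomD => //; rewrite -scaleN1r; apply: uqhomZ.
Qed.

Lemma uqhom_factor_inj M N S (i : 'M[k]_(udim M, udim S))
    (r : 'M[k]_(udim S, udim M)) (f : 'M[k]_(udim S, udim N)) :
  is_uqhom i -> r *m i = 1%:M -> is_uqhom (i *m f) -> is_uqhom f.
Proof.
move=> /uqhomE hi ri /uqhomE hf; apply/uqhomE => g.
rewrite -[LHS]mul1mx -[RHS]mul1mx -ri -!mulmxA; congr (_ *m _).
by rewrite mulmxA hf mulmxA [RHS]mulmxA hi.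
Qed.

(** The kernel of h is spanned by weight vectors, since h commutes with the
    projections onto weight spaces.  Over a field the inclusion i has a linear
    left inverse r, through which the operators are transported. *)
Lemma uqhom_kernel M N (h : 'M[k]_(udim N, udim M)) : is_uqhom h ->
  exists (S : uqrep k) (i : 'M[k]_(udim M, udim S)) (r : 'M[k]_(udim S, udim M)),
    [/\ is_uqhom i, r *m i = 1%:M, h *m i = 0 &
        forall p (x : 'M[k]_(udim M, p)), h *m x = 0 -> i *m (r *m x) = x].
Proof.
move=> hh; have /uqhomE hg := hh.
pose n := udim M; pose K := kermx h^T.
(* The rows of H are the weight components of a spanning set of the kernel. *)
pose H : 'M[k]_(n * n, n) := \matrix_(x, j)
  (K (mxtens_unindex x).1 j * (uwt M j == uwt M (mxtens_unindex x).2)%:R).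
have rowH a i : row (mxtens_index (a, i)) H = row a (K *m wproj M (uwt M i)).
  by apply/rowP => j; rewrite [RHS]mxE mul_wfun [LHS]mxE [LHS]mxE mxtens_indexK.
have KP w : K *m wproj M w *m h^T = 0.
  rewrite -mulmxA -[wproj M w]tr_wfun -trmx_mul (hg (GenP w)) trmx_mul tr_wfun.
  by rewrite mulmxA mulmx_ker mul0mx.
have Hh : H *m h^T = 0.
  apply/row_matrixP => x; case: (mxtens_indexP x) => a i.
  by rewrite row_mul rowH -row_mul KP !row0.
have KH : (K <= H)%MS.
  rewrite -[K]mulmx1 -sum_wproj mulmx_sumr.
  rewrite big_seq; apply: (big_ind (fun X => (X <= H)%MS)); first exact: sub0mx.
    by move=> X Y; apply: addmx_sub.
  move=> w; rewrite mem_undup => /mapP[i _ ->]; apply/row_subP => a.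
  by rewrite -rowH row_sub.
pose B := rowsub (maxrankfun H) H.
have Bf : row_free B by apply: maxrowsub_free.
have BH : (B :=: H)%MS by apply: eq_maxrowsub.
pose wt (c : 'I_(\rank H)) := uwt M (mxtens_unindex (maxrankfun H c)).2.
pose i : 'M[k]_(n, \rank H) := B^T.
pose r : 'M[k]_(\rank H, n) := (pinvmx B)^T.
have ri : r *m i = 1%:M by rewrite -trmx_mul mulmxVp // trmx1.
have hi : h *m i = 0.
  apply: trmx_inj; rewrite trmx_mul trmxK trmx0.
  have /submxP[D ->] : (B <= H)%MS by rewrite BH.
  by rewrite -mulmxA Hh mulmx0.
have comp p (x : 'M[k]_(n, p)) : h *m x = 0 -> i *m (r *m x) = x.
  move=> hx; apply: trmx_inj; rewrite !trmx_mul !trmxK mulmxKpV // BH.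
  apply: submx_trans KH; apply/sub_kermxP.
  by rewrite -trmx_mul hx trmx0.
pose S := UqRep wt (fun s => r *m uE M s *m i) (fun s => r *m uF M s *m i).
exists S, i, r; split => //.
have key g : h *m (act M g *m i) = 0 by rewrite mulmxA hg -mulmxA hi mulmx0.
split=> [a c|s|s].
- have -> : i a c = K (mxtens_unindex (maxrankfun H c)).1 a * (uwt M a == wt c)%:R.
    by rewrite mxE mxE mxE.
  by have [-> //|_] := eqVneq (uwt M a) (wt c); rewrite mulr0 eqxx.
- by rewrite /= -!mulmxA; apply: comp; apply: (key (GenE s)).
- by rewrite /= -!mulmxA; apply: comp; apply: (key (GenF s)).
Qed.

(** The transposed operators.  Homomorphisms make sense without the relations,
    so that this is enough to turn cokernels into kernels. *)
Definition utr M : uqrep k :=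
  UqRep (@uwt _ M) (fun r => (uE M r)^T) (fun r => (uF M r)^T).

Lemma act_utr M g : act (utr M) g = (act M g)^T.
Proof. by case: g => //= w; rewrite tr_wfun. Qed.

Lemma uqhom_tr M N (f : 'M[k]_(udim N, udim M)) :
  is_uqhom f -> @is_uqhom k (utr N) (utr M) f^T.
Proof.
move=> /uqhomE hf; apply/uqhomE => g; rewrite !act_utr.
by apply: trmx_inj; rewrite !trmx_mul !trmxK hf.
Qed.

Lemma uqhom_tr' M N (f : 'M[k]_(udim (utr M), udim N)) :
  is_uqhom f -> @is_uqhom k M (utr N) f^T.
Proof.
move=> /uqhomE hf; apply/uqhomE => g; rewrite act_utr -[act M g]trmxK.
by rewrite -act_utr -!trmx_mul hf.
Qed.

Lemma uqhom_cokernel M N (h : 'M[k]_(udim N, udim M)) : is_uqhom h ->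
  exists (S : uqrep k) (g : 'M[k]_(udim S, udim N)) (s : 'M[k]_(udim N, udim S)),
    [/\ is_uqhom g, g *m s = 1%:M, g *m h = 0 &
        forall v : 'cV[k]_(udim N), g *m v = 0 -> exists u, h *m u = v].
Proof.
move=> /uqhom_tr /uqhom_kernel[S [i [r [hi ri ti comp]]]].
have gh : i^T *m h = 0 by apply: trmx_inj; rewrite trmx_mul trmxK trmx0.
exists (utr S), i^T, r^T; split=> //; first exact: uqhom_tr'.
  by rewrite -trmx_mul ri trmx1.
move=> v iv; have vi : v^T *m i = 0.
  by apply: trmx_inj; rewrite trmx_mul trmxK trmx0.
have : (v^T <= h^T)%MS.
  rewrite submxE -[cokermx _](comp _ _ (mulmx_coker _)); apply/eqP.
  transitivity (v^T *m i *m (r *m cokermx h^T)); first exact: mulmxA.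
  by rewrite vi mul0mx.
by case/submxP => D e; exists D^T; rewrite -[v]trmxK e trmx_mul trmxK.
Qed.

Definition retract X M := exists (i : 'M[k]_(udim M, udim X)) p,
  [/\ is_uqhom i, is_uqhom p & p *m i = 1%:M].

(** The image of an idempotent e is the kernel of 1 - e. *)
Lemma uqhom_split_idem M (e : 'M[k]_(udim M)) : is_uqhom e -> e *m e = e ->
  exists (X : uqrep k) (i : 'M[k]_(udim M, udim X)) (p : 'M[k]_(udim X, udim M)),
    [/\ is_uqhom i, is_uqhom p, p *m i = 1%:M & i *m p = e].
Proof.
move=> he ee; have [X [i [r [hi ri ei comp]]]] :=
  uqhom_kernel (uqhomB (uqhom_id M) he).
have ie : e *m i = i.
  by apply/esym/eqP; rewrite -subr_eq0 -{1}[i]mul1mx -mulmxBl ei.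
have ip : i *m (r *m e) = e by apply: comp; rewrite mulmxBl mul1mx ee subrr.
exists X, i, (r *m e); split => //; last by rewrite -mulmxA ie.
by apply: (uqhom_factor_inj hi ri); rewrite ip.
Qed.

Lemma retract_biproduct M X (i : 'M[k]_(udim M, udim X)) p :
  is_uqhom i -> is_uqhom p -> p *m i = 1%:M ->
  exists Y iY pY, @biproduct k M X Y i p iY pY.
Proof.
move=> hi hp pi; have he : is_uqhom (1%:M - i *m p).
  by apply: uqhomB; [exact: uqhom_id|exact: is_uqhom_comp].
have [|Y [iY [pY [hiY hpY piY ipY]]]] := uqhom_split_idem he.
  rewrite mulmxBr mulmx1 mulmxBl mul1mx -mulmxA (mulmxA p) pi mul1mx subrr.
  by rewrite subr0.
by exists Y, iY, pY; split; split=> //; rewrite ipY addrC subrK.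
Qed.

Lemma retract_trans X N M : retract X N -> retract N M -> retract X M.
Proof.
move=> [i [p [hi hp pi]]] [i' [p' [hi' hp' pi']]].
exists (i' *m i), (p *m p'); split; try exact: is_uqhom_comp.
by rewrite mulmxA -(mulmxA p) pi' mulmx1.
Qed.

Lemma dsum_retract M X Y : is_dsum M X Y -> retract X M /\ retract Y M.
Proof.
by move=> [iX [pX [iY [pY [[? ? ? ?] [? ? ?]]]]]]; split;
   [exists iX, pX|exists iY, pY].
Qed.

Lemma retract_dsum X M : retract X M -> exists Y, is_dsum M X Y.
Proof.
move=> [i [p [hi hp pi]]]; have [Y [iY [pY b]]] := retract_biproduct hi hp pi.
by exists Y, i, p, iY, pY.
Qed.

Lemma biproduct_orth M X Y iX pX iY pY : @biproduct k M X Y iX pX iY pY ->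
  pY *m iX = 0 /\ pX *m iY = 0.
Proof.
move=> [_ [px py e]]; split.
  have : pY *m (iX *m pX + iY *m pY) *m iX = pY *m iX by rewrite e mulmx1.
  rewrite mulmxDr mulmxDl !mulmxA py mul1mx -[X in X + _]mulmxA px mulmx1.
  by rewrite -[RHS]add0r => /addIr.
have : pX *m (iX *m pX + iY *m pY) *m iY = pX *m iY by rewrite e mulmx1.
rewrite mulmxDr mulmxDl !mulmxA px mul1mx -[X in _ + X]mulmxA py mulmx1.
by rewrite -[RHS]add0r => /addIr.
Qed.

Lemma biproduct_dim M X Y iX pX iY pY : @biproduct k M X Y iX pX iY pY ->
  udim M = (udim X + udim Y)%N.
Proof.
move=> b; have [o1 o2] := biproduct_orth b; case: b => _ [px py e].
apply/eqP; rewrite eqn_leq; apply/andP; split.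
  have : row_mx iX iY *m col_mx pX pY = 1%:M by rewrite mul_row_col.
  move=> h; have := mulmx_max_rank (row_mx iX iY) (col_mx pX pY).
  by rewrite h mxrank1.
have : col_mx pX pY *m row_mx iX iY = 1%:M.
  by rewrite mul_col_row px py o1 o2 -scalar_mx_block.
move=> h; have := mulmx_max_rank (col_mx pX pY) (row_mx iX iY).
by rewrite h mxrank1.
Qed.

End Operators.

(** * Relations on weight spaces *)

Section LoweredIndex.
Variable k : fieldType.

(** Divided powers with the index lowered by t, extended by zero: this removes
    all truncations from the commutation formula of E and F. *)
Definition dn n (X : nat -> 'M[k]_n) (r t : nat) : 'M[k]_n :=
  if (t <= r)%N then X (r - t)%N else 0.

Lemma dn0 n (X : nat -> 'M[k]_n) r : dn X r 0 = X r.
Proof. by rewrite /dn subn0. Qed.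

Lemma dnSS n (X : nat -> 'M[k]_n) r t : dn X r.+1 t.+1 = dn X r t.
Proof. by rewrite /dn ltnS subSS. Qed.

Lemma dn_sub n (X : nat -> 'M[k]_n) r a t : (a <= r)%N ->
  dn X (r - a) t = dn X r (a + t).
Proof.
move=> le; rewrite /dn subnDA.
by have -> : (t <= r - a)%N = (a + t <= r)%N by lia.
Qed.

Lemma dn_out n (X : nat -> 'M[k]_n) r t : (r < t)%N -> dn X r t = 0.
Proof. by rewrite /dn ltnNge; case: leqP. Qed.

Lemma dn_sum n p (X Y : nat -> 'M[k]_n) r s (c : nat -> k) (P : 'M[k]_(n, p)) N :
  (minn r s < N)%N ->
  \sum_(t < N) c t *: (dn X s t *m dn Y r t *m P) =
  \sum_(t < (minn r s).+1) c t *: (X (s - t)%N *m Y (r - t)%N *m P).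
Proof.
move=> lt; rewrite (big_ord_widen _ (fun t : nat =>
  c t *: (X (s - t)%N *m Y (r - t)%N *m P)) lt) [RHS]big_mkcond /=.
apply: eq_bigr => i _; rewrite ltnS leq_min /dn.
by do 2 case: leqP => _; rewrite ?mul0mx ?mulmx0 ?mul0mx ?scaler0.
Qed.

End LoweredIndex.

Section Modules.
Variables (k : fieldType) (q : k).
Implicit Types M S : uqrep k.

Lemma hom_dnE M (N : uqrep k) (f : 'M[k]_(udim N, udim M)) r t : is_uqhom f ->
  f *m dn (uE M) r t = dn (uE N) r t *m f.
Proof.
by move=> [_ fE _]; rewrite /dn; case: leqP; rewrite ?fE // mulmx0 mul0mx.
Qed.

Lemma hom_dnF M (N : uqrep k) (f : 'M[k]_(udim N, udim M)) r t : is_uqhom f ->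
  f *m dn (uF M) r t = dn (uF N) r t *m f.
Proof.
by move=> [_ _ fF]; rewrite /dn; case: leqP; rewrite ?fF // mulmx0 mul0mx.
Qed.

Local Notation P := wproj.
Local Notation E := uE.
Local Notation F := uF.

Lemma uE_wproj M r w : is_uqmod q M ->
  E M r *m P M w = P M (w + (2 * r)%:Z) *m E M r.
Proof. by move=> hM; move: w; apply/graded_wproj => i j; apply: (uE_wt hM). Qed.

Lemma uF_wproj M r w : is_uqmod q M ->
  F M r *m P M w = P M (w - (2 * r)%:Z) *m F M r.
Proof. by move=> hM; move: w; apply/graded_wproj => i j; apply: (uF_wt hM). Qed.

Lemma uKbin_proj M c t w :
  uKbin q M c t *m P M w = qbin q (w + c) t *: P M w.
Proof. exact: (wfun_proj M (fun x => qbin q (x + c) t)). Qed.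

Lemma uEF_wproj M r s w N : is_uqmod q M -> (minn r s < N)%N ->
  E M r *m F M s *m P M w = \sum_(t < N)
    qbin q (w + r%:Z - s%:Z) t *: (dn (F M) s t *m dn (E M) r t *m P M w).
Proof.
move=> hM lt; rewrite dn_sum // (uEF hM) mulmx_suml; apply: eq_bigr => t _.
rewrite -mulmxA uE_wproj // !mulmxA -[_ *m uKbin _ _ _ _ *m _]mulmxA.
rewrite uKbin_proj -scalemxAr -scalemxAl -!mulmxA -uE_wproj //.
congr (qbin q _ _ *: _); have := ltn_ord t; rewrite ltnS leq_min.
by move=> /andP[]; lia.
Qed.

Lemma uEF_dn M r s a b w N : is_uqmod q M -> (minn r s < N)%N ->
  dn (E M) r a *m dn (F M) s b *m P M w = \sum_(t < N)
    qbin q (w + (r%:Z - a%:Z) - (s%:Z - b%:Z)) t *: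
      (dn (F M) s (b + t) *m dn (E M) r (a + t) *m P M w).
Proof.
move=> hM lt.
have [ar|ar] := leqP a r; last first.
  rewrite dn_out // !mul0mx big1 // => t _.
  by rewrite [dn (E M) r _]dn_out ?mulmx0 ?mul0mx ?scaler0 // ltn_addr.
have [bs|bs] := leqP b s; last first.
  rewrite [dn _ s b]dn_out // mulmx0 !mul0mx big1 // => t _.
  by rewrite [dn (F M) s _]dn_out ?mul0mx ?scaler0 // ltn_addr.
rewrite -[a]addn0 -[b in dn _ s b]addn0 -!dn_sub // !dn0.
rewrite (uEF_wproj _ hM (N := N)); last first.
  by apply: leq_ltn_trans lt; rewrite leq_min; lia.
apply: eq_bigr => t _; rewrite addn0 !dn_sub //; congr (qbin q _ _ *: _); lia.
Qed.

(** On a weight space the operators [K; c; t] are scalars, which leaves relations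
    between divided powers only. *)
Lemma uqmod_intro M : uE M 0 = 1%:M -> uF M 0 = 1%:M ->
  (forall r w, E M r *m P M w = P M (w + (2 * r)%:Z) *m E M r) ->
  (forall r w, F M r *m P M w = P M (w - (2 * r)%:Z) *m F M r) ->
  (forall r s, E M r *m E M s = qbinn q (r + s) r *: E M (r + s)) ->
  (forall r s, F M r *m F M s = qbinn q (r + s) r *: F M (r + s)) ->
  (forall r s w, E M r *m F M s *m P M w = \sum_(t < (r + s).+1)
    qbin q (w + r%:Z - s%:Z) t *: (dn (F M) s t *m dn (E M) r t *m P M w)) ->
  is_uqmod q M.
Proof.
move=> hE0 hF0 EP FP EE FF EF; split => //.
- by move=> r i j; move: j i; apply/graded_wproj => w; apply: EP.
- by move=> r i j; move: j i; apply/graded_wproj => w; apply: FP.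
move=> r s; apply: wproj_ext => w; rewrite EF dn_sum; last first.
  by rewrite ltnS geq_min leq_addr.
rewrite mulmx_suml; apply: eq_bigr => t _.
rewrite -[in RHS]mulmxA EP !mulmxA -[_ *m uKbin _ _ _ _ *m _]mulmxA.
rewrite uKbin_proj -scalemxAr -scalemxAl -!mulmxA -EP //.
congr (qbin q _ _ *: _); have := ltn_ord t; rewrite ltnS leq_min.
by move=> /andP[]; lia.
Qed.

Lemma uqmod_sub M S (i : 'M[k]_(udim M, udim S)) r :
  is_uqmod q M -> is_uqhom i -> r *m i = 1%:M -> is_uqmod q S.
Proof.
move=> hM hi ri; have /uqhomE ig := hi.
have iE s : i *m E S s = E M s *m i := ig (GenE s).
have iF s : i *m F S s = F M s *m i := ig (GenF s).
have iP w : i *m P S w = P M w *m i := ig (GenP w).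
have inj p (X Y : 'M[k]_(udim S, p)) : i *m X = i *m Y -> X = Y.
  by move=> e; rewrite -[X]mul1mx -ri -mulmxA e mulmxA ri mul1mx.
apply: uqmod_intro => [||s w|s w|s t|s t|s t w]; apply: inj.
- by rewrite (iE 0%N) /= (uE0 hM) mul1mx mulmx1.
- by rewrite (iF 0%N) /= (uF0 hM) mul1mx mulmx1.
- by rewrite !mulmxA iE iP -!mulmxA iP iE /= !mulmxA uE_wproj.
- by rewrite !mulmxA iF iP -!mulmxA iP iF /= !mulmxA uF_wproj.
- by rewrite mulmxA iE -mulmxA iE -scalemxAr iE mulmxA /= (uEE hM) scalemxAl.
- by rewrite mulmxA iF -mulmxA iF -scalemxAr iF mulmxA /= (uFF hM) scalemxAl.
rewrite !mulmxA iE -(mulmxA _ i) iF !mulmxA -(mulmxA _ i) iP mulmxA.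
rewrite (@uEF_wproj M s t w (s + t).+1) //; last by rewrite ltnS geq_min leq_addr.
rewrite mulmx_sumr mulmx_suml; apply: eq_bigr => u _.
rewrite -scalemxAl -scalemxAr; congr (_ *: _).
have eF : i *m dn (F S) t u = dn (F M) t u *m i by apply: hom_dnF.
have eE : i *m dn (E S) s u = dn (E M) s u *m i by apply: hom_dnE.
by rewrite !mulmxA eF -(mulmxA _ i) eE mulmxA -(mulmxA _ i) iP mulmxA.
Qed.

Lemma uqmod_quot M S (p : 'M[k]_(udim S, udim M)) s :
  is_uqmod q M -> is_uqhom p -> p *m s = 1%:M -> is_uqmod q S.
Proof.
move=> hM hp ps; have /uqhomE pg := hp.
have pE r : E S r *m p = p *m E M r := esym (pg (GenE r)).
have pF r : F S r *m p = p *m F M r := esym (pg (GenF r)).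
have pP w : P S w *m p = p *m P M w := esym (pg (GenP w)).
have inj n (X Y : 'M[k]_(n, udim S)) : X *m p = Y *m p -> X = Y.
  by move=> e; rewrite -[X]mulmx1 -ps mulmxA e -mulmxA ps mulmx1.
apply: uqmod_intro => [||r w|r w|r t|r t|r t w]; apply: inj.
- by rewrite pE (uE0 hM) mul1mx mulmx1.
- by rewrite pF (uF0 hM) mul1mx mulmx1.
- by rewrite -!mulmxA pE pP !mulmxA pE pP -!mulmxA uE_wproj.
- by rewrite -!mulmxA pF pP !mulmxA pF pP -!mulmxA uF_wproj.
- by rewrite -mulmxA pE mulmxA pE -scalemxAl pE -mulmxA (uEE hM) scalemxAr.
- by rewrite -mulmxA pF mulmxA pF -scalemxAl pF -mulmxA (uFF hM) scalemxAr.
rewrite -!mulmxA pP (mulmxA (F S t)) pF !mulmxA pE -!mulmxA.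
rewrite (mulmxA (E M r)) (@uEF_wproj M r t w (r + t).+1) //; last by rewrite ltnS geq_min leq_addr.
rewrite mulmx_sumr mulmx_suml; apply: eq_bigr => u _.
rewrite -scalemxAl -scalemxAr; congr (_ *: _).
have eF : p *m dn (F M) t u = dn (F S) t u *m p by apply: hom_dnF.
have eE : p *m dn (E M) r u = dn (E S) r u *m p by apply: hom_dnE.
by rewrite -!mulmxA pP (mulmxA (dn (E S) r u)) -eE !mulmxA -eF.
Qed.

Lemma uqmod_retract M X : is_uqmod q M -> retract X M -> is_uqmod q X.
Proof. by move=> hM [i [p [hi hp pi]]]; apply: uqmod_sub hM hi pi. Qed.

End Modules.

(** * The tensor product with V *)

Section TensorV.
Variables (k : fieldType) (q : k).
Hypothesis q0 : q != 0.
Variable M : uqrep k.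

Local Notation P := wproj.
Local Notation E := uE.
Local Notation F := uF.
Local Notation V := (weyl q 1).
Local Notation T := (utens q M V).
Local Notation v0 := (ord0 : 'I_2).
Local Notation v1 := (ord_max : 'I_2).

(** The inclusions of M as M (x) x_0 and M (x) x_1. *)
Definition tinj (b : 'I_2) : 'M[k]_(udim T, udim M) :=
  \matrix_(x, i) (x == mxtens_index (i, b))%:R.

Lemma mul_tinj p (A : 'M[k]_(p, udim T)) b x i :
  (A *m tinj b) x i = A x (mxtens_index (i, b)).
Proof.
rewrite mxE (bigD1 (mxtens_index (i, b))) //= mxE eqxx mulr1 big1 ?addr0 //.
by move=> y ne; rewrite mxE (negPf ne) mulr0.
Qed.

Lemma tinj_mul p (A : 'M[k]_(udim M, p)) b i c j :
  (tinj b *m A) (mxtens_index (i, c)) j = (c == b)%:R * A i j.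
Proof.
rewrite mxE (bigD1 i) //= mxE (can_eq (@mxtens_indexK _ _)) xpair_eqE eqxx /=.
rewrite big1 ?addr0 // => h ne; rewrite mxE (can_eq (@mxtens_indexK _ _)).
by rewrite xpair_eqE eq_sym (negPf ne) mul0r.
Qed.

Lemma tinj_orth b c : (tinj b)^T *m tinj c = (b == c)%:R%:M.
Proof.
apply/matrixP => i j; rewrite mul_tinj !mxE (can_eq (@mxtens_indexK _ _)).
rewrite xpair_eqE eq_sym [c == b]eq_sym.
by case: (i == j); case: (b == c).
Qed.

Lemma tinj_sum : tinj v0 *m (tinj v0)^T + tinj v1 *m (tinj v1)^T = 1%:M.
Proof.
apply/matrixP => x y; case: (mxtens_indexP x) => i b.
rewrite mxE !tinj_mul !mxE; case: (mxtens_indexP y) => j c; rewrite !(can_eq (@mxtens_indexK _ _)) !xpair_eqE.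
rewrite [j == i]eq_sym; case: (i == j); rewrite /= ?mulr0 ?addr0 //.
by case: b => [[|[|//]] ?]; case: c => [[|[|//]] ?];
   rewrite /= ?mulr0 ?mul0r ?mulr1 ?addr0 ?add0r.
Qed.

Lemma tinj_ext p (A B : 'M[k]_(p, udim T)) :
  A *m tinj v0 = B *m tinj v0 -> A *m tinj v1 = B *m tinj v1 -> A = B.
Proof.
move=> e0 e1; rewrite -[A]mulmx1 -[B]mulmx1 -tinj_sum !mulmxDr !mulmxA.
by rewrite e0 e1.
Qed.

Lemma tens_tinj (A : 'M[k]_(udim M)) (B : 'M[k]_2) b :
  (A *t B) *m tinj b = B v0 b *: (tinj v0 *m A) + B v1 b *: (tinj v1 *m A).
Proof.
apply/matrixP => x i; rewrite mul_tinj; case: (mxtens_indexP x) => j c.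
rewrite [LHS]mxE !mxtens_indexK [RHS]mxE [X in X + _]mxE [X in _ + X]mxE.
rewrite !tinj_mul /=.
have : c = v0 \/ c = v1.
  by case: c => [[|[|//]] ?]; [left|right]; apply: val_inj.
by case=> ->; rewrite /= ?mul1r ?mul0r ?mulr0 ?addr0 ?add0r mulrC.
Qed.

Lemma uwt_tens j c : uwt T (mxtens_index (j, c)) = uwt M j + (1 - (2 * c)%:Z).
Proof.
change (uwt M (mxtens_unindex (mxtens_index (j, c))).1 +
  uwt V (mxtens_unindex (mxtens_index (j, c))).2 = uwt M j + (1 - (2 * c)%:Z)).
by rewrite mxtens_indexK.
Qed.

Lemma tP b w : P T w *m tinj b =
  tinj b *m P M (w - (1 - (2 * b)%:Z)).
Proof.
apply/matrixP => x i; rewrite mul_tinj; case: (mxtens_indexP x) => j c.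
rewrite tinj_mul !mxE uwt_tens (can_eq (@mxtens_indexK _ _)) xpair_eqE.
have [->|] := eqVneq j i; last by rewrite /= mulr0.
have [->|] := eqVneq c b; last by rewrite /= mul0r.
rewrite !mulr1n mul1r; congr (_ %:R); congr nat_of_bool.
by rewrite -[in RHS](inj_eq (addIr (1 - (2 * b)%:Z))) subrK.
Qed.

Let K := wfun M (fun w => q ^ w).

Lemma uK1 : uK q M 1 = K.
Proof. by rewrite /uK /K /wfun; congr diag_mx; apply/rowP => i; rewrite !mxE mul1r. Qed.

Lemma uKz0 S : uK q S 0 = 1%:M.
Proof.
by apply/matrixP => i j; rewrite !mxE mul0r expr0z.
Qed.

Lemma uKE S c (a b : 'I_(udim S)) : uK q S c a b = (q ^ (c * uwt S a)) *+ (a == b).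
Proof. by rewrite !mxE; case: eqP => // ->. Qed.

Lemma mul_uK S p (A : 'M[k]_(p, udim S)) c i j :
  (A *m uK q S c) i j = A i j * q ^ (c * uwt S j).
Proof. exact: (mul_wfun A (fun w => q ^ (c * w))). Qed.

Lemma weylFK c (a b : 'I_2) : (F V 1 *m uK q V c : 'M[k]_2) a b =
  F V 1 a b * q ^ (c * (1 - (2 * b)%:Z)).
Proof. exact: mul_uK. Qed.

Lemma weylK c (a b : 'I_2) : (uK q V c : 'M[k]_2) a b =
  q ^ (c * (1 - (2 * a)%:Z)) *+ (a == b).
Proof. exact: uKE. Qed.

Lemma weylE r (a b : 'I_2) :
  E V r a b = (if (b == a + r :> nat)%N then qbinn q (1 - b + r) r else 0).
Proof. by rewrite mxE. Qed.

Lemma weylF r (a b : 'I_2) :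
  F V r a b = (if (a == b + r :> nat)%N then qbinn q (b + r) r else 0).
Proof. by rewrite mxE. Qed.

Lemma weylE_big r : (1 < r)%N -> E V r = 0.
Proof.
move=> lt; apply/matrixP => a b; rewrite weylE mxE; case: eqP => // e.
by have := ltn_ord b; rewrite e /=; lia.
Qed.

Lemma weylF_big r : (1 < r)%N -> F V r = 0.
Proof.
move=> lt; apply/matrixP => a b; rewrite weylF mxE; case: eqP => // e.
by have := ltn_ord a; rewrite e /=; lia.
Qed.

Lemma weylE0 : E V 0 = 1%:M.
Proof.
apply/matrixP => a b; rewrite weylE addn0 qbinn0 mxE [RHS]mulrb.
by rewrite eq_sym (inj_eq val_inj).
Qed.

Lemma weylF0 : F V 0 = 1%:M.
Proof.
apply/matrixP => a b; rewrite weylF addn0 qbinn0 mxE [RHS]mulrb.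
by rewrite (inj_eq val_inj).
Qed.

Lemma tE_sum r : E T r = (E M r *t (1%:M : 'M_2)) +
  q ^ (r%:Z - 1) *: ((dn (E M) r 1 *m K) *t E V 1).
Proof.
rewrite [LHS](_ : _ = \sum_(i < r.+1) q ^+ (i * (r - i)) *:
          ((E M (r - i) *m uK q M i%:Z) *t E V i)) //.
move: (E V) weylE0 weylE_big => EV one big.
case: r => [|r].
  by rewrite big_ord1 expr0 scale1r uKz0 mulmx1 one dn_out // mul0mx tens0mx
     scaler0 addr0.
rewrite big_ord_recl big_ord_recl big1 => [|i _]; last first.
  by rewrite big // tensmx0 scaler0.
rewrite lift0 /= addr0 expr0 scale1r uKz0 mulmx1 one uK1 subn0; congr (_ + _).
rewrite dnSS dn0 mul1n subn1 /= exprnP; congr (_ *: _).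
by congr (q ^ _); lia.
Qed.

Lemma weylE1 : [/\ E V 1 v0 v0 = 0, E V 1 v1 v0 = 0, E V 1 v0 v1 = 1 & E V 1 v1 v1 = 0].
Proof. by split; rewrite weylE //; apply: (qbinnn q 1). Qed.

Lemma weylF1 : [/\ F V 1 v0 v0 = 0, F V 1 v1 v0 = 1, F V 1 v0 v1 = 0 & F V 1 v1 v1 = 0].
Proof. by split; rewrite weylF //; apply: (qbinnn q 1). Qed.

Lemma tE0 r : E T r *m tinj v0 = tinj v0 *m E M r.
Proof.
have [e00 e10 e01 e11] := weylE1.
rewrite tE_sum mulmxDl -scalemxAl !tens_tinj e00 e10 !mxE !eqxx /=.
by rewrite scale1r !scale0r !addr0 scaler0 addr0.
Qed.

Lemma tE1 r : E T r *m tinj v1 = tinj v1 *m E M r +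
  q ^ (r%:Z - 1) *: (tinj v0 *m (dn (E M) r 1 *m K)).
Proof.
have [e00 e10 e01 e11] := weylE1.
rewrite tE_sum mulmxDl -scalemxAl !tens_tinj e01 e11 !mxE !eqxx /=.
by rewrite !scale1r !scale0r add0r addr0.
Qed.

Lemma tF_sum r : F T r = (F M r *t uK q V (- r%:Z)) +
  q ^ (r%:Z - 1) *: (dn (F M) r 1 *t (F V 1 *m uK q V (1 - r%:Z))).
Proof.
rewrite [LHS](_ : _ = \sum_(i < r.+1) q ^+ (i * (r - i)) *:
          (F M i *t (F V (r - i) *m uK q V (- i%:Z)))) //.
move: (F V) (uK q V) weylF0 weylF_big => FV KV one big.
case: r => [|r].
  by rewrite big_ord1 expr0 scale1r one mul1mx dn_out // tens0mx
     scaler0 addr0.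
rewrite big_ord_recr big_ord_recr big1 => [|i _]; last first.
  rewrite big ?mul0mx ?tensmx0 ?scaler0 //=.
  by have := ltn_ord i; lia.
rewrite /= add0r subnn muln0 expr0 scale1r one mul1mx addrC; congr (_ + _).
have -> : (r.+1 - r = 1)%N by lia.
rewrite dnSS dn0 muln1; congr (_ *: (_ *t (_ *m KV _))); last by lia.
by rewrite exprnP; congr (q ^ _); lia.
Qed.

Lemma tF0 r : F T r *m tinj v0 = q ^ (- r%:Z) *: (tinj v0 *m F M r) +
  tinj v1 *m dn (F M) r 1.
Proof.
have [e00 e10 e01 e11] := weylF1.
rewrite tF_sum mulmxDl -scalemxAl !tens_tinj !weylFK !weylK e00 e10 /= mulr1n mulr0n mul0r.
rewrite !scale0r addr0 add0r mul1r; congr (_ + _).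
  by congr (q ^ _ *: _); lia.
rewrite scalerA -expfzDr // [q ^ _](_ : _ = 1) ?scale1r //.
by rewrite -[RHS](expr0z q); congr (q ^ _); lia.
Qed.

Lemma tF1 r : F T r *m tinj v1 = q ^ r%:Z *: (tinj v1 *m F M r).
Proof.
have [e00 e10 e01 e11] := weylF1.
rewrite tF_sum mulmxDl -scalemxAl !tens_tinj !weylFK !weylK e01 e11 /= mulr1n mulr0n !mul0r.
rewrite !scale0r !add0r scaler0 addr0.
by congr (q ^ _ *: _); lia.
Qed.

End TensorV.

(** The relations of M (x) V follow from those of M because the two inclusions J0
    and J1 of M are jointly surjective.  The operators are kept abstract, so that
    the tensor product is not unfolded. *)
Section TensorRelations.
Variables (k : fieldType) (q : k).
Hypothesis q0 : q != 0.
Variable M : uqrep k.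
Local Notation P := wproj.
Local Notation E := uE.
Local Notation F := uF.
Let K := wfun M (fun w => q ^ w).
Variables (n : nat) (J0 J1 : 'M[k]_(n, udim M)).
Variables (ET FT : nat -> 'M[k]_n) (PT : int -> 'M[k]_n).
Hypothesis Jext : forall p (A B : 'M[k]_(p, n)),
  A *m J0 = B *m J0 -> A *m J1 = B *m J1 -> A = B.
Hypothesis tP0 : forall w, PT w *m J0 = J0 *m P M (w - 1).
Hypothesis tP1 : forall w, PT w *m J1 = J1 *m P M (w + 1).
Hypothesis tE0 : forall r, ET r *m J0 = J0 *m E M r.
Hypothesis tE1 : forall r, ET r *m J1 = J1 *m E M r +
  q ^ (r%:Z - 1) *: (J0 *m (dn (E M) r 1 *m K)).
Hypothesis tF0 : forall r, FT r *m J0 = q ^ (- r%:Z) *: (J0 *m F M r) +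
  J1 *m dn (F M) r 1.
Hypothesis tF1 : forall r, FT r *m J1 = q ^ r%:Z *: (J1 *m F M r).

Lemma tdnE0 r t : dn (ET) r t *m J0 = J0 *m dn (E M) r t.
Proof. by rewrite /dn; case: leqP => _; rewrite ?tE0 // mul0mx mulmx0. Qed.

Lemma tdnE1 r t : dn (ET) r t *m J1 = J1 *m dn (E M) r t +
  q ^ (r%:Z - t%:Z - 1) *: (J0 *m (dn (E M) r t.+1 *m K)).
Proof.
have [le|lt] := leqP t r; last first.
  by rewrite !dn_out ?mul0mx ?mulmx0 ?scaler0 ?addr0 // ltnW.
rewrite {1}/dn le tE1 dn_sub // addn1 {2}/dn le; congr (_ + _ *: _).
by congr (q ^ _); lia.
Qed.

Lemma tdnF0 r t : dn (FT) r t *m J0 =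
  q ^ (t%:Z - r%:Z) *: (J0 *m dn (F M) r t) + J1 *m dn (F M) r t.+1.
Proof.
have [le|lt] := leqP t r; last first.
  by rewrite !dn_out ?mul0mx ?mulmx0 ?scaler0 ?addr0 // ltnW.
rewrite {1}/dn le tF0 dn_sub // addn1 {2}/dn le; congr (_ *: _ + _).
by congr (q ^ _); lia.
Qed.

Lemma tdnF1 r t : dn (FT) r t *m J1 =
  q ^ (r%:Z - t%:Z) *: (J1 *m dn (F M) r t).
Proof.
have [le|lt] := leqP t r; last first.
  by rewrite !dn_out ?mul0mx ?mulmx0 ?scaler0 ?addr0 // ltnW.
rewrite {1}/dn le tF1 {1}/dn le; congr (_ *: _).
by congr (q ^ _); lia.
Qed.

Hypothesis hM : is_uqmod q M.

Lemma K_wproj w : K *m P M w = P M w *m K.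
Proof.
by rewrite wfun_proj proj_wfun. Qed.

Lemma dnE_wproj r t w : dn (E M) r t *m P M w =
  P M (w + 2 * (r%:Z - t%:Z)) *m dn (E M) r t.
Proof.
rewrite /dn; case: leqP => le; last by rewrite mul0mx mulmx0.
by rewrite (uE_wproj _ _ hM); congr (P M _ *m _); lia.
Qed.

Lemma dnF_wproj r t w : dn (F M) r t *m P M w =
  P M (w - 2 * (r%:Z - t%:Z)) *m dn (F M) r t.
Proof.
rewrite /dn; case: leqP => le; last by rewrite mul0mx mulmx0.
by rewrite (uF_wproj _ _ hM); congr (P M _ *m _); lia.
Qed.

Lemma K_dnF_wproj r t w : K *m (dn (F M) r t *m P M w) =
  q ^ (w - 2 * (r%:Z - t%:Z)) *: (dn (F M) r t *m P M w).
Proof. by rewrite dnF_wproj mulmxA wfun_proj scalemxAl. Qed.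

Lemma K_dnE_wproj r t w : K *m (dn (E M) r t *m P M w) =
  q ^ (w + 2 * (r%:Z - t%:Z)) *: (dn (E M) r t *m P M w).
Proof. by rewrite dnE_wproj mulmxA wfun_proj scalemxAl. Qed.

Let X r s t u w := dn (F M) s t *m (dn (E M) r u *m P M w).

Let uEFX r s a b w N : (minn r s < N)%N ->
  dn (E M) r a *m (dn (F M) s b *m P M w) = \sum_(t < N)
    qbin q (w + (r%:Z - a%:Z) - (s%:Z - b%:Z)) t *: X r s (b + t) (a + t) w.
Proof.
move=> lt; rewrite mulmxA (uEF_dn a b w hM lt).
by apply: eq_bigr => t _; rewrite /X mulmxA.
Qed.

(** On M (x) x_0 and M (x) x_1 both sides expand by the commutation formula of M,
    and the coefficients agree by Pascal's rule.  The last term of the sum is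
    zero; it leaves room for the shifts of the summation index. *)
Lemma tens_EF r s w : ET r *m FT s *m PT w = \sum_(t < (r + s).+2)
    qbin q (w + r%:Z - s%:Z) t *: (dn (FT) s t *m dn (ET) r t *m PT w).
Proof.
pose N := (r + s).+1.
have lt : (minn r s < N)%N by rewrite ltnS geq_min leq_addr.
have lt' : (minn r s < N.+1)%N by rewrite ltnS ltnW.
apply: Jext.
- rewrite -mulmxA tP0 mulmx_suml; set w' := w - 1.
  transitivity (J0 *m (\sum_(t < N.+1) (q ^ (t%:Z - s%:Z) *
        qbin q (w + r%:Z - s%:Z) t) *: X r s t t w') +
      J1 *m (\sum_(t < N.+1) qbin q (w + r%:Z - s%:Z) t *:
        X r s t.+1 t w')); last first.
    rewrite !mulmx_sumr -big_split /=. 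
    apply: eq_bigr => t _.
    rewrite -[in RHS]scalemxAl -(mulmxA _ (PT w)) tP0 -/w' -!mulmxA.
    rewrite (mulmxA (dn (ET) r t)) tdnE0 -mulmxA (mulmxA (dn (FT) s t)) tdnF0.
    by rewrite mulmxDl scalerDr -!scalemxAl scalerA -!scalemxAr mulrC -!mulmxA.
  rewrite -mulmxA (mulmxA (FT s)) tF0 mulmxDl mulmxDr -!scalemxAl -scalemxAr.
  rewrite -!mulmxA !(mulmxA (ET r)) tE0 tE1 mulmxDl -scalemxAl -!mulmxA.
  rewrite K_dnF_wproj -!scalemxAr scalerA -[F M s](dn0 (F M)) -[E M r](dn0 (E M)).
  rewrite (uEFX _ _ _ lt') (uEFX 0 1 _ lt') (uEFX 1 1 _ lt).
  rewrite [in LHS]addrCA addrC; congr (_ + _); last first.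
    congr (_ *m _); apply: eq_bigr => t _; congr (qbin q _ _ *: _).
    by rewrite /w'; lia.
  rewrite !scalemxAr -mulmxDr; congr (_ *m _).
  rewrite !scaler_sumr big_ord_recl [in RHS]big_ord_recl -addrA /=.
  rewrite !scalerA !qbin_0 !mulr1 sub0r; congr (_ + _).
  rewrite -big_split; apply: eq_bigr => t _ /=.
  rewrite !scalerA !add1n -scalerDl; congr (_ *: _).
  rewrite /bump add1n; set a := w' + _ - _.
  have -> : w' + (r%:Z - 1) - (s%:Z - 1) = a by rewrite /a; lia.
  have -> : w + r%:Z - s%:Z = a + 1 by rewrite /a /w'; lia.
  rewrite qbin_pascal' // [in RHS]mulrDr !qzM // -expfzDr //.
  by congr (q ^ _ * _ + q ^ _ * _); rewrite /a; lia.
- rewrite -mulmxA tP1 mulmx_suml; set w' := w + 1.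
  transitivity (J0 *m (\sum_(t < N.+1) (q ^ (r%:Z - 1 + w' - s%:Z) *
        qbin q (w + r%:Z - s%:Z) t) *: X r s t t.+1 w') +
      J1 *m (\sum_(t < N.+1) (q ^ (s%:Z - t%:Z) * qbin q (w + r%:Z - s%:Z) t) *:
        X r s t t w' + \sum_(t < N.+1) (q ^ (r%:Z - t%:Z - 1 + w') *
        qbin q (w + r%:Z - s%:Z) t) *: X r s t.+1 t.+1 w')); last first.
    rewrite !mulmxDr !mulmx_sumr -!big_split /=; apply: eq_bigr => t _.
    rewrite -[in RHS]scalemxAl -(mulmxA _ (PT w)) tP1 -/w' -!mulmxA.
    rewrite (mulmxA (dn ET r t)) tdnE1 mulmxDl -scalemxAl -!mulmxA.
    rewrite [K *m _]wfun_proj mulmxDr -scalemxAr mulmxA tdnF1.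
    rewrite -!scalemxAr (mulmxA (dn FT s t)) tdnF0 mulmxDl -!scalemxAl.
    rewrite !scalerDr !scalerA -!mulmxA.
    rewrite addrCA; congr (_ *: _ + (_ *: _ + _ *: _)).
    - by rewrite mulrC.
    - rewrite -mulrA mulrC; congr (_ * _); rewrite -!expfzDr //.
      by congr (q ^ _); lia.
    - rewrite mulrC; congr (_ * _); rewrite -!expfzDr //.
  rewrite -mulmxA (mulmxA (FT s)) tF1 -!scalemxAl -scalemxAr.
  rewrite -!mulmxA (mulmxA (ET r)) tE1 mulmxDl -scalemxAl -!mulmxA.
  rewrite -[F M s](dn0 (F M)) K_dnF_wproj -!scalemxAr scalerA -[E M r](dn0 (E M)).
  rewrite (uEFX _ _ _ lt') (uEFX 1 0 _ lt').
  rewrite scalerDr addrC scalerA !scalemxAr; congr (J0 *m _ + J1 *m _).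
    rewrite scaler_sumr; apply: eq_bigr => t _; rewrite scalerA.
    rewrite add0n add1n; congr (_ *: _); congr (_ * _).
      by rewrite -!expfzDr //; congr (q ^ _); lia.
    by congr (qbin q _ _); rewrite /w'; lia.
  have out : X r s N.+1 N.+1 w' = 0.
    by rewrite /X dn_out ?mul0mx // /N; lia.
  rewrite [X in _ = _ + X]big_ord_recr /= out scaler0 addr0.
  rewrite scaler_sumr [LHS]big_ord_recl [X in _ = X + _]big_ord_recl /=.
  rewrite !qbin_0 scale1r subr0 mulr1.
  rewrite -[RHS]addrA; congr (_ + _); rewrite addr0 -big_split; apply: eq_bigr => t _ /=.
  rewrite /bump !add0n !add1n scalerA -scalerDl; congr (_ *: _).
  set a := w + r%:Z - s%:Z.
  rewrite [qbin q (w' + _ - _) _](_ : _ = qbin q (a + 1) t.+1); last first.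
    by congr (qbin q _ _); rewrite /a /w'; lia.
  rewrite qbin_pascal' // [in LHS]mulrDr !qzM //.
  by congr (q ^ _ * _ + q ^ _ * _); rewrite /a /w'; lia.
Qed.

Lemma tens_E0 : ET 0 = 1%:M.
Proof.
by apply: Jext; rewrite ?tE0 ?tE1 (uE0 hM) mul1mx ?mulmx1 // dn_out //
   mul0mx mulmx0 scaler0 addr0.
Qed.

Lemma tens_F0 : FT 0 = 1%:M.
Proof.
have e : q ^ (- 0%:Z) = 1 by [].
by apply: Jext; rewrite ?tF0 ?tF1 (uF0 hM) mul1mx mulmx1 ?dn_out //
   ?mulmx0 ?e scale1r ?addr0.
Qed.

Lemma tens_EP r w : ET r *m PT w = PT (w + (2 * r)%:Z) *m ET r.
Proof.
apply: Jext.
  rewrite -!mulmxA tP0 tE0 !mulmxA tE0 tP0 -!mulmxA (uE_wproj _ _ hM).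
  by congr (_ *m (P M _ *m _)); lia.
rewrite -!mulmxA tP1 tE1 mulmxA tE1 mulmxDl mulmxDr -scalemxAl -scalemxAr.
rewrite !mulmxA tP0 tP1 -!mulmxA (uE_wproj _ _ hM) K_wproj.
rewrite [dn _ _ _ *m (P _ _ *m _)]mulmxA dnE_wproj !mulmxA.
have -> : w + 1 + (2 * r)%:Z = w + (2 * r)%:Z + 1 by lia.
by have -> : w + 1 + 2 * (r%:Z - 1%:Z) = w + (2 * r)%:Z - 1 by lia.
Qed.

Lemma tens_FP r w : FT r *m PT w = PT (w - (2 * r)%:Z) *m FT r.
Proof.
apply: Jext.
  rewrite -!mulmxA tP0 tF0 mulmxA tF0 mulmxDl mulmxDr -scalemxAl -scalemxAr.
  rewrite !mulmxA tP0 tP1 -!mulmxA (uF_wproj _ _ hM) dnF_wproj.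
  have -> : w - 1 - (2 * r)%:Z = w - (2 * r)%:Z - 1 by lia.
  by have -> : w - 1 - 2 * (r%:Z - 1%:Z) = w - (2 * r)%:Z + 1 by lia.
rewrite -!mulmxA tP1 tF1 mulmxA tF1 -scalemxAl -scalemxAr !mulmxA tP1 -!mulmxA.
by rewrite (uF_wproj _ _ hM) addrAC.
Qed.

Lemma K_dnE r t : K *m dn (E M) r t = q ^ (2 * (r%:Z - t%:Z)) *: (dn (E M) r t *m K).
Proof.
apply: wproj_ext => w; rewrite -mulmxA K_dnE_wproj -!scalemxAl -mulmxA.
rewrite wfun_proj -scalemxAr scalerA -expfzDr //; congr (q ^ _ *: _); lia.
Qed.

Lemma tens_EE r s : ET r *m ET s = qbinn q (r + s) r *: ET (r + s).
Proof.
case: r => [|r]; first by rewrite tens_E0 mul1mx qbinn0 scale1r.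
case: s => [|s]; first by rewrite tens_E0 mulmx1 addn0 qbinnn // scale1r.
apply: Jext; rewrite -mulmxA -scalemxAl.
  by rewrite !tE0 mulmxA tE0 -mulmxA (uEE hM) -scalemxAr.
rewrite !tE1 mulmxDr -scalemxAr !mulmxA tE0 tE1 mulmxDl -!scalemxAl -!mulmxA.
rewrite -[E M s.+1](dn0 (E M)) K_dnE !dn0 addSn !dnSS !dn0.
rewrite -!scalemxAr !(mulmxA (E M _)) !(uEE hM) -!scalemxAl -!scalemxAr.
rewrite !scalerA scalerDr scalerA !addSn !addnS -addrA -scalerDl.
congr (_ + _ *: _); rewrite (qbinn_pascal' q0 (r + s).+1 r).
rewrite [RHS]mulrC [in RHS]mulrDr [RHS]addrC !qzM //.
by congr (q ^ _ * _ + q ^ _ * _); lia.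
Qed.

Lemma tens_FF r s : FT r *m FT s = qbinn q (r + s) r *: FT (r + s).
Proof.
case: r => [|r]; first by rewrite tens_F0 mul1mx qbinn0 scale1r.
case: s => [|s]; first by rewrite tens_F0 mulmx1 addn0 qbinnn // scale1r.
apply: Jext; rewrite -mulmxA -scalemxAl.
  rewrite !tF0 mulmxDr -scalemxAr !mulmxA tF0 tF1 mulmxDl -!scalemxAl -!mulmxA.
  rewrite addSn !dnSS !dn0 !(uFF hM).
  rewrite -!scalemxAr !scalerDr !scalerA !addSn !addnS -addrA -scalerDl.
  congr (_ *: _ + _ *: _).
    rewrite [RHS]mulrC; congr (_ * _); rewrite -expfzDr //.
    by congr (q ^ _); lia.
  rewrite (qbinn_pascal q (r + s).+1 r) addrC.
  by congr (q ^ _ * _ + q ^ _ * _); lia.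
rewrite !tF1 -scalemxAr mulmxA tF1 -scalemxAl -mulmxA (uFF hM) -scalemxAr.
rewrite !scalerA; congr (_ *: _).
rewrite mulrC; congr (_ * _); rewrite -expfzDr //; congr (q ^ _); lia.
Qed.

End TensorRelations.

Section TensorModules.
Variables (k : fieldType) (q : k).
Hypothesis q0 : q != 0.
Implicit Types M N : uqrep k.
Local Notation V := (weyl q 1).

Lemma utens_uqmod M : is_uqmod q M -> is_uqmod q (utens q M V).
Proof.
move=> hM; pose T := utens q M V.
have ext : forall p (A B : 'M[k]_(p, udim T)),
    A *m tinj q M ord0 = B *m tinj q M ord0 ->
    A *m tinj q M ord_max = B *m tinj q M ord_max -> A = B.
  by move=> p A B; apply: tinj_ext.
have tP0 w : wproj T w *m tinj q M ord0 = tinj q M ord0 *m wproj M (w - 1).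
  by rewrite tP.
have tP1 w : wproj T w *m tinj q M ord_max = tinj q M ord_max *m wproj M (w + 1).
  by rewrite tP; congr (_ *m wproj M _); lia.
have E0 := @tE0 k q q0 M; have E1 := @tE1 k q q0 M.
have F0 := @tF0 k q q0 M; have F1 := @tF1 k q q0 M.
apply: uqmod_intro.
- exact: (tens_E0 ext E0 E1 hM).
- exact: (tens_F0 ext F0 F1 hM).
- move=> r w; exact: (tens_EP q0 ext tP0 tP1 E0 E1 hM).
- move=> r w; exact: (tens_FP q0 ext tP0 tP1 F0 F1 hM).
- move=> r s; exact: (tens_EE q0 ext E0 E1 hM).
- move=> r s; exact: (tens_FF q0 ext F0 F1 hM).
- move=> r s w; rewrite (tens_EF q0 ext tP0 tP1 E0 E1 F0 F1 hM).
  rewrite big_ord_recr /= [X in _ + _ *: X](_ : _ = 0) ?scaler0 ?addr0 //.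
  by rewrite dn_out ?mul0mx // ; lia.
Qed.

Definition tmap M N (f : 'M[k]_(udim N, udim M)) :
    'M[k]_(udim (utens q N V), udim (utens q M V)) :=
  tinj q N ord0 *m f *m (tinj q M ord0)^T +
  tinj q N ord_max *m f *m (tinj q M ord_max)^T.

Lemma tmap_tinj M N (f : 'M[k]_(udim N, udim M)) (b : 'I_2) :
  tmap f *m tinj q M b = tinj q N b *m f.
Proof.
rewrite /tmap mulmxDl -!(mulmxA _ _ (tinj q M b)) !tinj_orth.
have [->|->] : b = ord0 \/ b = ord_max.
  by case: b => [[|[|//]] ?]; [left|right]; apply: val_inj.
- by rewrite mulmx1 raddf0 mulmx0 addr0.
- by rewrite mulmx1 raddf0 mulmx0 add0r.
Qed.

Lemma tmap_hom M N (f : 'M[k]_(udim N, udim M)) :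
  is_uqhom f -> @is_uqhom k (utens q M V) (utens q N V) (tmap f).
Proof.
move=> hf; have /uqhomE hg := hf; apply/uqhomE => g.
have fE r : f *m uE M r = uE N r *m f := hg (GenE r).
have fF r : f *m uF M r = uF N r *m f := hg (GenF r).
have fP w : f *m wproj M w = wproj N w *m f := hg (GenP w).
have fdE r t : f *m dn (uE M) r t = dn (uE N) r t *m f by apply: hom_dnE.
have fdF r t : f *m dn (uF M) r t = dn (uF N) r t *m f by apply: hom_dnF.
have fK h : f *m wfun M h = wfun N h *m f by apply: hom_wfun.
apply: tinj_ext; case: g => [w|r|r]; rewrite -!mulmxA tmap_tinj.
- by rewrite !tP !mulmxA tmap_tinj tP -!mulmxA fP.
- by rewrite !tE0 // !mulmxA tmap_tinj tE0 // -!mulmxA fE.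
- rewrite tF0 // mulmxDr -scalemxAr !mulmxA !tmap_tinj tF0 // mulmxDl.
  by rewrite -scalemxAl -!mulmxA fF fdF.
- by rewrite !tP !mulmxA tmap_tinj tP -!mulmxA fP.
- rewrite tE1 // mulmxDr -scalemxAr !mulmxA !tmap_tinj tE1 // mulmxDl.
  by rewrite -scalemxAl -!mulmxA fE (mulmxA f) fdE -!mulmxA fK.
- by rewrite tF1 // -scalemxAr !mulmxA tmap_tinj tF1 // -scalemxAl -!mulmxA fF.
Qed.

Lemma tmap_comp M N (L : uqrep k) (f : 'M[k]_(udim N, udim M))
    (g : 'M[k]_(udim L, udim N)) : tmap (g *m f) = tmap g *m tmap f.
Proof. by apply: tinj_ext; rewrite -mulmxA !tmap_tinj !mulmxA tmap_tinj. Qed.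

Lemma tmap1 M : tmap (1%:M : 'M[k]_(udim M)) = 1%:M.
Proof. by apply: tinj_ext; rewrite tmap_tinj mulmx1 mul1mx. Qed.

Lemma weyl0_uqmod : is_uqmod q (weyl q 0).
Proof.
have big r : (0 < r)%N -> uE (weyl q 0) r = 0 /\ uF (weyl q 0) r = 0.
  by move=> r0; split; apply/matrixP => i j; rewrite !mxE !ord1 /=;
    case: eqP => //=; lia.
have E0 : uE (weyl q 0) 0 = 1%:M.
  by apply/matrixP => i j; rewrite !mxE !ord1.
have F0 : uF (weyl q 0) 0 = 1%:M.
  by apply/matrixP => i j; rewrite !mxE !ord1.
apply: uqmod_intro => // [r w|r w|r s|r s|r s w].
- case: r => [|r]; first by rewrite E0 mul1mx mulmx1 addr0.
  by have [-> _] := big r.+1 isT; rewrite mul0mx mulmx0.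
- case: r => [|r]; first by rewrite F0 mul1mx mulmx1 subr0.
  by have [_ ->] := big r.+1 isT; rewrite mul0mx mulmx0.
- case: r => [|r]; first by rewrite E0 mul1mx qbinn0 scale1r.
  by have [-> _] := big r.+1 isT; have [-> _] := big (r.+1 + s)%N isT;
    rewrite mul0mx scaler0.
- case: r => [|r]; first by rewrite F0 mul1mx qbinn0 scale1r.
  by have [_ ->] := big r.+1 isT; have [_ ->] := big (r.+1 + s)%N isT;
    rewrite mul0mx scaler0.
have dE a t : (t != a)%N -> dn (uE (weyl q 0)) a t = 0.
  rewrite neq_ltn => /orP[lt|]; last exact: dn_out.
  by rewrite /dn (ltnW lt); have [|-> _] := big (a - t)%N; rewrite ?subn_gt0.
have dF a t : (t != a)%N -> dn (uF (weyl q 0)) a t = 0.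
  rewrite neq_ltn => /orP[lt|]; last exact: dn_out.
  by rewrite /dn (ltnW lt); have [|_ ->] := big (a - t)%N; rewrite ?subn_gt0.
have [->|nw] := eqVneq w 0; last first.
  have -> : wproj (weyl q 0) w = 0.
    apply/matrixP => i j; rewrite !mxE !ord1 /= muln0 subrr eq_sym (negPf nw).
    by rewrite mul0rn.
  by rewrite mulmx0 big1 // => t _; rewrite mulmx0 scaler0.
have [/eqP|nz] := posnP (r + s).
  rewrite addn_eq0 => /andP[/eqP-> /eqP->].
  by rewrite big_ord1 qbin_0 scale1r !dn0 E0 F0.
rewrite [LHS](_ : _ = 0); last first.
  case: r nz => [|r] nz; last by have [-> _] := big r.+1 isT; rewrite !mul0mx.
  by have [_ ->] := big s nz; rewrite mulmx0 mul0mx.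
rewrite big1 // => t _.
have [e|ne] := eqVneq (t : nat) r; last by rewrite dE // mulmx0 mul0mx scaler0.
have [e'|ne] := eqVneq (t : nat) s; last by rewrite dF // !mul0mx scaler0.
rewrite qbin_small ?scale0r //; lia.
Qed.

Lemma Vpow_uqmod n : is_uqmod q (Vpow q n).
Proof. by elim: n => [|n IH]; [exact: weyl0_uqmod|exact: utens_uqmod]. Qed.

End TensorModules.

(** * The dual module *)

Section FE.
Variables (k : fieldType) (q : k).
Hypothesis q0 : q != 0.
Implicit Types M : uqrep k.
Local Notation P := wproj.
Local Notation E := uE.
Local Notation F := uF.

Lemma sum_convolution (V : lmodType k) N (c d : nat -> k) (G : nat -> V) :
  (forall v, (N <= v)%N -> G v = 0) ->
  \sum_(t < N) \sum_(u < N) (c t * d u) *: G (t + u)%N =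
  \sum_(v < N) (\sum_(t < v.+1) c t * d (v - t)%N) *: G v.
Proof.
move=> G0.
transitivity (\sum_(t < N) \sum_(v < N | (t <= v)%N) (c t * d (v - t)%N) *: G v).
  apply: eq_bigr => t _.
  rewrite -(big_mkord xpredT (fun u => (c t * d u) *: G (t + u)%N)).
  rewrite -(big_mkord (fun v => t <= v)%N (fun v => (c t * d (v - t)%N) *: G v)).
  have tN := ltn_ord t.
  rewrite (@big_cat_nat _ _ _ (N - t)%N) ?leq_subr //=.
  rewrite [X in _ + X]big_nat [X in _ + X]big1 ?addr0; last first.
    by move=> u /andP[le _]; rewrite G0 ?scaler0 //; lia.
  rewrite [RHS](@big_cat_nat _ _ _ t) //=; last exact: ltnW.
  rewrite [X in _ = X + _]big_nat_cond [X in _ = X + _]big1 ?add0r; last first.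
    by move=> v /andP[/= lt1 lt2]; move: lt1; rewrite ltnNge lt2.
  rewrite -[X in _ = \big[_/_]_(X <= _ < _ | _) _]add0n big_addn [RHS]big_mkcond /=.
  by apply: eq_bigr => u _; rewrite leq_addl addnK addnC.
rewrite (exchange_big_dep xpredT) //=; apply: eq_bigr => v _.
rewrite scaler_suml; rewrite -(big_mkord (fun t => t <= v)%N
  (fun t => (c t * d (v - t)%N) *: G v)).
rewrite -(big_mkord xpredT (fun t => (c t * d (v - t)%N) *: G v)).
rewrite [RHS](big_nat_widen _ _ N) //=.
Qed.

(** The opposite commutation formula, obtained by inverting the defining one:
    the two families of coefficients are inverse to each other under
    convolution. *)
Lemma uFE_wproj M r s w : is_uqmod q M ->
  F M s *m E M r *m P M w = \sum_(t < (r + s).+1)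
    qbin q (- (w + r%:Z - s%:Z)) t *: (dn (E M) r t *m dn (F M) s t *m P M w).
Proof.
move=> hM; set a := w + _ - _; set N := (r + s).+1.
have lt : (minn r s < N)%N by rewrite ltnS geq_min leq_addr.
pose G v := dn (F M) s v *m dn (E M) r v *m P M w.
transitivity (\sum_(t < N) \sum_(u < N) (qbin q (- a) t * qbin q a u) *: G (t + u)%N).
  rewrite sum_convolution; last first.
    by move=> v le; rewrite /G dn_out ?mul0mx //; move: le; rewrite /N; lia.
  rewrite big_ord_recl [X in _ = _ + X]big1 ?addr0 => [|v _]; last first.
    have := qbin_vandermonde q0 (- a) (lift ord0 v); rewrite opprK => e.
    by rewrite [X in X *: _]e scale0r.
  by rewrite big_ord1 !qbin_0 mulr1 scale1r /G !dn0.
apply: eq_bigr => t _; rewrite (uEF_dn _ _ _ hM lt) scaler_sumr.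
apply: eq_bigr => u _; rewrite scalerA; congr (_ * qbin q _ _ *: _).
by rewrite /a; lia.
Qed.

End FE.

Section Dual.
Variables (k : fieldType) (q : k).
Hypothesis q0 : q != 0.
Variable M : uqrep k.
Hypothesis hM : is_uqmod q M.
Local Notation P := wproj.
Local Notation E := uE.
Local Notation F := uF.
Local Notation D := (udual q M).

Lemma wproj_dual w : P D w = P M (- w).
Proof. by apply/matrixP => i j; rewrite !mxE /= eqr_oppLR. Qed.

(** The scalars by which the antipode twists E^(n) and F^(n) on the weight space
    of weight w; n is an integer since differences of indices are inserted. *)
Definition dualE (n w : int) : k := (-1) ^ n * q ^ (- (n * n) - n - n * w).
Definition dualF (n w : int) : k := (-1) ^ n * q ^ (- (n * n) + n + n * w).

Lemma uK_wproj c w : uK q M c *m P M w = q ^ (c * w) *: P M w.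
Proof. exact: (wfun_proj M (fun x => q ^ (c * x))). Qed.

Lemma dualE_wproj r w : (E D r)^T *m P M w = dualE r w *: (E M r *m P M w).
Proof.
rewrite /= trmxK -scalemxAl -mulmxA (uE_wproj _ _ hM) mulmxA uK_wproj.
rewrite -scalemxAl scalerA; congr (_ *: _); rewrite -mulrA; congr (_ * _).
rewrite exprnP -expfzDr //; congr (q ^ _); nia.
Qed.

Lemma dualF_wproj r w : (F D r)^T *m P M w = dualF r w *: (F M r *m P M w).
Proof.
rewrite /= trmxK -scalemxAl -mulmxA uK_wproj -scalemxAr scalerA.
congr (_ *: _); rewrite -mulrA; congr (_ * _).
rewrite exprnN -expfzDr //; congr (q ^ _); nia.
Qed.

(** Only the following two properties of the operators of the dual are used. *)
Section Relations.
Variables Ed Fd : nat -> 'M[k]_(udim M).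
Hypothesis HE : forall r w, (Ed r)^T *m P M w = dualE r w *: (E M r *m P M w).
Hypothesis HF : forall r w, (Fd r)^T *m P M w = dualF r w *: (F M r *m P M w).

Lemma dualE_dn r t w : (dn Ed r t)^T *m P M w =
  dualE (r%:Z - t%:Z) w *: (dn (E M) r t *m P M w).
Proof.
rewrite /dn; case: leqP => le; last by rewrite trmx0 !mul0mx scaler0.
by rewrite HE subzn.
Qed.

Lemma dualF_dn r t w : (dn Fd r t)^T *m P M w =
  dualF (r%:Z - t%:Z) w *: (dn (F M) r t *m P M w).
Proof.
rewrite /dn; case: leqP => le; last by rewrite trmx0 !mul0mx scaler0.
by rewrite HF subzn.
Qed.

Lemma dual_E0 : Ed 0 = 1%:M.
Proof.
apply: trmx_inj; apply: wproj_ext => w; rewrite HE (uE0 hM) /dualE !mul0r.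
by rewrite oppr0 subr0 addr0 !expr0z mulr1 scale1r trmx1.
Qed.

Lemma dual_F0 : Fd 0 = 1%:M.
Proof.
apply: trmx_inj; apply: wproj_ext => w; rewrite HF (uF0 hM) /dualF !mul0r.
by rewrite oppr0 !addr0 !expr0z mulr1 scale1r trmx1.
Qed.

Lemma dual_EP r w : Ed r *m P M (- w) = P M (- (w + (2 * r)%:Z)) *m Ed r.
Proof.
apply: trmx_inj; apply: wproj_ext => v; rewrite !trmx_mul !tr_wfun.
rewrite -!mulmxA wproj_proj HE -scalemxAr (uE_wproj _ _ hM) mulmxA wproj_proj.
have [<-|ne] := eqVneq (- (w + (2 * r)%:Z)) v.
  have -> : - (w + (2 * r)%:Z) + (2 * r)%:Z = - w by lia.
  by rewrite eqxx HE (uE_wproj _ _ hM); congr (_ *: (P M _ *m _)); lia.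
case: eqP => [e|_]; last by rewrite mul0mx mulmx0 scaler0.
by case/eqP: ne; lia.
Qed.

Lemma dual_FP r w : Fd r *m P M (- w) = P M (- (w - (2 * r)%:Z)) *m Fd r.
Proof.
apply: trmx_inj; apply: wproj_ext => v; rewrite !trmx_mul !tr_wfun.
rewrite -!mulmxA wproj_proj HF -scalemxAr (uF_wproj _ _ hM) mulmxA wproj_proj.
have [<-|ne] := eqVneq (- (w - (2 * r)%:Z)) v.
  have -> : - (w - (2 * r)%:Z) - (2 * r)%:Z = - w by lia.
  by rewrite eqxx HF (uF_wproj _ _ hM); congr (_ *: (P M _ *m _)); lia.
case: eqP => [e|_]; last by rewrite mul0mx mulmx0 scaler0.
by case/eqP: ne; lia.
Qed.

Lemma dual_EE r s : Ed r *m Ed s = qbinn q (r + s) r *: Ed (r + s).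
Proof.
apply: trmx_inj; apply: wproj_ext => w; rewrite trmx_mul linearZ /=.
rewrite -scalemxAl -mulmxA !HE -scalemxAr (uE_wproj r w hM) mulmxA HE -scalemxAl -mulmxA.
rewrite -(uE_wproj r w hM) mulmxA (uEE hM) -!scalemxAl !scalerA (addnC s r).
congr (_ *: _); rewrite [in RHS]qbinn_sym ?leq_addr // addKn [RHS]mulrC mulrA.
congr (_ * _).
rewrite -mulrA /dualE mulrACA -!expfzDr ?oppr_eq0 ?oner_neq0 //.
by congr (_ ^ _ * q ^ _); lia.
Qed.

Lemma dual_FF r s : Fd r *m Fd s = qbinn q (r + s) r *: Fd (r + s).
Proof.
apply: trmx_inj; apply: wproj_ext => w; rewrite trmx_mul linearZ /=.
rewrite -scalemxAl -mulmxA !HF -scalemxAr (uF_wproj r w hM) mulmxA HF -scalemxAl -mulmxA.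
rewrite -(uF_wproj r w hM) mulmxA (uFF hM) -!scalemxAl !scalerA (addnC s r).
congr (_ *: _); rewrite [in RHS]qbinn_sym ?leq_addr // addKn [RHS]mulrC mulrA.
congr (_ * _).
rewrite -mulrA /dualF mulrACA -!expfzDr ?oppr_eq0 ?oner_neq0 //.
by congr (_ ^ _ * q ^ _); lia.
Qed.

Lemma dual_EF_term r s t w : (dn Ed r t)^T *m ((dn Fd s t)^T *m P M w) =
  (dualE (r%:Z - t%:Z) (w - 2 * (s%:Z - t%:Z)) * dualF (s%:Z - t%:Z) w) *:
  (dn (E M) r t *m dn (F M) s t *m P M w).
Proof.
have e := @dnF_wproj k q q0 M hM s t w.
rewrite dualF_dn -scalemxAr e mulmxA dualE_dn -scalemxAl.
rewrite -[X in _ *: (_ *: X)]mulmxA -e mulmxA.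
by rewrite scalerA mulrC.
Qed.

(** Transposition reverses products, so that this relation of the dual comes from
    the opposite commutation formula of M. *)
Lemma dual_EF r s w : Ed r *m Fd s *m P M (- w) = \sum_(t < (r + s).+1)
  qbin q (w + r%:Z - s%:Z) t *: (dn Fd s t *m dn Ed r t *m P M (- w)).
Proof.
apply: trmx_inj; apply: wproj_ext => v; rewrite !trmx_mul !tr_wfun.
rewrite raddf_sum mulmx_suml /=.
transitivity (\sum_(t < (r + s).+1) qbin q (w + r%:Z - s%:Z) t *:
  ((dualE (r%:Z - t%:Z) (v - 2 * (s%:Z - t%:Z)) * dualF (s%:Z - t%:Z) v) *:
  (P M (- w) *m (dn (E M) r t *m dn (F M) s t *m P M v)))); last first.
  apply: eq_bigr => t _; rewrite [in RHS]linearZ /= !trmx_mul tr_wfun -[RHS]scalemxAl.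
  by rewrite -[in RHS]mulmxA -[in RHS]mulmxA dual_EF_term -scalemxAr.
have eE t := @dnE_wproj k q q0 M hM r t; have eF t := @dnF_wproj k q q0 M hM s t.
have ht t : P M (- w) *m (dn (E M) r t *m dn (F M) s t *m P M v) =
   if - w == v + 2 * (r%:Z - s%:Z) then dn (E M) r t *m dn (F M) s t *m P M v else 0.
  rewrite -[X in _ *m X]mulmxA eF (mulmxA (dn (E M) r t)) eE !mulmxA wproj_proj.
  have -> : v - 2 * (s%:Z - t%:Z) + 2 * (r%:Z - t%:Z) = v + 2 * (r%:Z - s%:Z) by lia.
  case: eqP => [->|_]; last by rewrite !mul0mx.
  rewrite -[RHS]mulmxA eF mulmxA eE; congr (P M _ *m _ *m _); lia.
have h0 : P M (- w) *m (F M s *m E M r *m P M v) =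
   if - w == v + 2 * (r%:Z - s%:Z) then F M s *m E M r *m P M v else 0.
  rewrite -[X in _ *m X]mulmxA (uE_wproj r v hM) (mulmxA (F M s)) (uF_wproj _ _ hM).
  rewrite !mulmxA wproj_proj.
  have -> : v + (2 * r)%:Z - (2 * s)%:Z = v + 2 * (r%:Z - s%:Z) by lia.
  case: eqP => [->|_]; last by rewrite !mul0mx.
  rewrite -[RHS]mulmxA (uE_wproj r v hM) mulmxA (uF_wproj _ _ hM).
  congr (P M _ *m _ *m _); lia.
have -> : P M (- w) *m ((Fd s)^T *m (Ed r)^T) *m P M v =
   (dualE r v * dualF s (v + (2 * r)%:Z)) *: (P M (- w) *m (F M s *m E M r *m P M v)).
  have t1 : (Fd s)^T *m ((Ed r)^T *m P M v) =
    (dualE r v * dualF s (v + (2 * r)%:Z)) *: (F M s *m E M r *m P M v).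
    rewrite HE -scalemxAr (uE_wproj r v hM) mulmxA HF -scalemxAl scalerA.
    by rewrite -!mulmxA (uE_wproj r v hM).
  by rewrite -[LHS]mulmxA -[X in _ *m X = _]mulmxA t1 -scalemxAr.
rewrite h0; under [RHS]eq_bigr do rewrite ht; case: eqP => [e|_]; last first.
  by rewrite scaler0 big1 // => t _; rewrite !scaler0.
rewrite (uFE_wproj q0 _ _ _ hM) scaler_sumr; apply: eq_bigr => t _.
rewrite !scalerA mulrC; congr (_ * _ *: _).
  by congr (qbin q _ _); lia.
rewrite /dualE /dualF [LHS]mulrACA [RHS]mulrACA.
rewrite -!expfzDr ?oppr_eq0 ?oner_neq0 //.
have -> : r%:Z - t%:Z + (s%:Z - t%:Z) = r%:Z + s%:Z + 2 * (- t%:Z) by lia.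
have s1 : (-1 : k) != 0 by rewrite oppr_eq0 oner_neq0.
have s2 : (-1 : k) ^ (2 * (- t%:Z)) = 1.
  by rewrite -exprz_exp -[(-1) ^ 2]/((-1) ^+ 2) sqrrN expr1n exp1rz.
rewrite (expfzDr (r%:Z + s%:Z) (2 * (- t%:Z)) s1) s2 mulr1.
congr (_ * q ^ _); lia.
Qed.

End Relations.

Lemma udual_uqmod : is_uqmod q D.
Proof.
have HE := dualE_wproj; have HF := dualF_wproj.
apply: uqmod_intro => [||r w|r w|r s|r s|r s w]; rewrite ?wproj_dual.
- exact: dual_E0 HE.
- exact: dual_F0 HF.
- exact: (dual_EP HE).
- exact: (dual_FP HF).
- exact: (dual_EE HE).
- exact: (dual_FF HF).
- exact: (dual_EF HE HF).
Qed.

End Dual.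

(** * Highest weight vectors and Weyl modules *)

Section HighestWeight.
Variables (k : fieldType) (q : k).
Hypothesis q0 : q != 0.
Implicit Types M : uqrep k.
Local Notation P := wproj.
Local Notation E := uE.
Local Notation F := uF.

(** A bound on the weights, beyond which divided powers act by zero. *)
Definition wbound M : nat := \sum_(i < udim M) `|uwt M i|%N.

Lemma uwt_wbound M i : (`|uwt M i| <= wbound M)%N.
Proof. by rewrite /wbound (bigD1 i) //= leq_addr. Qed.

Lemma uF_wbound M r : is_uqmod q M -> (wbound M < r)%N -> F M r = 0.
Proof.
move=> hM lt; apply/matrixP => j i; rewrite mxE; apply/eqP.
apply: contraTT lt => /(uF_wt hM) e.
by have := uwt_wbound i; have := uwt_wbound j; lia.
Qed.

Definition hwvec M (w : int) (v : 'cV[k]_(udim M)) : Prop :=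
  P M w *m v = v /\ forall r, (0 < r)%N -> E M r *m v = 0.

Lemma EF_hwvec M w v r s : is_uqmod q M -> @hwvec M w v ->
  E M r *m (F M s *m v) = qbin q (w + r%:Z - s%:Z) r *: (dn (F M) s r *m v).
Proof.
move=> hM [pv ev]; rewrite -{1}pv !mulmxA.
rewrite (@uEF_wproj _ _ M r s w (r + s).+1 hM); last first.
  by rewrite ltnS geq_min leq_addr.
have rN : (r < (r + s).+1)%N by rewrite ltnS leq_addr.
rewrite mulmx_suml (bigD1 (Ordinal rN)) //= big1 ?addr0 => [|t ne].
  by rewrite -scalemxAl -!mulmxA pv /(dn (E M)) leqnn subnn (uE0 hM) mul1mx.
rewrite -scalemxAl -!mulmxA pv.
have [lt|ge] := ltnP t r.
  by rewrite {2}/dn (ltnW lt) ev ?subn_gt0 // mulmx0 scaler0.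
rewrite [dn (E M) r t]dn_out ?mul0mx ?mulmx0 ?scaler0 // ltn_neqAle ge andbT.
by rewrite eq_sym.
Qed.

(** On a highest weight vector E^(r) F^(r) is the scalar [w; r], which for w < 0 is
    nonzero for arbitrarily large r, whereas F^(r) vanishes for large r. *)
Lemma hwvec_ge0 M w v : is_uqmod q M -> @hwvec M w v -> v != 0 -> 0 <= w.
Proof.
move=> hM hv nz; case: w hv => // n hv; rewrite NegzE in hv.
have [r lt nzq] := qbin_neg_neq0 q0 n (wbound M).+1.
have := EF_hwvec r r hM hv; rewrite uF_wbound // mul0mx mulmx0 addrK.
rewrite /dn leqnn subnn (uF0 hM) mul1mx => /esym/eqP.
by rewrite scaler_eq0 (negPf nzq) (negPf nz).
Qed.

(** Otherwise F^(j) v, for the least such j, would be a highest weight vector of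
    negative weight m - 2j. *)
Lemma F_hwvec_eq0 M (m : nat) v j : is_uqmod q M -> hwvec m%:Z v ->
  (m < j)%N -> F M j *m v = 0.
Proof.
move=> hM hv; have [N] := ubnP j; elim: N j => // N IH j lt mj.
apply: contrapT => /eqP nz.
have : hwvec (m%:Z - (2 * j)%:Z) (F M j *m v).
  have [pv ev] := hv; split.
    by rewrite mulmxA -(uF_wproj _ _ hM) -mulmxA pv.
  move=> r r0; rewrite (EF_hwvec _ _ hM hv).
  have [rj|jr] := leqP r j; last by rewrite dn_out // mul0mx scaler0.
  have [le|gt] := leqP j (m + r).
    by rewrite qbin_small ?scale0r //; lia.
  by rewrite /dn rj IH ?scaler0 //; lia.
by move/(hwvec_ge0 hM)/(_ nz); lia.
Qed.

Local Notation W := (weyl q).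

Lemma weylE_delta m r (i : 'I_m.+1) : E (W m) r *m (delta_mx i 0 : 'cV_m.+1) =
  if (r <= i)%N then qbinn q (m - i + r) r *: delta_mx (inord (i - r)) 0 else 0.
Proof.
rewrite -colE; apply/colP => j; rewrite !mxE.
case: leqP => le; last by rewrite mxE; case: eqP => // e; lia.
rewrite !mxE eqxx andbT -val_eqE /= inordK; last first.
  by have : (i < m.+1)%N := ltn_ord i; lia.
have -> : (j == i - r :> nat)%N = (i == j + r :> nat)%N by apply/eqP/eqP; lia.
by case: eqP; rewrite ?mulr1 ?mulr0.
Qed.

Lemma weylF_delta m r (i : 'I_m.+1) : F (W m) r *m (delta_mx i 0 : 'cV_m.+1) =
  if (i + r <= m)%N then qbinn q (i + r) r *: delta_mx (inord (i + r)) 0 else 0.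
Proof.
rewrite -colE; apply/colP => j; rewrite !mxE.
case: leqP => le; last first.
  rewrite mxE; case: eqP => // e; have := ltn_ord j; rewrite e => lj.
  by have {}lj : (i + r < m.+1)%N := lj; lia.
rewrite !mxE eqxx andbT -val_eqE /= inordK // -mulr_natr.
by case: eqP; rewrite ?mulr1 ?mulr0.
Qed.

Lemma weylF_delta0 m (i : 'I_m.+1) :
  F (W m) i *m (delta_mx ord0 0 : 'cV_m.+1) = delta_mx i 0.
Proof.
by rewrite weylF_delta add0n -ltnS ltn_ord qbinnn // scale1r inord_val.
Qed.

Definition weyl_map M (m : nat) (v : 'cV[k]_(udim M)) : 'M[k]_(udim M, m.+1) :=
  \matrix_(a, i) (F M i *m v) a 0.

Lemma weyl_map_delta M m v (i : 'I_m.+1) :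
  @weyl_map M m v *m delta_mx i 0 = F M i *m v.
Proof. by rewrite -colE; apply/colP => a; rewrite !mxE. Qed.

Lemma delta_ext n p (A B : 'M[k]_(p, n)) :
  (forall i, A *m (delta_mx i 0 : 'cV_n) = B *m delta_mx i 0) -> A = B.
Proof.
by move=> H; apply/matrixP => a i; have /colP/(_ a) := H i; rewrite -!colE !mxE.
Qed.

(** The universal property of Weyl modules: the vectors F^(i) v satisfy the
    relations of the standard basis of W m, and vanish for i > m. *)
Lemma weyl_map_hom M m v : is_uqmod q M -> hwvec m%:Z v ->
  @is_uqhom k (W m) M (weyl_map m v).
Proof.
move=> hM hv; have [pv ev] := hv; split=> [a i|r|r].
- rewrite mxE => nz; have /colP/(_ a) : P M (m%:Z - (2 * i)%:Z) *m (F M i *m v) = F M i *m v.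
    by rewrite mulmxA -(uF_wproj _ _ hM) -mulmxA pv.
  by rewrite wfun_mul; case: eqP => // _ /eqP; rewrite mul0r eq_sym (negPf nz).
- apply: delta_ext => i; rewrite -!mulmxA weylE_delta weyl_map_delta.
  rewrite (EF_hwvec _ _ hM hv) /dn; have im : (i < m.+1)%N := ltn_ord i.
  case: leqP => le; last by rewrite mulmx0 mul0mx scaler0.
  rewrite -scalemxAr weyl_map_delta inordK ?(leq_ltn_trans (leq_subr _ _) im) //.
  congr (_ *: _); apply/esym/qbinn_exact_pos.
  by move: (nat_of_ord i) im le => n im le; lia.
- apply: delta_ext => i; rewrite -!mulmxA weylF_delta weyl_map_delta.
  rewrite mulmxA (uFF hM) -scalemxAl (addnC r i).
  case: leqP => le; last first.
    by rewrite mulmx0 (F_hwvec_eq0 hM hv le) scaler0.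
  by rewrite -scalemxAr weyl_map_delta inordK.
Qed.

Local Notation x0 m := (delta_mx (ord0 : 'I_m.+1) 0 : 'cV[k]_m.+1).

Lemma weyl_hom_delta M m (f : 'M[k]_(udim M, udim (W m))) (i : 'I_m.+1) :
  is_uqhom f -> f *m (delta_mx i 0 : 'cV_m.+1) = F M i *m (f *m x0 m).
Proof. by move=> [_ _ fF]; rewrite mulmxA -fF -mulmxA weylF_delta0. Qed.

Lemma weyl_hom_eq0 M m (f : 'M[k]_(udim M, udim (W m))) :
  is_uqhom f -> f *m x0 m = 0 -> f = 0.
Proof.
move=> hf f0; apply: delta_ext => i.
by rewrite (weyl_hom_delta _ hf) f0 mulmx0 mul0mx.
Qed.

(** The weight m occurs once in W m, on the generator x_0. *)
Lemma weyl_end_scalar m (f : 'M[k]_(udim (W m))) :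
  @is_uqhom k (W m) (W m) f -> f = (f ord0 ord0)%:M.
Proof.
move=> hf; apply/eqP; rewrite -subr_eq0; apply/eqP.
apply: weyl_hom_eq0.
  by apply: uqhomB => //; rewrite -scalemx1; apply: uqhomZ; apply: uqhom_id.
rewrite -colE; apply/colP => i; rewrite !mxE.
have [->|ne] := eqVneq i ord0; first by rewrite mulr1n subrr.
rewrite mulr0n subr0; apply/eqP; apply: contraNT ne => nz.
by case: hf => /(_ _ _ nz) /= e _ _; apply/eqP/val_inj => /=; lia.
Qed.

Lemma max_uwt M : (0 < udim M)%N -> exists i, forall j, uwt M j <= uwt M i.
Proof.
move=> d0; pose i0 := Ordinal d0.
have := arg_maxP (P := xpredT) (i0 := i0) (fun i : 'I_(udim M) => uwt M i) isT.
by case=> i _ H; exists i => j; apply: H.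
Qed.

Lemma min_uwt M : (0 < udim M)%N -> exists i, forall j, uwt M i <= uwt M j.
Proof.
move=> d0; pose i0 := Ordinal d0.
have := arg_minP (P := xpredT) (i0 := i0) (fun i : 'I_(udim M) => uwt M i) isT.
by case=> i _ H; exists i => j; apply: H.
Qed.

Lemma delta_wproj M i : P M (uwt M i) *m (delta_mx i 0 : 'cV_(udim M)) = delta_mx i 0.
Proof.
apply/colP => a; rewrite wfun_mul !mxE eqxx andbT.
by have [->|] := eqVneq a i; rewrite ?eqxx ?mulr1 ?mulr0.
Qed.

Lemma delta_neq0 n (i : 'I_n) : (delta_mx i 0 : 'cV[k]_n) != 0.
Proof.
by apply/eqP => /colP/(_ i); rewrite !mxE !eqxx => /eqP; rewrite oner_eq0.
Qed.

Lemma max_hwvec M i : is_uqmod q M -> (forall j, uwt M j <= uwt M i) ->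
  hwvec (uwt M i) (delta_mx i 0 : 'cV_(udim M)).
Proof.
move=> hM mx; split=> [|r r0]; first exact: delta_wproj.
apply/colP => a; rewrite -colE !mxE; apply/eqP.
apply: contraTT (mx a) => /(uE_wt hM) ->; lia.
Qed.

Lemma max_uwt_ge0 M i : is_uqmod q M -> (forall j, uwt M j <= uwt M i) ->
  0 <= uwt M i.
Proof.
by move=> hM mx; apply: (hwvec_ge0 hM (max_hwvec hM mx)); apply: delta_neq0.
Qed.

(** A vector v of least weight - n is killed by F, so that F^(n) E^(n) v = v;
    hence n is a weight as well. *)
Lemma uwt_lower M (m : nat) : is_uqmod q M -> (forall j, uwt M j <= m%:Z) ->
  forall j, - m%:Z <= uwt M j.
Proof.
move=> hM mx j0; have d0 : (0 < udim M)%N by case: j0 => j; case: (udim M).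
have [i mn] := min_uwt d0; apply: le_trans (mn j0).
rewrite leNgt; apply/negP => lt.
pose n := `|uwt M i|%N; have en : uwt M i = - n%:Z by rewrite /n; lia.
pose u : 'cV[k]_(udim M) := delta_mx i 0.
have pu : P M (uwt M i) *m u = u by apply: delta_wproj.
have Fu s : (0 < s)%N -> F M s *m u = 0.
  move=> s0; apply/colP => a; rewrite -colE !mxE; apply/eqP.
  by apply: contraTT (mn a) => /(uF_wt hM) ->; lia.
have Eu : E M n *m u = 0.
  apply/colP => a; rewrite -colE !mxE; apply/eqP.
  by apply: contraTT (mx a) => /(uE_wt hM) ->; lia.
suff : u = 0 by apply/eqP/delta_neq0.
have : F M n *m E M n *m P M (uwt M i) *m u = 0.
  by rewrite -!mulmxA pu Eu mulmx0.
rewrite (uFE_wproj q0 _ _ _ hM) mulmx_suml.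
have nN : (n < (n + n).+1)%N by lia.
rewrite (bigD1 (Ordinal nN)) //= big1 ?addr0 => [|t ne].
  rewrite -scalemxAl -!mulmxA pu /dn leqnn subnn (uE0 hM) (uF0 hM) !mul1mx.
  rewrite (_ : - _ = n%:Z) /= ?qbinnn ?scale1r //; lia.
rewrite -scalemxAl -!mulmxA pu.
have [tn|ge] := ltnP t n.
  by rewrite {2}/dn (ltnW tn) Fu ?subn_gt0 // mulmx0 scaler0.
rewrite dn_out ?mul0mx ?scaler0 // ltn_neqAle ge andbT.
by rewrite eq_sym.
Qed.

End HighestWeight.

(** * Splitting below the quantum characteristic *)

Section Semisimple.
Variables (k : fieldType) (q : k) (l : nat).
Hypothesis q0 : q != 0.
Hypothesis hl : quantum_char q l.
Implicit Types M : uqrep k.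
Local Notation P := wproj.
Local Notation E := uE.
Local Notation F := uF.
Local Notation W := (weyl q).
Local Notation x0 m := (delta_mx (ord0 : 'I_m.+1) 0 : 'cV[k]_m.+1).

Lemma top_row_F M i0 s : is_uqmod q M -> (forall j, uwt M j <= uwt M i0) ->
  (0 < s)%N -> row i0 (F M s) = 0.
Proof.
move=> hM mx s0; apply/rowP => a; rewrite !mxE; apply/eqP.
by apply: contraTT (mx a) => /(uF_wt hM) ->; lia.
Qed.

(** Dual to the formula for highest weight vectors: a coordinate of maximal weight
    is a functional that vanishes on the images of F^(s), s > 0. *)
Lemma top_row_EF M i0 i r a : is_uqmod q M -> (forall j, uwt M j <= uwt M i0) ->
  (E M i *m F M r) i0 a = qbin q (uwt M a + i%:Z - r%:Z) r * dn (E M) i r i0 a.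
Proof.
move=> hM mx; have pr (A : 'M[k]_(udim M)) : (A *m P M (uwt M a)) i0 a = A i0 a.
  by rewrite mul_wfun eqxx mulr1.
rewrite -[LHS]pr (@uEF_wproj _ _ M i r _ (i + r).+1 hM); last first.
  by rewrite ltnS geq_min leq_addr.
have rN : (r < (i + r).+1)%N by rewrite ltnS leq_addl.
rewrite summxE (bigD1 (Ordinal rN)) //= big1 ?addr0 => [|t ne].
  rewrite mxE pr /(dn (F M)) leqnn subnn (uF0 hM) mul1mx //.
rewrite mxE pr.
have -> : (dn (F M) r t *m dn (E M) i t) i0 a = 0; last by rewrite mulr0.
transitivity (row i0 (dn (F M) r t *m dn (E M) i t) 0 a); first by rewrite [RHS]mxE.
rewrite row_mul; have [lt|ge] := ltnP t r.
  by rewrite /dn (ltnW lt) top_row_F ?subn_gt0 // mul0mx mxE.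
rewrite dn_out ?row0 ?mul0mx ?mxE // ltn_neqAle ge andbT.
by rewrite eq_sym.
Qed.

(** The map u |-> [m; i]^-1 phi(E^(i) u) x_i on the weight space of weight m - 2i,
    for phi the coordinate of index i0, is a homomorphism that splits off the
    submodule generated by a vector of maximal weight. *)
Lemma top_weyl_retract M (m : nat) i0 : is_uqmod q M -> (m < l)%N ->
  (forall j, uwt M j <= uwt M i0) -> uwt M i0 = m%:Z -> retract (W m) M.
Proof.
move=> hM ml mx e0.
have nz i : (i <= m)%N -> qbinn q m i != 0.
  by move=> im; apply: (quantum_char_binn q0 hl); rewrite im ml.
pose v : 'cV[k]_(udim M) := delta_mx i0 0.
have hv : hwvec m%:Z v by rewrite -e0; apply: (max_hwvec q0 hM).
pose p : 'M[k]_(m.+1, udim M) := \matrix_(i, a) ((qbinn q m i)^-1 * E M i i0 a).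
have low j : - m%:Z <= uwt M j by apply: (uwt_lower q0 hM) => j'; rewrite -e0.
have hp : @is_uqhom k M (W m) p.
  split=> [i a|r|r].
  - rewrite mxE mulf_eq0 negb_or => /andP[_ /(uE_wt hM)].
    by rewrite e0 /= => ->; lia.
  - apply/matrixP => i a; have im : (i < m.+1)%N := ltn_ord i.
    have im' : (i <= m)%N := im.
    have -> : (p *m E M r) i a =
        (qbinn q m i)^-1 * (qbinn q (i + r) i * E M (i + r) i0 a).
      transitivity ((qbinn q m i)^-1 * (E M i *m E M r) i0 a).
        rewrite !mxE mulr_sumr; apply: eq_bigr => b _.
        by rewrite mxE mulrA.
      by rewrite (uEE hM) mxE.
    have [le|lt] := leqP (i + r) m; last first.
      have -> : E M (i + r) i0 a = 0.
        apply/eqP; apply: contraTT (low a) => /(uE_wt hM); rewrite e0.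
        by move: (nat_of_ord i) lt => n lt; lia.
      rewrite !mulr0 mxE big1 // => j _; rewrite mxE; case: eqP; rewrite ?mul0r //.
      by move=> e; have : (j < m.+1)%N := ltn_ord j; rewrite e ltnNge -ltnS ltnS lt.
    have jm : (i + r < m.+1)%N by [].
    rewrite [RHS]mxE (bigD1 (Ordinal jm)) //= big1 ?addr0 => [|j ne]; last first.
      rewrite mxE; case: eqP; rewrite ?mul0r // => e.
      by case/eqP: ne; apply: val_inj.
    rewrite !mxE /= eqxx !mulrA; congr (_ * _).
    apply: (mulfI (nz i (ltnSE im))); apply: (mulIf (nz _ le)).
    rewrite !mulrA divff ?nz // mul1r -mulrA mulVf ?nz // mulr1.
    rewrite mulrC.
    have := qbinn_trinomial q0 i r (m - (i + r)); rewrite subnKC // => ->.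
    by congr (_ * qbinn q _ _); move: (nat_of_ord i) le => n le; lia.
  - apply/matrixP => i a; have im : (i < m.+1)%N := ltn_ord i.
    have im' : (i <= m)%N := im.
    have -> : (p *m F M r) i a = (qbinn q m i)^-1 *
        (qbin q (uwt M a + i%:Z - r%:Z) r * dn (E M) i r i0 a).
      rewrite -top_row_EF // !mxE mulr_sumr; apply: eq_bigr => b _.
      by rewrite mxE mulrA.
    have [le|lt] := leqP r i; last first.
      rewrite dn_out // mxE !mulr0 mxE big1 // => j _.
      by rewrite mxE; case: eqP; rewrite ?mul0r // => e; move: lt; rewrite e ltnNge leq_addl.
    have jm : (i - r < m.+1)%N by apply: leq_ltn_trans im; apply: leq_subr.
    have jm' : (i - r <= m)%N := jm.
    rewrite [RHS]mxE (bigD1 (Ordinal jm)) //= big1 ?addr0 => [|j ne]; last first.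
      rewrite mxE; case: eqP; rewrite ?mul0r // => e.
      by case/eqP: ne; apply: val_inj; rewrite /= e addnK.
    rewrite !mxE /= subnK // eqxx /dn le.
    have [->|/(uE_wt hM)] := eqVneq (E M (i - r) i0 a) 0; first by rewrite !mulr0.
    rewrite e0 => ea; rewrite !mulrA; congr (_ * _).
    have -> : qbin q (uwt M a + i%:Z - r%:Z) r = qbinn q (m - i + r) r.
      by apply: qbinn_exact_pos; move: (nat_of_ord i) le im ea => n le im ea; lia.
    apply: (mulfI (nz i (ltnSE im))); apply: (mulIf (nz _ (ltnSE jm))).
    rewrite !mulrA divff ?nz // mul1r -[RHS]mulrA mulVf ?nz // mulr1.
    rewrite mulrC.
    have := qbinn_trinomial q0 (i - r) r (m - i); rewrite subnK // subnKC //.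
    by rewrite [qbinn q i (i - r)]qbinn_sym ?leq_subr // subKn // addnC => ->.
exists (weyl_map m v), p; split => //; first exact: weyl_map_hom.
rewrite (weyl_end_scalar q0 (is_uqhom_comp hp (weyl_map_hom q0 hM hv))).
congr (_%:M).
have pE b : p ord0 b = (b == i0)%:R.
  by rewrite mxE qbinn0 invr1 mul1r (uE0 hM) mxE eq_sym.
have vE b : weyl_map m v b ord0 = (b == i0)%:R.
  by rewrite mxE (uF0 hM) mul1mx mxE eqxx andbT.
rewrite mxE (bigD1 i0) //= big1 ?addr0 => [|j ne].
  by rewrite pE vE eqxx mul1r.
by rewrite pE (negPf ne) mul0r.
Qed.

Lemma weyl_E1_kernel m (y : 'cV[k]_(udim (W m))) (i : 'I_m.+1) : (m < l)%N ->
  E (W m) 1 *m y = 0 -> (0 < i)%N -> y i 0 = 0.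
Proof.
move=> ml Ey i0; have im : (i < m.+1)%N := ltn_ord i.
have jm : (i.-1 < m.+1)%N by move: (nat_of_ord i) im => n; lia.
have /colP/(_ (Ordinal jm)) := Ey; rewrite mxE (bigD1 i) //= big1 => [|j ne].
  rewrite !mxE /= addr0 addn1 prednK // eqxx => /eqP; rewrite mulf_eq0.
  case/orP => [|/eqP //]; apply: contraTeq => _; case: hl => _ _; apply.
  by move: (nat_of_ord i) i0 im => n; lia.
rewrite mxE /= addn1 prednK //; case: eqP; rewrite ?mul0r // => e.
by case/eqP: ne; apply: val_inj.
Qed.

(** For m < l the operator E is injective on the weight spaces of W m below the top
    one, so that W m has highest weight vectors of weight m only. *)
Lemma weyl_hom_neq m m' (f : 'M[k]_(udim (W m), udim (W m'))) :
  (m < l)%N -> is_uqhom f -> m != m' -> f = 0.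
Proof.
move=> ml hf ne; apply: weyl_hom_eq0 => //; have [fw fE _] := hf.
have y0 (i : 'I_m.+1) : (0 < i)%N -> (f *m x0 m') i 0 = 0.
  apply: weyl_E1_kernel => //; rewrite mulmxA -fE -mulmxA weylE_delta //=.
  by rewrite mulmx0.
apply/colP => i; rewrite [RHS]mxE; have [i0|] := posnP i; last exact: y0.
rewrite -colE mxE; apply/eqP; apply: contraNT ne => /fw /=.
by rewrite i0 => e; apply/eqP; lia.
Qed.

End Semisimple.

(** * Weights and decompositions *)

Section Decompositions.
Variables (k : fieldType) (q : k) (l : nat).
Hypothesis q0 : q != 0.
Hypothesis hl : quantum_char q l.
Implicit Types M X Y : uqrep k.
Local Notation P := wproj.
Local Notation E := uE.
Local Notation F := uF.
Local Notation W := (weyl q).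
Local Notation V := (weyl q 1).

Lemma l_gt1 : (1 < l)%N.
Proof. by case: hl. Qed.

Lemma Vpow_uwt n i : exists2 a, (a <= n)%N & uwt (Vpow q n) i = n%:Z - (2 * a)%:Z.
Proof.
elim: n i => [|n IH] i; first by exists 0%N; rewrite // ord1.
case: (mxtens_indexP i) => j c; have [a le e] := IH j.
have c1 : (c <= 1)%N by have : (c < 2)%N := ltn_ord c.
exists (a + c)%N; first lia.
rewrite [LHS]uwt_tens e; lia.
Qed.

Lemma Vpow_top n : exists i, uwt (Vpow q n) i = n%:Z.
Proof.
elim: n => [|n [i e]]; first by exists ord0.
exists (mxtens_index (i, ord0 : 'I_2)).
by rewrite [LHS]uwt_tens e /=; lia.
Qed.

Lemma uwt_retract X M j : retract X M -> exists i, uwt M i = uwt X j.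
Proof.
move=> [i [p [[iw _ _] hp pi]]].
have [a nz] : exists a, i a j != 0.
  apply: contrapT => no; have : col j (p *m i) = 0.
    rewrite colE -mulmxA -colE (_ : col j i = 0) ?mulmx0 //.
    apply/colP => a; rewrite !mxE; apply/eqP; apply: contrapT => /negP nz.
    by apply: no; exists a.
  by rewrite pi colE mul1mx; apply/eqP/delta_neq0.
by exists a; apply: iw.
Qed.

(** W m is a summand of V^m, whose largest weight is m. *)
Lemma weyl_uqmod m : (m < l)%N -> is_uqmod q (W m).
Proof.
move=> ml; apply: (uqmod_retract (Vpow_uqmod q0 m)).
have [i e] := Vpow_top m; apply: (top_weyl_retract q0 hl _ ml _ e).
  exact: Vpow_uqmod.
by move=> j; rewrite e; have [a _ ->] := Vpow_uwt j; lia.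
Qed.

(** Scalar endomorphisms leave no idempotents other than 0 and 1. *)
Lemma weyl_indecomposable m : indecomposable (W m).
Proof.
split=> // X Y [iX [pX [iY [pY b]]]].
have [oX oY] := biproduct_orth b.
case: b => [[hiX hpX hiY hpY] [pX1 pY1 _]].
have eX := weyl_end_scalar q0 (is_uqhom_comp hiX hpX).
have eY := weyl_end_scalar q0 (is_uqhom_comp hiY hpY).
move: ((iX *m pX) _ _) ((iY *m pY) _ _) eX eY => c d eX eY.
have : iX *m pX *m (iY *m pY) = 0 by rewrite mulmxA -(mulmxA iX) oY mulmx0 mul0mx.
rewrite eX eY -scalar_mxM => /matrixP/(_ ord0 ord0).
rewrite !mxE eqxx mulr1n => /eqP; rewrite mulf_eq0 => /orP[] /eqP z; [left|right].
  have : pX *m (iX *m pX) *m iX = 1%:M by rewrite mulmxA pX1 mul1mx.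
  rewrite eX z raddf0 mulmx0 mul0mx => /esym h.
  by have := mxrank1 k (udim X); rewrite h mxrank0.
have : pY *m (iY *m pY) *m iY = 1%:M by rewrite mulmxA pY1 mul1mx.
rewrite eY z raddf0 mulmx0 mul0mx => /esym h.
by have := mxrank1 k (udim Y); rewrite h mxrank0.
Qed.

(** An induction principle: the identity is a sum of maps that factor through Weyl
    modules, obtained by splitting off top Weyl modules one after the other. *)
Lemma weyl_ideal M (b : nat) (Q : 'M[k]_(udim M) -> Prop) : is_uqmod q M ->
  (b < l)%N -> (forall i, uwt M i <= b%:Z) -> Q 0 ->
  (forall x y, Q x -> Q y -> Q (x + y)) ->
  (forall m (i : 'M[k]_(udim M, udim (W m))) (p : 'M[k]_(udim (W m), udim M)),
    (m <= b)%N -> is_uqhom i -> is_uqhom p -> Q (i *m p)) -> Q 1%:M.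
Proof.
move=> hM bl wM Q0 QD QW.
suff gen n X (i : 'M[k]_(udim M, udim X)) (p : 'M[k]_(udim X, udim M)) :
    (udim X <= n)%N -> is_uqmod q X -> (forall i, uwt X i <= b%:Z) ->
    is_uqhom i -> is_uqhom p -> Q (i *m p).
  by rewrite -[1%:M]mul1mx; apply: (gen (udim M)) => //; apply: uqhom_id.
elim: n X i p => [|n IH] X i p dX hX wX hi hp.
  rewrite (_ : i *m p = 0) //; apply/matrixP => a c; rewrite !mxE big1 // => j.
  by have := ltn_ord j; rewrite ltnNge (leq_trans dX).
have [d0|d0] := posnP (udim X); first by apply: IH; rewrite ?d0.
have [i0 mx] := max_uwt d0.
have w0 := max_uwt_ge0 q0 hX mx; have wb := wX i0.
pose m := `|uwt X i0|%N; have em : uwt X i0 = m%:Z by rewrite /m; lia.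
have mb : (m <= b)%N by rewrite -lez_nat -em.
have [iW [pW [hiW hpW pW1]]] := top_weyl_retract q0 hl hX (leq_ltn_trans mb bl) mx em.
have [Y [iY [pY bp]]] := retract_biproduct hiW hpW pW1.
have dXY := biproduct_dim bp; case: bp => [[_ _ hiY hpY] [_ pY1 e]].
have rY : retract Y X by exists iY, pY.
rewrite -[i]mulmx1 -e mulmxDr mulmxDl !mulmxA -!(mulmxA (i *m _)).
apply: QD; first by apply: QW => //; exact: is_uqhom_comp.
apply: IH => //; try exact: is_uqhom_comp.
- by move: dX; rewrite dXY /=; lia.
- exact: uqmod_retract rY.
- by move=> j; have [a <-] := uwt_retract j rY.
Qed.

(** Without a left inverse, every map M -> W a -> M would kill f, and so would the
    identity of M, which is a sum of such maps. *)
Lemma weyl_split M (b m : nat) (f : 'M[k]_(udim M, udim (W m))) : is_uqmod q M ->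
  (b < l)%N -> (forall i, uwt M i <= b%:Z) -> (m < l)%N -> is_uqhom f -> f != 0 ->
  exists2 g : 'M[k]_(udim (W m), udim M), is_uqhom g & g *m f = 1%:M.
Proof.
move=> hM bl wM ml hf nz; apply: contrapT => no; case/eqP: nz.
rewrite -[f]mul1mx; apply: (weyl_ideal (Q := fun e => e *m f = 0) hM bl wM).
- exact: mul0mx.
- by move=> x y fx fy; rewrite mulmxDl fx fy addr0.
move=> a i p ab hi hp; rewrite -mulmxA.
have hpf := is_uqhom_comp hp hf.
have al := leq_ltn_trans ab bl.
have [e|ne] := eqVneq a m; last by rewrite (weyl_hom_neq q0 hl al hpf) // mulmx0.
subst a; have pf := weyl_end_scalar q0 hpf; move: ((p *m f) _ _) pf => c pf.
have [c0|c0] := eqVneq c 0; first by rewrite pf c0 raddf0 mulmx0.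
case: no; exists (c^-1 *: p); first exact: uqhomZ.
by rewrite -scalemxAl pf scale_scalar_mx mulVf.
Qed.

(** The dual also has largest weight m, so that W m splits off it, and both have
    dimension m + 1. *)
Lemma weyl_nabla m : (m < l)%N -> exists (t : 'M[k]_(udim (W m), udim (nabla q m)))
  (t' : 'M[k]_(udim (nabla q m), udim (W m))),
  [/\ is_uqhom t, is_uqhom t' , t *m t' = 1%:M & t' *m t = 1%:M].
Proof.
move=> ml; have hN : is_uqmod q (nabla q m) by apply/udual_uqmod/weyl_uqmod.
have mx (j : 'I_m.+1) : uwt (nabla q m) j <= uwt (nabla q m) (ord_max : 'I_m.+1).
  by have : (j < m.+1)%N := ltn_ord j; rewrite /=; lia.
have em : uwt (nabla q m) (ord_max : 'I_m.+1) = m%:Z by rewrite /=; lia.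
have [i [p [hi hp pi]]] := top_weyl_retract q0 hl hN ml mx em.
by exists p, i; split=> //; apply: mulmx1C.
Qed.

Definition wdim M w := \rank (P M w).

Lemma rank_dsum n x y (iX : 'M[k]_(n, x)) (pX : 'M[k]_(x, n))
    (iY : 'M[k]_(n, y)) (pY : 'M[k]_(y, n)) (A : 'M[k]_x) (B : 'M[k]_y) :
  pX *m iX = 1%:M -> pY *m iY = 1%:M -> pX *m iY = 0 -> pY *m iX = 0 ->
  \rank (iX *m A *m pX + iY *m B *m pY)%R = (\rank A + \rank B)%N.
Proof.
move=> x1 y1 xy yx; pose g := row_mx iX iY; pose g' := col_mx pX pY.
have gg : g' *m g = 1%:M by rewrite mul_col_row x1 y1 xy yx -scalar_mx_block.
rewrite -rank_diag_block_mx.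
have -> : iX *m A *m pX + iY *m B *m pY = g *m block_mx A 0 0 B *m g'.
  by rewrite mul_row_block !mulmx0 addr0 add0r mul_row_col.
apply/eqP; rewrite eqn_leq; apply/andP; split.
  by apply: leq_trans (mxrankM_maxl _ _) _; apply: mxrankM_maxr.
rewrite -[X in (\rank X <= _)%N]mul1mx -[X in (\rank X <= _)%N]mulmx1 -gg.
rewrite -!mulmxA (mulmxA g) (mulmxA _ g') .
apply: leq_trans (mxrankM_maxr _ _) _; rewrite !mulmxA.
by apply: leq_trans (mxrankM_maxl _ _) _.
Qed.

Lemma wdim_biproduct M X Y iX pX iY pY w : @biproduct k M X Y iX pX iY pY ->
  wdim M w = (wdim X w + wdim Y w)%N.
Proof.
move=> b; have [o1 o2] := biproduct_orth b.
case: b => [[/uqhomE hiX _ /uqhomE hiY _] [px py e]].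
rewrite /wdim -(rank_dsum _ _ px py o2 o1); congr (\rank _).
rewrite -[LHS]mulmx1 -e mulmxDr !mulmxA.
by rewrite -[P M w]/(act M (GenP w)) -hiX -hiY.
Qed.

Lemma wdim_tens M w : wdim (utens q M V) w = (wdim M (w - 1) + wdim M (w + 1))%N.
Proof.
have oc b c := tinj_orth q M b c.
rewrite /wdim -(rank_dsum (iX := tinj q M ord0) (pX := (tinj q M ord0)^T)
  (iY := tinj q M ord_max) (pY := (tinj q M ord_max)^T)) ?oc ?raddf0 //.
congr (\rank _); rewrite -[LHS]mulmx1 -tinj_sum mulmxDr !mulmxA !tP.
by congr (_ *m P M _ *m _ + _ *m P M _ *m _); lia.
Qed.

Lemma wdim_weyl a w :
  wdim (W a) w = [exists i : 'I_a.+1, a%:Z - (2 * i)%:Z == w] :> nat.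
Proof.
rewrite /wdim; case: existsP => [[i /eqP e]|no].
  rewrite (_ : P (W a) w = (delta_mx i i : 'M_a.+1)) ?mxrank_delta //.
  apply/matrixP => x y; rewrite !mxE /= -e.
  have [->|ne] := eqVneq x y; last first.
    by rewrite mulr0n; have [<-|] := eqVneq x i; rewrite //= eq_sym (negPf ne).
  rewrite mulr1n andbb; congr (nat_of_bool _)%:R; apply/eqP/eqP => [h|->//].
  by apply: val_inj; rewrite /=; lia.
rewrite (_ : P _ _ = 0) ?mxrank0 //; apply/matrixP => x y; rewrite !mxE /=.
case: eqP => [e|_]; last by rewrite mul0rn.
by case: no; exists x; apply/eqP.
Qed.

Lemma wdim_eq0 M w : (forall i, uwt M i != w) -> wdim M w = 0%N.
Proof.
move=> no; rewrite /wdim (_ : P _ _ = 0) ?mxrank0 //; apply/matrixP => x y.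
by rewrite !mxE (negPf (no _)) mul0rn.
Qed.

End Decompositions.

(** * The quantum trace *)

(** An endomorphism f of M (x) V is given by four blocks a, b, c, d with respect to
    M (x) x_0 and M (x) x_1. *)
Section PartialTrace.
Variables (k : fieldType) (q : k).
Hypothesis q0 : q != 0.
Variable M : uqrep k.
Hypothesis hM : is_uqmod q M.
Local Notation P := wproj.
Local Notation E := uE.
Local Notation F := uF.
Let K := wfun M (fun w => q ^ w).
Variables (n : nat) (J0 J1 : 'M[k]_(n, udim M)).
Variables (ET FT : nat -> 'M[k]_n) (PT : int -> 'M[k]_n).
Hypothesis J00 : J0^T *m J0 = 1%:M.
Hypothesis J01 : J0^T *m J1 = 0.
Hypothesis J10 : J1^T *m J0 = 0.
Hypothesis J11 : J1^T *m J1 = 1%:M.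
Hypothesis tP0 : forall w, PT w *m J0 = J0 *m P M (w - 1).
Hypothesis tP1 : forall w, PT w *m J1 = J1 *m P M (w + 1).
Hypothesis tE0 : forall r, ET r *m J0 = J0 *m E M r.
Hypothesis tE1 : forall r, ET r *m J1 = J1 *m E M r +
  q ^ (r%:Z - 1) *: (J0 *m (dn (E M) r 1 *m K)).
Hypothesis tF0 : forall r, FT r *m J0 = q ^ (- r%:Z) *: (J0 *m F M r) +
  J1 *m dn (F M) r 1.
Hypothesis tF1 : forall r, FT r *m J1 = q ^ r%:Z *: (J1 *m F M r).
Variable f : 'M[k]_n.
Hypothesis fE : forall r, f *m ET r = ET r *m f.
Hypothesis fF : forall r, f *m FT r = FT r *m f.
Hypothesis fP : forall w, f *m PT w = PT w *m f.

Variables a b c d : 'M[k]_(udim M).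
Hypothesis block_col0 : f *m J0 = J0 *m a + J1 *m c.
Hypothesis block_col1 : f *m J1 = J0 *m b + J1 *m d.

Lemma proj_cols p (X Y : 'M[k]_(udim M, p)) :
  J0^T *m (J0 *m X + J1 *m Y) = X /\ J1^T *m (J0 *m X + J1 *m Y) = Y.
Proof.
by rewrite !mulmxDr !mulmxA J00 J01 J10 J11 !mul1mx !mul0mx addr0 add0r.
Qed.

Lemma cols_inj p (X Y X' Y' : 'M[k]_(udim M, p)) :
  J0 *m X + J1 *m Y = J0 *m X' + J1 *m Y' -> X = X' /\ Y = Y'.
Proof.
move=> e; have [x y] := proj_cols X Y; have [x' y'] := proj_cols X' Y'.
by split; [rewrite -x -x' e|rewrite -y -y' e].
Qed.

Lemma block_P w : [/\ a *m P M w = P M w *m a, c *m P M w = P M (w + 2) *m c,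
  b *m P M w = P M (w - 2) *m b & d *m P M w = P M w *m d].
Proof.
have e0 : f *m PT (w + 1) *m J0 = PT (w + 1) *m f *m J0 by rewrite fP.
have e1 : f *m PT (w - 1) *m J1 = PT (w - 1) *m f *m J1 by rewrite fP.
move: e0 e1; rewrite -!mulmxA tP0 tP1 !(mulmxA f) block_col0 block_col1.
rewrite !mulmxDr !mulmxDl !(mulmxA (PT _)) !tP0 !tP1 -!mulmxA.
have -> : w + 1 - 1 = w by lia.
have -> : w + 1 + 1 = w + 2 by lia.
have -> : w - 1 + 1 = w by lia.
have -> : w - 1 - 1 = w - 2 by lia.
by move=> /cols_inj[? ?] /cols_inj[? ?]; split.
Qed.

Lemma block_E r : [/\ a *m E M r = E M r *m a + q ^ (r%:Z - 1) *: (dn (E M) r 1 *m (K *m c)),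
  c *m E M r = E M r *m c &
  q ^ (r%:Z - 1) *: (c *m (dn (E M) r 1 *m K)) + d *m E M r = E M r *m d].
Proof.
have e0 : f *m ET r *m J0 = ET r *m f *m J0 by rewrite fE.
have e1 : f *m ET r *m J1 = ET r *m f *m J1 by rewrite fE.
move: e0; rewrite -!mulmxA tE0 !(mulmxA f) block_col0.
rewrite mulmxDr mulmxDl !(mulmxA (ET _)) tE0 tE1 mulmxDl -scalemxAl -!mulmxA.
rewrite [X in _ = _ + X]addrC addrA scalemxAr -mulmxDr => /cols_inj[-> ->].
set x := q ^ (r%:Z - 1); set D := dn (E M) r 1 *m K.
have e1' : J0 *m (b *m E M r + x *: (a *m D)) + J1 *m (d *m E M r + x *: (c *m D)) =
    J0 *m (E M r *m b + x *: (D *m d)) + J1 *m (E M r *m d).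
  move: e1; rewrite -!mulmxA tE1 mulmxDr -/x -/D -scalemxAr !(mulmxA f) block_col0.
  rewrite block_col1 !mulmxDl !mulmxDr !mulmxA tE0 tE1 -/x -/D mulmxDl.
  rewrite -!scalemxAl -!scalemxAr scalerDr !mulmxA => e.
  by rewrite addrACA e addrA addrAC.
by have [_ <-] := cols_inj e1'; split=> //; rewrite addrC.
Qed.

Lemma block_F r : [/\ q ^ (- r%:Z) *: (a *m F M r) + b *m dn (F M) r 1 =
    q ^ (- r%:Z) *: (F M r *m a),
  q ^ r%:Z *: (b *m F M r) = q ^ (- r%:Z) *: (F M r *m b) &
  q ^ r%:Z *: (d *m F M r) = dn (F M) r 1 *m b + q ^ r%:Z *: (F M r *m d)].
Proof.
have e0 : f *m FT r *m J0 = FT r *m f *m J0 by rewrite fF.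
have e1 : f *m FT r *m J1 = FT r *m f *m J1 by rewrite fF.
have e1' : J0 *m (q ^ r%:Z *: (b *m F M r)) + J1 *m (q ^ r%:Z *: (d *m F M r)) =
  J0 *m (q ^ (- r%:Z) *: (F M r *m b)) +
  J1 *m (dn (F M) r 1 *m b + q ^ r%:Z *: (F M r *m d)).
  move: e1; rewrite -!mulmxA tF1 -scalemxAr (mulmxA f) block_col1 mulmxDl.
  rewrite !mulmxDr !mulmxA tF0 tF1 mulmxDl -!scalemxAl -!scalemxAr scalerDr.
  by rewrite !mulmxA addrA.
have e0' : J0 *m (q ^ (- r%:Z) *: (a *m F M r) + b *m dn (F M) r 1) +
  J1 *m (q ^ (- r%:Z) *: (c *m F M r) + d *m dn (F M) r 1) =
  J0 *m (q ^ (- r%:Z) *: (F M r *m a)) +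
  J1 *m (dn (F M) r 1 *m a + q ^ r%:Z *: (F M r *m c)).
  rewrite !mulmxDr -!scalemxAr; have e := e0.
  rewrite -!mulmxA tF0 mulmxDr -scalemxAr !(mulmxA f) block_col0 block_col1 in e.
  rewrite !mulmxDl !mulmxDr scalerDr !(mulmxA (FT r)) tF0 tF1 mulmxDl in e.
  rewrite -!scalemxAl -!mulmxA in e.
  by rewrite addrACA e !addrA.
by have [? ?] := cols_inj e1'; have [? _] := cols_inj e0'.
Qed.

(** The quantum partial trace of f over the factor V. *)
Definition ptrace := q^-1 *: a + q *: d.

Lemma wfun_shift h h' (x : 'M[k]_(udim M)) s :
  (forall w, x *m P M w = P M (w + s) *m x) -> (forall w, h (w + s) = h' w) ->
  wfun M h *m x = x *m wfun M h'.
Proof.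
move=> xP hh; apply: wproj_ext => w; rewrite -mulmxA xP mulmxA wfun_proj.
by rewrite -mulmxA wfun_proj -scalemxAr xP -scalemxAl hh.
Qed.

(** Comparing the blocks of f E^(r) with those of E^(r) f, and likewise for F^(r),
    expresses the failure of a and d to commute with the action through c and b;
    the weights q^-1 and q make these errors cancel. *)
Lemma ptrace_hom : @is_uqhom k M M ptrace.
Proof.
have qi : q^-1 = q ^ (-1) by rewrite exprN1.
have qq (y : k) : q * y = q ^ 1 * y by rewrite expr1z.
apply/uqhomE; case=> [w|r|r] /=; rewrite mulmxDl mulmxDr -!scalemxAl -!scalemxAr.
- by have [-> _ _ ->] := block_P w.
- have [-> cE <-] := block_E r.
  have -> : c *m (dn (E M) r 1 *m K) = q ^ (-2) *: (dn (E M) r 1 *m (K *m c)).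
    have -> : K *m c = q ^ 2 *: (c *m K).
      rewrite (@wfun_shift _ (fun w => q ^ 2 * q ^ w) c 2); first last.
      - by move=> w; rewrite -expfzDr // addrC.
      - by move=> w; case: (block_P w).
      by rewrite scalemxAr; congr (_ *m _); apply/matrixP => i j; rewrite !mxE mulrnAr.
    rewrite -scalemxAr scalerA -expfzDr // addNr expr0z scale1r !mulmxA.
    congr (_ *m _); rewrite /dn; case: (1 <= r)%N; last by rewrite mul0mx mulmx0.
    by have [_ -> _] := block_E (r - 1).
  rewrite !scalerDr !scalerA -!addrA; congr (_ + _).
  congr (_ *: _ + _); rewrite qi qq -!expfzDr //.
  by congr (q ^ _); lia.
- have [e0 e1 e2] := block_F r.
  have aF : a *m F M r = F M r *m a - q ^ r%:Z *: (b *m dn (F M) r 1).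
    have := congr1 (fun y => q ^ r%:Z *: y) e0.
    rewrite scalerDr !scalerA -!expfzDr // subrr expr0z !scale1r => <-.
    by rewrite addrK.
  have dF : d *m F M r = F M r *m d + q ^ (- r%:Z) *: (dn (F M) r 1 *m b).
    have := congr1 (fun y => q ^ (- r%:Z) *: y) e2.
    rewrite scalerDr !scalerA -!expfzDr // addNr expr0z !scale1r => ->.
    by rewrite addrC.
  have -> : F M r *m a = a *m F M r + q ^ r%:Z *: (b *m dn (F M) r 1).
    by rewrite aF subrK.
  rewrite dF; have -> : dn (F M) r 1 *m b = q ^ (2 * r%:Z - 2) *: (b *m dn (F M) r 1).
    rewrite /dn; case: (leqP 1 r) => r1; last by rewrite mul0mx mulmx0 scaler0.
    have [_ eb _] := block_F (r - 1).
    have := congr1 (fun y => q ^ (r - 1)%N%:Z *: y) eb.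
    rewrite !scalerA -!expfzDr // subrr expr0z scale1r => <-.
    by congr (q ^ _ *: _); lia.
  rewrite !scalerDr !scalerA -!addrA; congr (_ + _).
  rewrite addrC; congr (_ *: _ + _); rewrite qi ?qq -!expfzDr //.
  by congr (q ^ _ *: _); lia.
Qed.

End PartialTrace.

Section Negligible.
Variables (k : fieldType) (q : k) (l : nat).
Hypothesis q0 : q != 0.
Hypothesis hl : quantum_char q l.
Implicit Types M N X Y : uqrep k.
Local Notation P := wproj.
Local Notation W := (weyl q).
Local Notation V := (weyl q 1).

(** The quantum trace of f is the trace of K^-1 f. *)
Definition Kinv M := wfun M (fun w => q ^ (- w)).

(** The ideal of maps in the radical of the quantum trace form. *)
Definition qtrace_null M (e : 'M[k]_(udim M)) : Prop :=
  forall f : 'M[k]_(udim M), is_uqhom f -> \tr (Kinv M *m (f *m e)) = 0.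

Lemma qtrace_nullD M (x y : 'M[k]_(udim M)) :
  qtrace_null x -> qtrace_null y -> qtrace_null (x + y).
Proof. by move=> hx hy f hf; rewrite !mulmxDr linearD /= hx // hy // addr0. Qed.

Lemma qtrace_null0 M : qtrace_null (0 : 'M[k]_(udim M)).
Proof. by move=> f _; rewrite !mulmx0 linear0. Qed.

Lemma qtrace_null_comp M N (a : 'M[k]_(udim M, udim N)) e b : is_uqhom a ->
  is_uqhom b -> @qtrace_null N e -> qtrace_null (a *m e *m b).
Proof.
move=> ha hb he f hf; rewrite !mulmxA mxtrace_mulC !mulmxA.
rewrite [b *m _]hom_wfun // -!mulmxA (mulmxA b) (mulmxA (b *m f)).
by apply: he; apply: is_uqhom_comp => //; apply: is_uqhom_comp.
Qed.

Lemma qtrace_weyl m : \tr (Kinv (W m)) = qbinn q m.+1 1.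
Proof.
rewrite -(qint_trace q0) [LHS](@mxtrace_diag _ m.+1); apply: eq_bigr => i _.
by rewrite mxE; congr (q ^ _) => /=; lia.
Qed.

(** The endomorphisms of W (l - 1) are scalars and its quantum dimension is [l] = 0. *)
Lemma qtrace_null_steinberg : qtrace_null (1%:M : 'M[k]_(udim (W l.-1))).
Proof.
move=> f hf; rewrite mulmx1 (weyl_end_scalar q0 hf).
have l1 : l.-1.+1 = l by case: hl; lia.
have e : qbinn q l.-1.+1 1 = 0 by rewrite l1; case: hl.
by rewrite mul_mx_scalar linearZ /= qtrace_weyl e mulr0.
Qed.

Lemma wfun_tinj M h (b : 'I_2) : wfun (utens q M V) h *m tinj q M b =
  tinj q M b *m wfun M (fun w => h (w + (1 - (2 * b)%:Z))).
Proof.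
apply/matrixP => x i; rewrite mul_tinj; case: (mxtens_indexP x) => j c.
rewrite tinj_mul !mxE uwt_tens (can_eq (@mxtens_indexK _ _)) xpair_eqE.
have [->|] := eqVneq j i; last by rewrite /= mulr0.
by have [->|] := eqVneq c b; rewrite /= ?mul0r // mul1r.
Qed.

(** The quantum trace of f (e (x) 1) is that of the partial trace of f times e. *)
Lemma qtrace_null_tens M (e : 'M[k]_(udim M)) : is_uqmod q M ->
  qtrace_null e -> @qtrace_null (utens q M V) (tmap q e).
Proof.
move=> hM he f hf; have /uqhomE hg := hf.
set J0 := tinj q M ord0; set J1 := tinj q M ord_max.
have o00 : J0^T *m J0 = 1%:M by rewrite tinj_orth.
have o01 : J0^T *m J1 = 0 by rewrite tinj_orth raddf0.
have o10 : J1^T *m J0 = 0 by rewrite tinj_orth raddf0.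
have o11 : J1^T *m J1 = 1%:M by rewrite tinj_orth.
have sm := tinj_sum q M.
pose a := J0^T *m (f *m J0); pose b := J0^T *m (f *m J1).
pose c := J1^T *m (f *m J0); pose d := J1^T *m (f *m J1).
have f0 : f *m J0 = J0 *m a + J1 *m c by rewrite !mulmxA -!mulmxDl sm mul1mx.
have f1 : f *m J1 = J0 *m b + J1 *m d by rewrite !mulmxA -!mulmxDl sm mul1mx.
have tP0 w : P (utens q M V) w *m J0 = J0 *m P M (w - 1) by rewrite tP.
have tP1 w : P (utens q M V) w *m J1 = J1 *m P M (w + 1).
  by rewrite tP; congr (_ *m P M _); lia.
have hp := ptrace_hom q0 o00 o01 o10 o11 tP0 tP1 (@tE0 k q q0 M)
  (@tE1 k q q0 M) (@tF0 k q q0 M) (@tF1 k q q0 M) (fun r => hg (GenE r))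
  (fun r => hg (GenF r)) (fun w => hg (GenP w)) f0 f1.
have Kt (x : k) (b' : 'I_2) : (forall w, q ^ (- (w + (1 - (2 * b')%:Z))) = x * q ^ (- w)) ->
    (tinj q M b')^T *m Kinv (utens q M V) = x *: (Kinv M *m (tinj q M b')^T).
  move=> hx.
  have ek : Kinv (utens q M V) *m tinj q M b' = x *: (tinj q M b' *m Kinv M).
    rewrite [LHS]wfun_tinj scalemxAr; congr (_ *m _); apply/matrixP => y z.
    by rewrite !mxE hx mulrnAr.
  apply: trmx_inj; rewrite trmx_mul trmxK [(Kinv (utens q M V))^T]tr_wfun ek.
  by rewrite linearZ /= trmx_mul trmxK [(Kinv M)^T]tr_wfun.
rewrite /tmap -/J0 -/J1 !mulmxDr linearD /= !mulmxA.
rewrite [\tr (_ *m J0^T)]mxtrace_mulC [\tr (_ *m J1^T)]mxtrace_mulC !mulmxA.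
rewrite (Kt q^-1) => [|w]; last first.
  by rewrite -exprN1 -expfzDr //; congr (q ^ _); rewrite /=; lia.
rewrite (Kt q) => [|w]; last first.
  by rewrite -{2}[q]expr1z -expfzDr //; congr (q ^ _); rewrite /=; lia.
rewrite -!scalemxAl !linearZ /= -!mulmxA !(mulmxA f) !(mulmxA (_^T)) -/a -/d.
have := he _ hp; rewrite /ptrace mulmxDl mulmxDr linearD /= -!scalemxAl -!scalemxAr.
by rewrite !linearZ /= /a /d !mulmxA.
Qed.

(** A weight l - 1 is maximal, hence carried by a summand W (l - 1), on which the
    quantum trace form is zero.  Its weights all have multiplicity one, so that
    removing it changes no difference of multiplicities at m and m + 2. *)
Lemma steinberg_split M : is_uqmod q M -> (forall j, uwt M j <= (l - 1)%N%:Z) ->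
  (forall w, wdim M w = wdim M (- w)) ->
  exists X (i : 'M[k]_(udim M, udim X)) (p : 'M[k]_(udim X, udim M)),
  [/\ [/\ is_uqhom i, is_uqhom p & p *m i = 1%:M],
      forall j, uwt X j <= (l - 2)%N%:Z, forall w, wdim X w = wdim X (- w),
      qtrace_null (1%:M - i *m p) &
      forall m : nat, (m <= l - 2)%N ->
        (wdim X m%:Z + wdim M (m%:Z + 2) = wdim M m%:Z + wdim X (m%:Z + 2))%N].
Proof.
have l1 := l_gt1 hl.
have [n] := ubnP (udim M); elim: n M => // n IH M dM hM wM sM.
have [[j ej]|no] := pselect (exists j, uwt M j = (l - 1)%N%:Z); last first.
  exists M, 1%:M, 1%:M; split=> //; first by split; rewrite ?mulmx1 //; apply: uqhom_id.
  - move=> j; have := wM j; rewrite le_eqVlt => /orP[/eqP e|]; last lia.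
    by case: no; exists j.
  - by rewrite mulmx1 subrr; apply: qtrace_null0.
have ll : (l - 1 < l)%N by lia.
have [iW [pW [hiW hpW pW1]]] : retract (W (l - 1)) M.
  by apply: (top_weyl_retract q0 hl hM ll _ ej) => j'; rewrite ej.
have [Y [iY [pY bp]]] := retract_biproduct hiW hpW pW1.
have nM w := wdim_biproduct w bp; have dM' := biproduct_dim bp.
case: bp => [[_ _ hiY hpY] [_ pY1 e]].
have rY : retract Y M by exists iY, pY.
have sW w : wdim (W (l - 1)) w = wdim (W (l - 1)) (- w).
  rewrite !(wdim_weyl q0); congr nat_of_bool; apply/existsP/existsP => -[x /eqP ex];
    by exists (rev_ord x); apply/eqP; have : (x < (l - 1).+1)%N := ltn_ord x;
       rewrite /= subSS; lia.
have [||||X [i [p [[hi hp pi] wX sX tX cX]]]] := IH Y.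
- by move: dM; rewrite dM' /=; lia.
- exact: uqmod_retract rY.
- by move=> y; have [a <-] := uwt_retract y rY.
- by move=> w; apply: (@addnI (wdim (W (l - 1)) w)); rewrite -nM sM nM -sW.
exists X, (iY *m i), (p *m pY); split=> //.
- split; try exact: is_uqhom_comp.
  by rewrite mulmxA -(mulmxA p) pY1 mulmx1.
- have -> : 1%:M - iY *m i *m (p *m pY) = iW *m 1%:M *m pW + iY *m (1%:M - i *m p) *m pY.
    by rewrite mulmx1 mulmxBr mulmxBl mulmx1 addrA e !mulmxA.
  apply: qtrace_nullD; apply: qtrace_null_comp => //.
  by rewrite subn1; apply: qtrace_null_steinberg.
- move=> m ml; have := cX m ml; rewrite !nM.
  (* m and m + 2 are both weights of W (l - 1), or neither is. *)
  have -> : wdim (W (l - 1)) (m%:Z + 2) = wdim (W (l - 1)) m%:Z; last by lia.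
  rewrite !(wdim_weyl q0); congr nat_of_bool; apply/existsP/existsP => -[x /eqP ex].
    have x1 : (x.+1 < (l - 1).+1)%N by lia.
    by exists (Ordinal x1); apply/eqP; rewrite /=; lia.
  have x1 : (x.-1 < (l - 1).+1)%N by have : (x < (l - 1).+1)%N := ltn_ord x; lia.
  by exists (Ordinal x1); apply/eqP; rewrite /=; lia.
Qed.

End Negligible.

(** * Counting functionals killed by F *)

Section Filtrations.
Variables (k : fieldType) (q : k).
Hypothesis q0 : q != 0.
Implicit Types M X Y : uqrep k.
Local Notation P := wproj.
Local Notation E := uE.
Local Notation F := uF.
Local Notation W := (weyl q).
Local Notation V := (weyl q 1).

(** The row vectors, that is functionals, of weight w that vanish on the images
    of the divided powers of F: they correspond to the homomorphisms from M to
    the dual Weyl module of highest weight w. *)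
Definition primmx M (w : int) : 'M[k]_(udim M) :=
  ((\bigcap_(r < wbound M) kermx (F M r.+1)) :&: kermx (1%:M - P M w))%MS.

Definition prim_dim M w : nat := \rank (primmx M w).

Lemma primP M w p (x : 'M[k]_(p, udim M)) : is_uqmod q M ->
  (x <= primmx M w)%MS <-> (x *m P M w = x /\ forall r, (0 < r)%N -> x *m F M r = 0).
Proof.
move=> hM; rewrite sub_capmx; split.
  case/andP => /sub_bigcapmxP H /sub_kermxP; rewrite mulmxBr mulmx1 => /eqP.
  rewrite subr_eq0 => /eqP <-; split=> // -[//|r] _.
  have [lt|ge] := ltnP r (wbound M); last by rewrite (uF_wbound q0 hM) ?mulmx0.
  by apply/sub_kermxP; apply: (H (Ordinal lt)).
case=> xP xF; apply/andP; split.
  by apply/sub_bigcapmxP => r _; apply/sub_kermxP; apply: xF.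
by apply/sub_kermxP; rewrite mulmxBr mulmx1 xP subrr.
Qed.

Lemma prim_dim_le_wdim M w : is_uqmod q M -> (prim_dim M w <= wdim M w)%N.
Proof.
move=> hM; have [xP _] := (primP w (primmx M w) hM).1 (submx_refl _).
by rewrite /prim_dim -xP; apply: mxrankM_maxr.
Qed.

(** The commutation formula gives x E^(r) F^(r) = [w; r] x for such a functional x,
    and F^(r) vanishes for large r. *)
Lemma prim_dim_neg M w : is_uqmod q M -> w < 0 -> prim_dim M w = 0%N.
Proof.
move=> hM; case: w => // n _; rewrite NegzE.
set w := - n.+1%:Z; set x := primmx M w.
have [xP xF] := (primP w x hM).1 (submx_refl _).
have [r lt nz] := qbin_neg_neq0 q0 n (wbound M).+1.
suff x0 : x = 0 by rewrite /prim_dim -/x x0 mxrank0.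
have : x *m (E M r *m F M r *m P M w) = 0.
  by rewrite (uF_wbound q0 hM lt) mulmx0 mul0mx mulmx0.
rewrite (@uEF_wproj _ _ M r r w r.+1 hM) ?minnn // mulmx_sumr.
rewrite (bigD1 ord_max) //= big1 ?addr0 => [|t ne].
  rewrite /dn leqnn subnn (uE0 hM) (uF0 hM) mulmx1 mul1mx -scalemxAr xP addrK.
  by move/eqP; rewrite scaler_eq0 (negPf nz) => /eqP.
rewrite -scalemxAr -[X in x *m X]mulmxA (mulmxA x) /(dn (F M)).
have tr : (t < r)%N by move: ne (ltn_ord t); rewrite -val_eqE /= ltnS leq_eqVlt => /negPf->.
by rewrite (ltnW tr) xF ?subn_gt0 // mul0mx scaler0.
Qed.

Lemma prim_dim_biproduct M X Y iX pX iY pY w : is_uqmod q M ->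
  is_uqmod q X -> is_uqmod q Y ->
  @biproduct k M X Y iX pX iY pY -> (prim_dim X w + prim_dim Y w <= prim_dim M w)%N.
Proof.
move=> hM hX hY b; have [o1 o2] := biproduct_orth b.
case: b => [[_ /uqhomE hpX _ /uqhomE hpY] [px py _]].
pose A := col_mx (primmx X w *m pX) (primmx Y w *m pY).
have -> : (prim_dim X w + prim_dim Y w)%N = \rank A.
  have -> : A = block_mx (primmx X w) 0 0 (primmx Y w) *m col_mx pX pY.
    by rewrite mul_block_col !mul0mx addr0 add0r.
  rewrite mxrankMfree ?rank_diag_block_mx // -row_leq_rank.
  have gg : col_mx pX pY *m row_mx iX iY = 1%:M.
    by rewrite mul_col_row px py o1 o2 -scalar_mx_block.
  by rewrite -[X in (X <= _)%N](mxrank1 k) -gg mxrankM_maxl.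
apply: mxrankS; rewrite col_mx_sub; apply/andP; split; apply/(primP w _ hM).
  have [xP xF] := (primP w (primmx X w) hX).1 (submx_refl _).
  split=> [|r r0]; rewrite -mulmxA.
    by rewrite [pX *m P M w](hpX (GenP w)) mulmxA xP.
  by rewrite [pX *m F M r](hpX (GenF r)) mulmxA xF // mul0mx.
have [xP xF] := (primP w (primmx Y w) hY).1 (submx_refl _).
split=> [|r r0]; rewrite -mulmxA.
  by rewrite [pY *m P M w](hpY (GenP w)) mulmxA xP.
by rewrite [pY *m F M r](hpY (GenF r)) mulmxA xF // mul0mx.
Qed.

Lemma rank_split n p1 p2 m (A : 'M[k]_(m, n)) (J0 : 'M[k]_(n, p1)) (J1 : 'M[k]_(n, p2))
   (J0' : 'M[k]_(p1, n)) J1' : J0 *m J0' + J1 *m J1' = 1%:M ->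
  (\rank A <= \rank (A *m J1) + \rank ((A :&: kermx J1)%MS *m J0))%N.
Proof.
move=> e; rewrite -(mxrank_mul_ker A J1) leq_add2l.
set B := (A :&: kermx J1)%MS.
have B1 : B *m J1 = 0 by apply/sub_kermxP; apply: capmxSr.
have {1}-> : B = B *m J0 *m J0'.
  by rewrite -[LHS]mulmx1 -e mulmxDr !mulmxA B1 mul0mx addr0.
exact: mxrankM_maxl.
Qed.

(** Such a functional restricts to M (x) x_1 as one of weight w + 1, and when this
    restriction vanishes, to M (x) x_0 as one of weight w - 1. *)
Lemma prim_dim_tens M w : is_uqmod q M ->
  (prim_dim (utens q M V) w <= prim_dim M (w - 1) + prim_dim M (w + 1))%N.
Proof.
move=> hM; have hT := utens_uqmod q0 hM.
have [AP AF] := (primP w (primmx (utens q M V) w) hT).1 (submx_refl _).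
rewrite /prim_dim; move: (primmx _ _) AP AF => A AP AF.
rewrite addnC; apply: leq_trans (rank_split A (tinj_sum q M)) _.
apply: leq_add; apply: mxrankS; apply/primP => //; split=> [|r r0].
- rewrite -mulmxA (_ : tinj q M ord_max *m _ = P (utens q M V) w *m tinj q M ord_max).
    by rewrite mulmxA AP.
  by rewrite tP; congr (_ *m P M _) => /=; lia.
- have := congr1 (mulmx^~ (tinj q M ord_max)) (AF r r0).
  rewrite /= mul0mx -mulmxA tF1 // -scalemxAr mulmxA => /eqP.
  by rewrite scaler_eq0 (negPf (expfz_neq0 _ q0)) => /eqP.
- set B := (A :&: _)%MS; have BA : B *m P (utens q M V) w = B.
    have /submxP[D ->] : (B <= A)%MS by apply: capmxSl.
    by rewrite -mulmxA AP.
  rewrite -mulmxA (_ : tinj q M ord0 *m _ = P (utens q M V) w *m tinj q M ord0).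
    by rewrite mulmxA BA.
  by rewrite tP; congr (_ *m P M _) => /=; lia.
- set B := (A :&: _)%MS; have BF : B *m F (utens q M V) r = 0.
    have /submxP[D ->] : (B <= A)%MS by apply: capmxSl.
    by rewrite -mulmxA AF // mulmx0.
  have B1 : B *m tinj q M ord_max = 0 by apply/sub_kermxP; apply: capmxSr.
  have := congr1 (mulmx^~ (tinj q M ord0)) BF.
  rewrite /= mul0mx -mulmxA tF0 // mulmxDr -scalemxAr !mulmxA B1 mul0mx addr0.
  by move/eqP; rewrite scaler_eq0 (negPf (expfz_neq0 _ q0)) => /eqP.
Qed.

Lemma primP_dual M w p (x : 'M[k]_(p, udim M)) : is_uqmod q M ->
  (x <= primmx (udual q M) w)%MS <->
  (x *m P M (- w) = x /\ forall r, (0 < r)%N -> x *m (F M r)^T = 0).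
Proof.
move=> hM; have hD := udual_uqmod q0 hM.
have key r : x *m P M (- w) = x ->
    exists2 c, c != 0 & x *m F (udual q M) r = c *: (x *m (F M r)^T).
  move=> xP; rewrite /= linearZ /= trmx_mul -scalemxAr mulmxA.
  have -> : x *m (uK q M r%:Z)^T = q ^ (r%:Z * - w) *: x.
    rewrite -{1}xP -mulmxA [(uK _ _ _)^T]tr_diag_mx.
    by rewrite [P M _ *m _](proj_wfun _ (fun z => q ^ (r%:Z * z))) -scalemxAr xP.
  rewrite -scalemxAl scalerA; eexists; last by [].
  rewrite !mulf_neq0 ?expfz_neq0 ?signr_eq0 // invr_neq0 // expf_neq0 //.
split=> [/(primP _ _ hD)|[xP xF]].
  have -> : P (udual q M) w = P M (- w) by exact: wproj_dual.
  move=> [xP xF]; split=> // r r0; have [c c0 e] := key r xP.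
  have := xF r r0; rewrite e => /eqP.
  by rewrite scaler_eq0 (negPf c0) => /eqP.
apply/(primP _ _ hD); split=> [|r r0].
  have -> : P (udual q M) w = P M (- w) by exact: wproj_dual.
  exact: xP.
by have [c c0 ->] := key r xP; rewrite xF // scaler0.
Qed.

Lemma tF_tr0 M r : (F (utens q M V) r)^T *m tinj q M ord0 =
  q ^ (- r%:Z) *: (tinj q M ord0 *m (F M r)^T).
Proof.
have e0 := tF0 q0 M r; have e1 := tF1 q0 M r; have o b c := tinj_orth q M b c.
move: (F (utens q M V) r) e0 e1 => FT e0 e1.
apply: trmx_inj; rewrite [RHS]linearZ /= !trmx_mul !trmxK.
apply: (@tinj_ext k q M); rewrite -mulmxA ?e0 ?e1 -scalemxAl -[F M r *m _ *m _]mulmxA !o.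
  by rewrite mulmxDr -scalemxAr !mulmxA !o mul1mx raddf0 mul0mx addr0 mulmx1.
by rewrite -scalemxAr mulmxA o raddf0 mul0mx mulmx0 !scaler0.
Qed.

Lemma tF_tr1 M r : (F (utens q M V) r)^T *m tinj q M ord_max =
  q ^ r%:Z *: (tinj q M ord_max *m (F M r)^T) + tinj q M ord0 *m (dn (F M) r 1)^T.
Proof.
have e0 := tF0 q0 M r; have e1 := tF1 q0 M r; have o b c := tinj_orth q M b c.
move: (F (utens q M V) r) e0 e1 => FT e0 e1.
apply: trmx_inj; rewrite [RHS]linearD linearZ /= !trmx_mul !trmxK.
apply: (@tinj_ext k q M); rewrite -mulmxA ?e0 ?e1 mulmxDl -scalemxAl -!(mulmxA (F M r))
  -(mulmxA (dn _ _ _)) !o.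
  rewrite mulmxDr -scalemxAr !mulmxA !o mul1mx raddf0 mul0mx mulmx0 !scaler0.
  by rewrite mulmx1.
by rewrite -scalemxAr mulmxA o raddf0 mulmx0 addr0 mul1mx mulmx1.
Qed.

(** The functionals on the dual are vectors of M (x) V, for which x_0 and x_1
    exchange their roles. *)
Lemma prim_dim_dual_tens M w : is_uqmod q M ->
  (prim_dim (udual q (utens q M V)) w <=
   prim_dim (udual q M) (w - 1) + prim_dim (udual q M) (w + 1))%N.
Proof.
move=> hM; have hT := utens_uqmod q0 hM.
have [AP AF] := (@primP_dual (utens q M V) w _
  (primmx (udual q (utens q M V)) w) hT).1 (submx_refl _).
rewrite /prim_dim; move: (primmx _ _) AP AF => A AP AF.
have sm : tinj q M ord_max *m (tinj q M ord_max)^T +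
  tinj q M ord0 *m (tinj q M ord0)^T = 1%:M by rewrite addrC tinj_sum.
rewrite addnC; apply: leq_trans (rank_split A sm) _.
apply: leq_add; apply: mxrankS; apply/primP_dual => //; split=> [|r r0].
- rewrite -mulmxA (_ : tinj q M ord0 *m _ = P (utens q M V) (- w) *m tinj q M ord0).
    by rewrite mulmxA AP.
  by rewrite tP; congr (_ *m P M _) => /=; lia.
- have := congr1 (mulmx^~ (tinj q M ord0)) (AF r r0).
  rewrite /= mul0mx -mulmxA tF_tr0 // -scalemxAr mulmxA => /eqP.
  by rewrite scaler_eq0 (negPf (expfz_neq0 _ q0)) => /eqP.
- set B := (A :&: _)%MS; have BA : B *m P (utens q M V) (- w) = B.
    have /submxP[D ->] : (B <= A)%MS by apply: capmxSl.
    by rewrite -mulmxA AP.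
  rewrite -mulmxA (_ : tinj q M ord_max *m _ = P (utens q M V) (- w) *m tinj q M ord_max).
    by rewrite mulmxA BA.
  by rewrite tP; congr (_ *m P M _) => /=; lia.
- set B := (A :&: _)%MS; have BF : B *m (F (utens q M V) r)^T = 0.
    have /submxP[D ->] : (B <= A)%MS by apply: capmxSl.
    by rewrite -mulmxA AF // mulmx0.
  have B1 : B *m tinj q M ord0 = 0 by apply/sub_kermxP; apply: capmxSr.
  have := congr1 (mulmx^~ (tinj q M ord_max)) BF.
  rewrite /= mul0mx -mulmxA tF_tr1 // mulmxDr -scalemxAr !mulmxA B1 mul0mx addr0.
  by move/eqP; rewrite scaler_eq0 (negPf (expfz_neq0 _ q0)) => /eqP.
Qed.

Definition wsum B M : nat := \sum_(m < B) m.+1 * prim_dim M m%:Z.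

(** The reverse inequality holds for every module once B exceeds its weights, so
    that this bound amounts to equality. *)
Definition weyl_bounded M := forall B, (wsum B M <= udim M)%N.

Lemma leq_wsum B B' M : (B <= B')%N -> (wsum B M <= wsum B' M)%N.
Proof.
move=> le; rewrite /wsum -!(big_mkord xpredT (fun m => (m.+1 * prim_dim M m%:Z)%N)).
by rewrite (@big_cat_nat _ _ _ B _ _ _ _ (leq0n B) le) leq_addr.
Qed.

(** Each c m is counted with the factors m and m + 2, of sum 2 (m + 1); the other
    terms come from the upper end of the range. *)
Lemma wsum_step (c c' : int -> nat) B : c (-1) = 0%N ->
  (forall w : int, (c' w <= c (w - 1)%R + c (w + 1)%R)%N) ->
  (\sum_(m < B) m.+1 * c' m%:Z + B.+1 * c (B%:Z - 1)%R <=
   2 * (\sum_(m < B) m.+1 * c m%:Z) + B * c B%:Z)%N.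
Proof.
move=> c0 H; elim: B => [|B IH]; first by rewrite !big_ord0 sub0r c0.
rewrite !big_ord_recr /=; have := H B%:Z.
have -> : (B.+1%:Z - 1)%R = B%:Z by lia.
have -> : (B%:Z + 1)%R = B.+1%:Z by lia.
move: IH; move: (\sum_(m < B) _)%N (\sum_(m < B) _)%N (c _) (c _) (c _) (c' _).
by move=> x y z t u v h1 h2; nia.
Qed.

Lemma weyl_bounded_step M M' : prim_dim M (-1) = 0%N -> udim M' = (2 * udim M)%N ->
  (forall w, (prim_dim M' w <= prim_dim M (w - 1) + prim_dim M (w + 1))%N) ->
  weyl_bounded M -> weyl_bounded M'.
Proof.
move=> c0 d H hM B; have := wsum_step B c0 H; have := hM B.+1.
rewrite d /wsum big_ord_recr /=.
move: (\sum_(m < B) _)%N (\sum_(m < B) _)%N (prim_dim _ _) (prim_dim _ _).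
by move=> x y z t; nia.
Qed.

Lemma weyl_bounded1 M : is_uqmod q M -> udim M = 1%N ->
  (forall i, uwt M i = 0) -> weyl_bounded M.
Proof.
move=> hM d1 w0 B; case: B => [|B]; first by rewrite /wsum big_ord0.
rewrite /wsum big_ord_recl big1 => [|i _]; last first.
  have := prim_dim_le_wdim (lift ord0 i)%:Z hM; rewrite wdim_eq0 => [|j].
    by rewrite leqn0 => /eqP ->; rewrite muln0.
  by rewrite w0.
rewrite addn0 mul1n; apply: leq_trans (prim_dim_le_wdim _ hM) _.
exact: rank_leq_row.
Qed.

Lemma Vpow_weyl_bounded n : weyl_bounded (Vpow q n) /\ weyl_bounded (udual q (Vpow q n)).
Proof.
elim: n => [|n [IH1 IH2]].
  by split; apply: weyl_bounded1 => //; rewrite ?[Vpow q 0]/(W 0);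
    [exact: weyl0_uqmod|move=> i; rewrite ord1|
     apply: udual_uqmod => //; exact: weyl0_uqmod|move=> i; rewrite ord1].
have hV := Vpow_uqmod q0 n; have hD := udual_uqmod q0 hV.
split.
  apply: (weyl_bounded_step _ _ _ IH1); first exact: prim_dim_neg.
    by rewrite /= mulnC.
  by move=> w; apply: prim_dim_tens.
apply: (weyl_bounded_step _ _ _ IH2); first exact: prim_dim_neg.
  by rewrite /= mulnC.
by move=> w; apply: prim_dim_dual_tens.
Qed.

End Filtrations.

(** * Weyl filtrations of the summands of tensor powers *)

Section WeylFiltrations.
Variables (k : fieldType) (q : k).
Hypothesis q0 : q != 0.
Implicit Types M N L X Y I : uqrep k.
Local Notation P := wproj.
Local Notation E := uE.
Local Notation F := uF.
Local Notation W := (weyl q).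

Lemma exact_dim M N L (h : 'M[k]_(udim N, udim M)) (g : 'M[k]_(udim L, udim N))
    (s : 'M[k]_(udim N, udim L)) : g *m s = 1%:M -> g *m h = 0 ->
  (forall v : 'cV[k]_(udim N), g *m v = 0 -> exists u, h *m u = v) ->
  udim N = (\rank h + udim L)%N.
Proof.
move=> gs gh ex; have rg : \rank g = udim L.
  apply/eqP; rewrite eqn_leq rank_leq_row.
  by rewrite -{1}(mxrank1 k (udim L)) -gs mxrankM_maxl.
have <- : \rank (kermx g^T) = \rank h.
  rewrite -(mxrank_tr h); apply/eqP; rewrite eqn_leq; apply/andP; split.
    apply: mxrankS; apply/row_subP => i; set x := row i _.
    have xg : x *m g^T = 0 by rewrite -row_mul mulmx_ker row0.
    have [|u e] := ex x^T; first by apply: trmx_inj; rewrite trmx_mul trmxK xg trmx0.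
    by apply/submxP; exists u^T; rewrite -trmx_mul e trmxK.
  by apply/mxrankS/sub_kermxP; rewrite -trmx_mul gh trmx0.
by rewrite mxrank_ker mxrank_tr rg subnK // -rg rank_leq_col.
Qed.

(** Let N be the quotient by the submodule generated by a vector v of maximal
    weight: functionals on N of the kind counted are those on M that vanish at v,
    and the coordinate of v is one that does not. *)
Lemma top_quotient M i0 (m : nat) : is_uqmod q M ->
  (forall j, uwt M j <= uwt M i0) -> uwt M i0 = m%:Z ->
  exists N (iota : 'M[k]_(udim M, udim (W m))) (g : 'M[k]_(udim N, udim M))
    (s : 'M[k]_(udim M, udim N)),
  [/\ is_uqhom iota, is_uqhom g, g *m s = 1%:M, g *m iota = 0 &
   [/\ forall v : 'cV[k]_(udim M), g *m v = 0 -> exists u, iota *m u = v,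
       udim M = (\rank iota + udim N)%N, (0 < \rank iota)%N,
       forall w, (prim_dim N w <= prim_dim M w)%N & (prim_dim N m < prim_dim M m)%N]].
Proof.
move=> hM mx em; pose v : 'cV[k]_(udim M) := delta_mx i0 0.
have hv : hwvec m%:Z v by rewrite -em; apply: (max_hwvec q0 hM).
pose iota := weyl_map m v : 'M[k]_(udim M, udim (W m)).
have hi : @is_uqhom k (W m) M iota by apply: weyl_map_hom hM hv.
have [N [g [s [hg gs gi ex]]]] := uqhom_cokernel hi.
have hN := uqmod_quot hM hg gs.
have iv : iota *m (delta_mx (ord0 : 'I_m.+1) 0 : 'cV_m.+1) = v.
  by rewrite weyl_map_delta (uF0 hM) mul1mx.
have gv : g *m v = 0 by rewrite -iv mulmxA gi mul0mx.
have gf : row_free g.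
  by rewrite -row_leq_rank -{1}(mxrank1 k (udim N)) -gs mxrankM_maxl.
have sub w : (primmx N w *m g <= primmx M w)%MS.
  have [xP xF] := (primP q0 w (primmx N w) hN).1 (submx_refl _).
  have /uqhomE hg' := hg.
  apply/(primP q0 _ _ hM); split=> [|r r0]; rewrite -mulmxA.
    by rewrite [g *m P M w](hg' (GenP w)) mulmxA xP.
  by rewrite [g *m F M r](hg' (GenF r)) mulmxA xF // mul0mx.
have rk w : \rank (primmx N w *m g) = prim_dim N w by rewrite mxrankMfree.
exists N, iota, g, s; split=> //; split=> //.
- exact: exact_dim gs gi ex.
- rewrite lt0n mxrank_eq0; apply/eqP => z; have := delta_neq0 k i0.
  by rewrite -/v -iv z mul0mx eqxx.
- by move=> w; rewrite -rk; apply: mxrankS.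
pose x := delta_mx 0 i0 : 'rV[k]_(udim M).
rewrite -rk; apply: rank_ltmx; rewrite ltmxE sub /=; apply/negP => le.
have xM : (x <= primmx M m%:Z)%MS.
  apply/(primP q0 _ _ hM); split=> [|r r0].
    apply/rowP => j; rewrite mul_wfun !mxE eqxx /=.
    by have [->|ne] := eqVneq j i0; rewrite ?em ?eqxx ?mulr1 ?mul0r.
  by rewrite -rowE (top_row_F q0 hM).
have /submxP[D e] := submx_trans xM le.
have : x *m v = 0 by rewrite e -!mulmxA gv !mulmx0.
move/matrixP/(_ 0 0); rewrite -rowE !mxE !eqxx => /eqP.
by rewrite oner_eq0.
Qed.

Lemma uwt_quot M N (g : 'M[k]_(udim N, udim M)) s i : is_uqhom g ->
  g *m s = 1%:M -> exists a, uwt M a = uwt N i.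
Proof.
move=> [gw _ _] gs; have [a nz] : exists a, g i a != 0.
  apply: contrapT => no; have : row i (g *m s) = 0.
    rewrite row_mul (_ : row i g = 0) ?mul0mx //.
    apply/rowP => a; rewrite !mxE; apply/eqP; apply: contrapT => /negP nz.
    by apply: no; exists a.
  by rewrite gs => /rowP/(_ i); rewrite !mxE eqxx => /eqP; rewrite oner_eq0.
by exists a; rewrite (gw _ _ nz).
Qed.

Lemma wsum_drop B M N (m : nat) : (forall w, (prim_dim N w <= prim_dim M w)%N) ->
  (prim_dim N m < prim_dim M m)%N -> (m < B)%N -> (m.+1 + wsum B N <= wsum B M)%N.
Proof.
move=> le lt mB; rewrite /wsum (bigD1 (Ordinal mB)) //= [X in (_ <= X)%N](bigD1 (Ordinal mB)) //=.
rewrite addnA -mulnS; apply: leq_add; first by rewrite leq_mul2l lt orbT.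
by apply: leq_sum => i _; rewrite leq_mul2l le orbT.
Qed.

(** Dividing by the submodule generated by a vector of maximal weight m removes at
    most m + 1 dimensions and at least one functional of weight m. *)
Lemma udim_le_wsum M B : is_uqmod q M -> (forall i, uwt M i < B%:Z) ->
  (udim M <= wsum B M)%N.
Proof.
have [n] := ubnP (udim M); elim: n M => // n IH M lt hM wM.
have [->//|d0] := posnP (udim M).
have [i0 mx] := max_uwt d0; have w0 := max_uwt_ge0 q0 hM mx.
pose m := `|uwt M i0|%N; have em : uwt M i0 = m%:Z by rewrite /m; lia.
have mB : (m < B)%N by rewrite -ltz_nat -em.
have [N [iota [g [s [_ hg gs gi [_ d r0 le lt']]]]]] := top_quotient hM mx em.
have rm : (\rank iota <= m.+1)%N by apply: rank_leq_col.
apply: leq_trans (wsum_drop le lt' mB); rewrite d leq_add //.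
apply: IH; first by rewrite d in lt; lia.
  exact: uqmod_quot hM hg gs.
by move=> i; have [a <-] := uwt_quot i hg gs.
Qed.

(** Equality in the count forces the submodule of N generated by a vector of
    maximal weight m to have dimension m + 1, hence to be W m.  As filtrations
    grow at the top, the induction is on extensions of N by filtered modules. *)
Lemma weyl_bounded_filtered_step n N : (udim N <= n)%N -> (0 < udim N)%N ->
  is_uqmod q N -> weyl_bounded N ->
  forall I M f g, @short_exact k I M N f g -> weyl_filtered q I -> weyl_filtered q M.
Proof.
elim: n N => [|n IH] N dn d0 hN bN I M f g sx fI; first by lia.
have [i0 mx] := max_uwt d0; have w0 := max_uwt_ge0 q0 hN mx.
pose m := `|uwt N i0|%N; have em : uwt N i0 = m%:Z by rewrite /m; lia.
have [N' [iota [h [s [hi hh hs hiota [ex d r0 le lt']]]]]] := top_quotient hN mx em.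
have hN' := uqmod_quot hN hh hs.
have rm : (\rank iota <= m.+1)%N by apply: rank_leq_col.
have wB i : uwt N i < m.+1%:Z by have := mx i; rewrite em; lia.
have dN' : (udim N' <= wsum m.+1 N')%N.
  apply: (udim_le_wsum hN') => i.
  by have [a <-] := uwt_quot i hh hs.
(* N would otherwise violate its bound. *)
have rk : \rank iota = m.+1.
  have := wsum_drop le lt' (ltnSn m); have := bN m.+1; lia.
have bN' : weyl_bounded N'.
  move=> B; apply: leq_trans (leq_wsum _ (leq_maxl B m.+1)) _.
  have mB : (m < maxn B m.+1)%N by rewrite leq_maxr.
  have := wsum_drop le lt' mB; have := bN (maxn B m.+1); lia.
have [li lK] : exists li : 'M[k]_(udim (W m), udim N), li *m iota = 1%:M.
  exists (pinvmx iota^T)^T; apply: trmx_inj; rewrite trmx_mul trmxK mulmxVp ?trmx1 //.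
  by rewrite -row_leq_rank mxrank_tr rk.
have Kl p (x : 'M[k]_(udim N, p)) : h *m x = 0 -> iota *m (li *m x) = x.
  move=> hx; apply: delta_ext => j; rewrite -!mulmxA.
  have [|u <-] := ex (x *m delta_mx j 0); first by rewrite mulmxA hx mul0mx.
  by rewrite (mulmxA li) lK mul1mx.
case: sx => hf hg finj gsurj exfg.
have gf0 : g *m f = 0.
  apply: delta_ext => j; rewrite mul0mx -mulmxA.
  by apply/exfg; exists (delta_mx j 0).
have [N0|N0] := posnP (udim N').
  have hx0 p (x : 'M[k]_(udim N, p)) : h *m x = 0.
    by apply/matrixP => a; have := ltn_ord a; rewrite {2}N0.
  apply: (@WeylFilteredS k q I M m f (li *m g)) => //.
  have ig : iota *m (li *m g) = g by apply: Kl.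
  split=> // [|w|v].
  - by apply: (uqhom_factor_inj hi lK); rewrite ig.
  - have [v e] := gsurj (iota *m w); exists v.
    by rewrite -mulmxA e mulmxA lK mul1mx.
  - rewrite -exfg; split=> [e|e]; last by rewrite -mulmxA e mulmx0.
    by rewrite -ig -mulmxA e mulmx0.
have hhg := is_uqhom_comp hh hg.
(* I' is the preimage in M of the submodule W m of N. *)
have [I' [i' [r' [hi' ri hgi comp]]]] := uqhom_kernel hhg.
have ff : i' *m (r' *m f) = f by apply: comp; rewrite -mulmxA gf0 mulmx0.
have gg : iota *m (li *m (g *m i')) = g *m i' by apply: Kl; rewrite mulmxA.
apply: (IH N' _ N0 hN' bN' I' M i' (h *m g)).
- lia.
- split=> // [x y e|w|v].
  + by rewrite -[x]mul1mx -[y]mul1mx -ri -!mulmxA /= e.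
  + have [v e] := gsurj (s *m w); exists v.
    by rewrite -mulmxA e mulmxA hs mul1mx.
  + split=> [e|[u <-]]; first by exists (r' *m v); apply: comp.
    by rewrite mulmxA hgi mul0mx.
apply: (@WeylFilteredS k q I I' m (r' *m f) (li *m (g *m i'))) => //; split.
- by apply: (uqhom_factor_inj hi' ri); rewrite ff.
- by apply: (uqhom_factor_inj hi lK); rewrite gg; apply: is_uqhom_comp.
- by move=> x y e; apply: finj; rewrite /= -ff -!mulmxA; congr (_ *m _); rewrite !mulmxA.
- move=> w; have [v e] := gsurj (iota *m w); exists (r' *m v).
  rewrite -!mulmxA comp ?e ?mulmxA ?lK ?mul1mx // -!mulmxA e mulmxA hiota.
  by rewrite mul0mx.
- move=> x; split=> [e|[u <-]].
    have : g *m (i' *m x) = 0 by rewrite mulmxA -gg -!mulmxA (mulmxA g) (mulmxA li) e mulmx0.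
    move/exfg => [u e']; exists u; rewrite -mulmxA e' mulmxA ri mul1mx //.
  by rewrite -!mulmxA (mulmxA r') (mulmxA i') ff (mulmxA g) gf0 mul0mx mulmx0.
Qed.

Lemma weyl_bounded_filtered M : is_uqmod q M -> weyl_bounded M -> weyl_filtered q M.
Proof.
move=> hM bM; have [d0|d0] := posnP (udim M); first exact: WeylFiltered0.
pose Z := UqRep (udim := 0) (fun _ => 0) (fun _ => (0 : 'M[k]_0)) (fun _ => 0).
apply: (weyl_bounded_filtered_step (leqnn _) d0 hM bM (I := Z) (f := 0) (g := 1%:M)).
  split=> [|||w|v].
  - exact: uqhom_0.
  - exact: uqhom_id.
  - by move=> x y _; apply/matrixP => [[]].
  - by exists w; rewrite mul1mx.
  - rewrite mul1mx; split=> [->|[u <-]]; last by rewrite mul0mx.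
    by exists 0; rewrite mulmx0.
exact: WeylFiltered0.
Qed.

(** The counts of X and of a complement add up to at most that of M, while neither
    is less than the dimension. *)
Lemma weyl_bounded_retract M X : is_uqmod q M -> weyl_bounded M -> retract X M ->
  weyl_bounded X.
Proof.
move=> hM bM rX B; have [Y [iX [pX [iY [pY b]]]]] := retract_dsum rX.
have rY : retract Y M.
  by apply: (proj2 (@dsum_retract _ M X Y _)); exists iX, pX, iY, pY.
have hX := uqmod_retract hM rX; have hY := uqmod_retract hM rY.
pose B' := maxn B (wbound Y).+1.
have yB i : uwt Y i < B'%:Z.
  have := uwt_wbound i; have : ((wbound Y).+1 <= B')%N by apply: leq_maxr.
  lia.
have := udim_le_wsum hY yB; have := bM B'; rewrite (biproduct_dim b).
have : (wsum B' X + wsum B' Y <= wsum B' M)%N.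
  rewrite /wsum -big_split; apply: leq_sum => i _ /=.
  by rewrite -mulnDr leq_mul2l (prim_dim_biproduct q0 _ hM hX hY b) orbT.
have := leq_wsum X (leq_maxl B (wbound Y).+1); rewrite -/B'; lia.
Qed.

Lemma uqhom_dual M N (f : 'M[k]_(udim N, udim M)) :
  is_uqhom f -> @is_uqhom k (udual q N) (udual q M) f^T.
Proof.
move=> hf; have [fw fE fF] := hf.
have fK c : f *m uK q M c = uK q N c *m f.
  exact: (hom_wfun (fun w => q ^ (c * w)) hf).
split=> [i j|r|r].
- by rewrite mxE => /fw /= ->.
- rewrite /= -!trmx_mul; congr (_^T).
  by rewrite -scalemxAl -scalemxAr -mulmxA -fE !mulmxA fK.
- rewrite /= -!trmx_mul; congr (_^T).
  by rewrite -scalemxAl -scalemxAr mulmxA fF -!mulmxA fK.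
Qed.

Lemma Vpow_retract_tilting n X : retract X (Vpow q n) -> tilting q X.
Proof.
move=> rX; have hV := Vpow_uqmod q0 n; have hX := uqmod_retract hV rX.
have [b1 b2] := Vpow_weyl_bounded q0 n; split=> //.
  by apply: weyl_bounded_filtered => //; apply: weyl_bounded_retract b1 rX.
apply: weyl_bounded_filtered; first exact: udual_uqmod.
apply: (weyl_bounded_retract (udual_uqmod q0 hV) b2).
have [i [p [hi hp pi]]] := rX; exists p^T, i^T; split; try exact: uqhom_dual.
by rewrite -trmx_mul pi trmx1.
Qed.

End WeylFiltrations.

(** * The fusion summand of a tensor power *)

Section FusionProjection.
Variables (k : fieldType) (q : k) (l : nat).
Hypothesis q0 : q != 0.
Hypothesis hl : quantum_char q l.
Implicit Types M N X Y : uqrep k.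
Local Notation P := wproj.
Local Notation W := (weyl q).
Local Notation V := (weyl q 1).

(** A splitting that has the properties of the fusion summand that are preserved
    by tensoring with V and removing Steinberg summands. *)
Definition fusion_split n X (i : 'M[k]_(udim (Vpow q n), udim X)) p : Prop :=
  [/\ [/\ is_uqhom i, is_uqhom p & p *m i = 1%:M],
      forall j, uwt X j <= (l - 2)%N%:Z, forall w, wdim X w = wdim X (- w) &
      qtrace_null q (1%:M - i *m p)].

Lemma tmapB M N (f g : 'M[k]_(udim N, udim M)) : tmap q (f - g) = tmap q f - tmap q g.
Proof. by apply: (@tinj_ext k q M); rewrite mulmxBl !tmap_tinj mulmxBr. Qed.

Lemma fusion_split0 : @fusion_split 0 (W 0) 1%:M 1%:M.
Proof.
split; first by split; rewrite ?mulmx1 //; apply: uqhom_id.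
- by move=> j; rewrite ord1.
- move=> w; have e : wdim (W 0) w = (w == 0) :> nat.
    rewrite (wdim_weyl q0); congr nat_of_bool; apply/existsP/eqP => [[i /eqP <-]|->].
      by rewrite ord1.
    by exists ord0.
  have e' : wdim (W 0) (- w) = (- w == 0) :> nat.
    rewrite (wdim_weyl q0); congr nat_of_bool; apply/existsP/eqP => [[i /eqP <-]|->].
      by rewrite ord1.
    by exists ord0.
  by rewrite e e' oppr_eq0.
- by rewrite mulmx1 subrr; apply: qtrace_null0.
Qed.

(** The weights of X (x) V are those of X shifted by 1 and by -1, hence at most
    l - 1; it remains to split off Steinberg modules. *)
Lemma fusion_splitS n X i p : @fusion_split n X i p -> exists X' i' p',
  @fusion_split n.+1 X' i' p' /\
  forall m : nat, (m <= l - 2)%N ->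
    ((wdim X' m%:Z)%:Z - (wdim X' (m%:Z + 2))%:Z =
     ((wdim X (m%:Z - 1))%:Z - (wdim X (m%:Z + 1))%:Z) +
     ((wdim X (m%:Z + 1))%:Z - (wdim X (m%:Z + 3))%:Z))%R.
Proof.
move=> [[hi hp pi] wX sX tX]; have l1 := l_gt1 hl.
have hX : is_uqmod q X.
  by apply: (uqmod_retract (Vpow_uqmod q0 n)); exists i, p.
have hM := utens_uqmod q0 hX.
have wM j : uwt (utens q X V) j <= (l - 1)%N%:Z.
  case: (mxtens_indexP j) => a c; rewrite uwt_tens; have := wX a; lia.
have sM w : wdim (utens q X V) w = wdim (utens q X V) (- w).
  rewrite !wdim_tens addnC sX [in X in (_ + X)%N]sX.
  by congr (wdim X _ + wdim X _)%N; lia.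
have [X' [i' [p' [[hi' hp' pi'] wX' sX' tX' cX']]]] := steinberg_split q0 hl hM wM sM.
exists X', (tmap q i *m i'), (p' *m tmap q p); split.
  split=> //.
  - split; try by apply: is_uqhom_comp => //; apply: tmap_hom.
    by rewrite mulmxA -(mulmxA p') -tmap_comp pi tmap1 mulmx1.
  have -> : 1%:M - tmap q i *m i' *m (p' *m tmap q p) =
      1%:M *m tmap q (1%:M - i *m p) *m 1%:M + tmap q i *m (1%:M - i' *m p') *m tmap q p.
    rewrite mulmx1 mul1mx tmapB tmap1 tmap_comp mulmxBr mulmxBl mulmx1 !mulmxA.
    by rewrite addrA subrK.
  apply: qtrace_nullD; apply: qtrace_null_comp; rewrite ?uqhom_id //; try exact: uqhom_id.
  - apply: qtrace_null_tens => //; exact: Vpow_uqmod.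
  - exact: tmap_hom.
  - exact: tmap_hom.
move=> m ml; have := cX' m ml; rewrite !wdim_tens.
have -> : m%:Z + 2 - 1 = m%:Z + 1 by lia.
have -> : m%:Z + 2 + 1 = m%:Z + 3 by lia.
by lia.
Qed.

Lemma fusion_split_exists n : exists X i p, @fusion_split n X i p.
Proof.
elim: n => [|n [X [i [p g]]]]; first by exists (W 0), 1%:M, 1%:M; apply: fusion_split0.
by have [X' [i' [p' [g' _]]]] := fusion_splitS g; exists X', i', p'.
Qed.

Lemma retract_indec_tilting n X : retract X (Vpow q n) -> indecomposable X ->
  exists2 m, is_indec_tilting q m X &
  exists2 i0, (forall j, uwt X j <= uwt X i0) & uwt X i0 = m%:Z.
Proof.
move=> rX iX; have tX := Vpow_retract_tilting q0 rX.
have hX := uqmod_retract (Vpow_uqmod q0 n) rX.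
have d0 : (0 < udim X)%N by rewrite lt0n; apply/eqP; case: iX.
have [i0 mx] := max_uwt d0; have w0 := max_uwt_ge0 q0 hX mx.
have em : uwt X i0 = (`|uwt X i0|%N)%:Z by lia.
exists `|uwt X i0|%N; last by exists i0.
by split=> //; split=> [|j]; [exists i0|rewrite -em].
Qed.

(** A summand of the complement of X with highest weight m <= l - 2 would have a
    summand W m, of nonzero quantum dimension [m + 1]. *)
Lemma fusion_split_pr n X i p : @fusion_split n X i p ->
  exists J : fusion_pr q l (Vpow q n), pr_obj J = X.
Proof.
move=> [[hi hp pi] wX sX tX]; have l1 := l_gt1 hl.
have [Y [iY [pY b]]] := retract_biproduct hi hp pi.
have [[_ _ hiY hpY] [_ pY1 e]] := b.
have rX : retract X (Vpow q n) by exists i, p.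
have rY : retract Y (Vpow q n) by exists iY, pY.
have fX : fusion_object q l X.
  split; first exact: Vpow_retract_tilting rX.
  move=> A B /dsum_retract[rA _] iA.
  have [m tm [i0 _ em]] := retract_indec_tilting (retract_trans rA rX) iA.
  exists m => //; have [a ea] := uwt_retract i0 rA.
  by have := wX a; rewrite ea em.
have fY : negligible q l Y.
  split; first exact: Vpow_retract_tilting rY.
  move=> A B /dsum_retract[rA _] iA.
  have [m tm [i0 mx em]] := retract_indec_tilting (retract_trans rA rY) iA.
  exists m => //; rewrite leqNgt; apply/negP => lt.
  have hA : is_uqmod q A by case: tm => -[].
  have ml : (m < l)%N by lia.
  have rW := retract_trans (top_weyl_retract q0 hl hA ml mx em) rA.
  have [io [pr [hio hpr prio]]] := rW.
  have hf : is_uqhom (iY *m io *m (pr *m pY)).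
    by do ![apply: is_uqhom_comp => //].
  (* The quantum trace of the idempotent onto W m is [m + 1]. *)
  have := tX _ hf; have -> : 1%:M - i *m p = iY *m pY.
    by rewrite -e addrC addKr.
  have -> : iY *m io *m (pr *m pY) *m (iY *m pY) = iY *m io *m (pr *m pY).
    by rewrite -!mulmxA (mulmxA pY iY) pY1 mul1mx.
  have ha : is_uqhom (iY *m io) by apply: is_uqhom_comp.
  have ba : pr *m pY *m (iY *m io) = 1%:M.
    by rewrite -mulmxA (mulmxA pY) pY1 mul1mx prio.
  move: (iY *m io) (pr *m pY) ha ba => a c ha ca.
  rewrite mulmxA -[Kinv q _ *m a](hom_wfun (fun w => q ^ (- w)) ha).
  rewrite mxtrace_mulC mulmxA ca mul1mx.
  rewrite [X in X = 0](qtrace_weyl q0 m) => /eqP; apply/negP.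
  by case: hl => _ _; apply; lia.
by exists (FusionPr b fX fY).
Qed.

(** Every basis vector has a nonzero component in some indecomposable summand. *)
Lemma fusion_object_uwt X : is_uqmod q X -> fusion_object q l X ->
  forall j, uwt X j <= (l - 2)%N%:Z.
Proof.
move=> hX [_ fX].
suff gen n A : (udim A <= n)%N -> retract A X -> forall j, uwt A j <= (l - 2)%N%:Z.
  apply: (gen (udim X)) => //; exists 1%:M, 1%:M.
  by split; rewrite ?mulmx1 //; apply: uqhom_id.
elim: n A => [|n IH] A dA rA j.
  by have := ltn_ord j; rewrite ltnNge (leq_trans dA).
have [iA|no] := pselect (indecomposable A).
  have [B bB] := retract_dsum rA.
  have [m ml [_ _ [_ hw]]] := fX _ _ bB iA.
  by apply: le_trans (hw j) _; rewrite lez_nat.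
have [B [C [bBC dB dC]]] : exists B C, [/\ is_dsum A B C, udim B <> 0%N & udim C <> 0%N].
  apply: contrapT => no'; apply: no; split.
    by move=> z; have := ltn_ord j; rewrite {2}z.
  move=> B C bBC; apply: contrapT => /not_orP[dB dC]; apply: no'.
  by exists B, C.
have [rB rC] := dsum_retract bBC.
have [iB [pB [iC [pC b]]]] := bBC.
have dd := biproduct_dim b.
case: b => [[_ [pBw _ _] _ [pCw _ _]] [_ _ e]].
have [[a nz]|nB] := pselect (exists a, pB a j != 0).
  by rewrite -(pBw _ _ nz); apply: IH; [lia|exact: retract_trans rB rA].
have [[a nz]|nC] := pselect (exists a, pC a j != 0).
  by rewrite -(pCw _ _ nz); apply: IH; [lia|exact: retract_trans rC rA].
have zB : col j pB = 0.
  apply/colP => a; rewrite !mxE; apply/eqP; apply: contrapT => /negP nz.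
  by apply: nB; exists a.
have zC : col j pC = 0.
  apply/colP => a; rewrite !mxE; apply/eqP; apply: contrapT => /negP nz.
  by apply: nC; exists a.
have : col j (1%:M : 'M[k]_(udim A)) = 0.
  by rewrite -e colE mulmxDl -!mulmxA -!colE zB zC !mulmx0 addr0.
by rewrite colE mul1mx => /eqP; rewrite (negPf (delta_neq0 k j)).
Qed.

(** As the dual of W m is isomorphic to W m, a nonzero composite would make W m a
    summand of N. *)
Lemma negligible_weyl N (m : nat) (f : 'M[k]_(udim N, udim (W m))) (h : 'M[k]_(udim (nabla q m), udim N)) :
  negligible q l N -> (m <= l - 2)%N -> is_uqhom f -> is_uqhom h -> h *m f = 0.
Proof.
move=> [_ nN] ml hf hh; have l1 := l_gt1 hl.
have ml' : (m < l)%N by lia.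
have [t [t' [ht ht' tt' t't]]] := weyl_nabla q0 hl ml'.
have hth := is_uqhom_comp ht hh.
have e := weyl_end_scalar q0 (is_uqhom_comp hth hf).
have [c0|c0] := eqVneq ((t *m h *m f) ord0 ord0) 0.
  by rewrite -[h *m f]mul1mx -t't -mulmxA (mulmxA t h) e c0 raddf0 mulmx0.
have rW : retract (W m) N.
  exists f, (((t *m h *m f) ord0 ord0)^-1 *: (t *m h)); split=> //; first exact: uqhomZ.
  by rewrite -scalemxAl {2}e scale_scalar_mx mulVf.
have [Y bY] := retract_dsum rW.
have [m' lm [_ _ [[i ei] _]]] := nN _ _ bY (weyl_indecomposable q0 m).
by move: ei lm => /=; lia.
Qed.

End FusionProjection.

(** * Simple modules of the Jones algebra *)

Section Schur.
Variables (R : pzRingType) (V U : lmodType R).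

Section KerIm.
Variable f : {linear V -> U}.

Definition lin_ker_pred : {pred V} := fun x => f x == 0.
Definition lin_im_pred : {pred U} := fun y => `[< exists x, f x = y >].

Fact lin_ker_closed : submod_closed lin_ker_pred.
Proof.
split=> [|a x y]; rewrite !unfold_in ?linear0 ?eqxx //.
by rewrite linearP => /eqP-> /eqP->; rewrite scaler0 addr0.
Qed.

Fact lin_im_closed : submod_closed lin_im_pred.
Proof.
split=> [|a x y]; first by apply/asboolP; exists 0; rewrite linear0.
move=> /asboolP[x' <-] /asboolP[y' <-]; apply/asboolP.
by exists (a *: x' + y'); rewrite linearP.
Qed.

HB.instance Definition _ := GRing.isSubmodClosed.Build R V lin_ker_pred lin_ker_closed.
HB.instance Definition _ := GRing.isSubmodClosed.Build R U lin_im_pred lin_im_closed.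

Lemma schur : simple_module V -> simple_module U -> (exists x, f x != 0) ->
  lmod_iso U V.
Proof.
move=> [_ sV] [_ sU] [x fx].
have inj : injective f.
  case: (sV lin_ker_pred) => [k0|kT].
    move=> y z e; apply/eqP; rewrite -subr_eq0; apply/eqP/k0.
    by rewrite unfold_in linearB e subrr.
  by have := kT x; rewrite unfold_in (negPf fx).
have sur y : exists x, f x = y.
  case: (sU lin_im_pred) => [i0|iT]; last exact/asboolP/(iT y).
  have z : f x = 0 by apply: i0; apply/asboolP; exists x.
  by rewrite z eqxx in fx.
have [g fg] := choice sur.
have gf : cancel f g by move=> z; apply: inj; rewrite fg.
pose g' : {linear U -> V} := HB.pack g (GRing.isLinear.Build R U V *:%R g (can2_linear gf fg)).
by exists g'; exists f.
Qed.

End KerIm.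
End Schur.

Section Dimension.
Variable k : fieldType.

Lemma rV_linear_dim d d' (f : 'rV[k]_d -> 'rV[k]_d') :
  (forall c x y, f (c *: x + y) = c *: f x + f y) -> injective f -> (d <= d')%N.
Proof.
move=> fl fi; pose A : 'M[k]_(d, d') := \matrix_i f (delta_mx 0 i).
have f0 : f 0 = 0.
  have := fl 1 0 0; rewrite !scale1r addr0 => e.
  by apply: (@addrI _ (f 0)); rewrite addr0 -e.
have fD x y : f (x + y) = f x + f y by rewrite -[x]scale1r fl !scale1r.
have fZ c x : f (c *: x) = c *: f x by rewrite -[c *: x]addr0 fl f0 addr0.
have fA x : f x = x *m A.
  rewrite mulmx_sum_row {1}[x]row_sum_delta.
  rewrite (big_morph f fD f0); apply: eq_bigr => i _.
  by rewrite fZ rowK.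
suff : row_free A by rewrite -row_leq_rank => h; apply: leq_trans h (rank_leq_col _).
rewrite -kermx_eq0; apply/eqP/row_matrixP => i; rewrite row0; apply: fi.
by rewrite f0 fA -row_mul mulmx_ker row0.
Qed.

Lemma has_kdim_unique (M : uqrep k) (W : lmodType (uqend M)) d d' :
  has_kdim W d -> has_kdim W d' -> d = d'.
Proof.
suff le e e' : has_kdim W e -> has_kdim W e' -> (e <= e')%N.
  by move=> h h'; apply/eqP; rewrite eqn_leq !le.
move=> [f [bf fl]] [f' [[g fg gf] fl']].
apply: (@rV_linear_dim e e' (fun x => g (f x))) => [c x y|].
  by apply: (can_inj fg); rewrite gf fl fl' !gf.
exact: inj_comp (can_inj gf) (bij_inj bf).
Qed.

Lemma kdimE (M : uqrep k) (W : lmodType (uqend M)) d : has_kdim W d -> kdim W = d.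
Proof.
move=> h; rewrite /kdim; case: xgetP => [e _ he|no]; last by case: (no d).
exact: has_kdim_unique he h.
Qed.

End Dimension.

Section JonesModules.
Variables (k : fieldType) (q : k) (l : nat).
Hypothesis q0 : q != 0.
Hypothesis hl : quantum_char q l.
Variables (n : nat) (J : fusion_pr q l (Vpow q n)).
Local Notation W := (weyl q).
Local Notation X := (pr_obj J).

(** Composition with the inclusion of pr(V^n) in V^n identifies this Hom-space with
    D_n(m) when m <= l - 2. *)
Definition DQ (m : nat) : lmodType (jones J) := uqhom (W m) X.

Lemma J_biproduct : biproduct (pr_in J) (pr_out J) (neg_in J) (neg_out J).
Proof. exact: pr_biproduct. Qed.

Lemma pr_in_hom : is_uqhom (pr_in J). Proof. by have [[]] := J_biproduct. Qed.
Lemma pr_out_hom : is_uqhom (pr_out J). Proof. by have [[]] := J_biproduct. Qed.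

Lemma pr_out_in : pr_out J *m pr_in J = 1%:M.
Proof. by have [_ []] := J_biproduct. Qed.

Lemma pr_retract : retract X (Vpow q n).
Proof. by exists (pr_in J), (pr_out J); have [[? ? _ _] [? _ _]] := J_biproduct. Qed.

Lemma pr_uqmod : is_uqmod q X.
Proof. by have [[]] := pr_objP J. Qed.

Lemma pr_uwt j : uwt X j <= (l - 2)%N%:Z.
Proof. exact: fusion_object_uwt pr_uqmod (pr_objP J) j. Qed.

Lemma pr_split m (f : 'M[k]_(udim X, udim (W m))) : (m <= l - 2)%N -> is_uqhom f ->
  f != 0 -> exists2 g : 'M[k]_(udim (W m), udim X), is_uqhom g & g *m f = 1%:M.
Proof.
move=> ml hf nz; have l1 := l_gt1 hl.
by apply: (@weyl_split k q l q0 hl X (l - 2) m f pr_uqmod _ pr_uwt _ hf nz); lia.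
Qed.

(** The radical of the cell form is the part that maps into the negligible
    summand. *)
Lemma cell_radP m (f : cell q n m) : (m <= l - 2)%N ->
  (f \in cell_rad q n m) <-> pr_out J *m uqhom_mx f = 0.
Proof.
move=> ml; have l1 := l_gt1 hl; have hf : is_uqhom (uqhom_mx f).
  by apply/uqhomP/(valP f).
have [[hi ho hni hno] [e1 e2 e3]] := J_biproduct.
split.
  move/asboolP => rf; apply: contrapT => /eqP nz.
  have [g hg gf] := pr_split ml (is_uqhom_comp ho hf) nz.
  have ml' : (m < l)%N by lia.
  have [t [t' [ht ht' tt' t't]]] := weyl_nabla q0 hl ml'.
  have := rf _ (is_uqhom_comp ht' (is_uqhom_comp hg ho)).
  rewrite -!mulmxA gf mulmx1 => z; have := tt'; rewrite z mulmx0 => /esym h.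
  by have := mxrank1 k (udim (W m)); rewrite h mxrank0.
move=> z; apply/asboolP => h hh.
rewrite -[uqhom_mx f]mul1mx -e3 mulmxDl -!mulmxA z mulmx0 add0r mulmxA.
apply: (negligible_weyl q0 hl (pr_negP J)) => //; exact: is_uqhom_comp.
Qed.

Fact jres_subproof m (x : DQ m) :
  pr_in J *m uqhom_mx x \in @uqhom_pred k (W m) (Vpow q n).
Proof. by apply/uqhomP/is_uqhom_comp; [exact: pr_in_hom|apply/uqhomP/(valP x)]. Qed.

Definition jlift m (x : DQ m) : cell q n m := UqHom (jres_subproof x).

Definition jres m (x : DQ m) : Dmod q n m := \pi_(Dmod q n m)%qT (jlift x).

Fact jcores_subproof m (u : cell q n m) :
  pr_out J *m uqhom_mx u \in @uqhom_pred k (W m) X.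
Proof. by apply/uqhomP/is_uqhom_comp; [exact: pr_out_hom|apply/uqhomP/(valP u)]. Qed.

Definition jcores m (u : cell q n m) : DQ m := UqHom (jcores_subproof u).

Lemma Dmod_eq m (u v : cell q n m) :
  (\pi_(Dmod q n m)%qT u == \pi_(Dmod q n m)%qT v) = (u - v \in cell_rad q n m).
Proof. exact/esym/(Quotient.idealrBE (lquot_pred (cell_rad q n m))). Qed.

Lemma jres_can m : (m <= l - 2)%N ->
  cancel (@jres m) (fun y => jcores (repr y)) /\
  cancel (fun y => jcores (repr y)) (@jres m).
Proof.
move=> ml; split=> [x|y].
  apply: val_inj; rewrite /=.
  have : \pi_(Dmod q n m)%qT (repr (jres x)) == \pi_(Dmod q n m)%qT (jlift x).
    by rewrite reprK.
  rewrite Dmod_eq => /(cell_radP _ ml); rewrite [uqhom_mx _]/= mulmxBr => /eqP.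
  by rewrite subr_eq0 => /eqP ->; rewrite mulmxA pr_out_in mul1mx.
rewrite -[RHS]reprK; apply/eqP; rewrite Dmod_eq; apply/(cell_radP _ ml).
by rewrite [uqhom_mx _]/= mulmxBr !mulmxA pr_out_in mul1mx subrr.
Qed.

Lemma jresB m : zmod_morphism (@jres m).
Proof.
move=> x y; have e : jlift (x - y) = jlift x - jlift y.
  by apply: val_inj; rewrite /= mulmxBr.
have h (u v : cell q n m) : \pi_(Dmod q n m)%qT (u - v) =
    \pi_(Dmod q n m)%qT u - \pi_(Dmod q n m)%qT v.
  apply/eqP; rewrite eq_sym subr_eq -[X in _ == X](pi_lquotD (cell_rad q n m)).
  by rewrite subrK.
by rewrite /jres e; exact: h.
Qed.

HB.instance Definition _ m := GRing.isZmodMorphism.Build (DQ m) (Dmod q n m)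
  (@jres m) (@jresB m).

Lemma jres_scale m (a : TL q n) (x : DQ m) : (m <= l - 2)%N ->
  jres (TL_to_jones J a *: x) = a *: jres x.
Proof.
move=> ml; rewrite [RHS]pi_lquot_scale; apply/eqP; rewrite Dmod_eq.
apply/(cell_radP _ ml).
by rewrite [uqhom_mx _]/= mulmxBr !mulmxA pr_out_in mul1mx subrr.
Qed.

Lemma jres_restriction m : (m <= l - 2)%N ->
  is_restriction (TL_to_jones J) (DQ m) (Dmod q n m).
Proof.
move=> ml; have [c1 c2] := jres_can ml.
exists (@jres m : {additive DQ m -> Dmod q n m}); split; first by exists (fun y => jcores (repr y)).
by move=> a x; exact: jres_scale.
Qed.

Lemma DQ_nonzero m : (m <= l - 2)%N -> nonzero_module (Dmod q n m) <-> nonzero_module (DQ m).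
Proof.
move=> ml; have [c1 c2] := jres_can ml.
have r0 : @jres m 0 = 0 by exact: raddf0.
split=> [[y y0]|[x x0]].
  exists (jcores (repr y)); apply: contraNneq y0 => e.
  by rewrite -[y]c2 e r0.
exists (jres x); apply: contraNneq x0 => e.
by apply/eqP; rewrite -[x]c1 -[RHS]c1 e r0.
Qed.

Lemma DQ_hom m (x : DQ m) : is_uqhom (uqhom_mx x).
Proof. exact/uqhomP/(valP x). Qed.

Lemma DQ_split m (x : DQ m) : (m <= l - 2)%N -> x != 0 ->
  exists2 g : 'M[k]_(udim (W m), udim X), is_uqhom g & g *m uqhom_mx x = 1%:M.
Proof.
move=> ml x0; apply: pr_split ml (DQ_hom x) _.
by apply: contraNneq x0 => e; apply/eqP/val_inj.
Qed.

Lemma DQ_end m (x : DQ m) (g : 'M[k]_(udim (W m), udim X)) : is_uqhom g ->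
  exists a : jones J, uqend_mx a = uqhom_mx x *m g.
Proof.
move=> hg; have h : uqhom_mx x *m g \in @uqhom_pred k X X.
  by apply/uqhomP/is_uqhom_comp => //; exact: DQ_hom.
by exists (UqEnd h).
Qed.

(** A nonzero map from W m has a left inverse, so that the endomorphisms of pr(V^n)
    carry it to any other map. *)
Lemma DQ_simple m : (m <= l - 2)%N -> nonzero_module (DQ m) -> simple_module (DQ m).
Proof.
move=> ml nz; split=> // S.
have [[x Sx x0]|no] := pselect (exists2 x, x \in S & x != 0); last first.
  by left=> x Sx; apply/eqP; apply: contrapT => /negP x0; apply: no; exists x.
right=> y; have [g hg gx] := DQ_split ml x0.
have [a ea] := DQ_end y hg.
suff -> : y = a *: x by apply: rpredZ.
by apply: val_inj; rewrite /= ea -mulmxA gx mulmx1.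
Qed.

(** The idempotent x g, with g a left inverse of x, fixes x but kills all maps from
    W m2, since there are no maps from W m2 to W m1. *)
Lemma DQ_iso_eq m1 m2 : (m1 <= l - 2)%N -> (m2 <= l - 2)%N ->
  nonzero_module (DQ m1) -> lmod_iso (DQ m1) (DQ m2) -> m1 = m2.
Proof.
move=> l1 l2 [x x0] [f /bij_inj fi]; apply/eqP; apply: contrapT => /negP ne.
have [g hg gx] := DQ_split l1 x0.
have [a ea] := DQ_end x hg.
have ax : a *: x = x by apply: val_inj; rewrite /= ea -mulmxA gx mulmx1.
have l0 := l_gt1 hl.
have gf : g *m uqhom_mx (f x) = 0.
  apply: (weyl_hom_neq q0 hl (m := m1) (m' := m2)) => //; first by lia.
  by apply: is_uqhom_comp => //; exact: DQ_hom.
have afx : a *: f x = 0 by apply: val_inj; rewrite /= ea -mulmxA gf mulmx0.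
by case/eqP: x0; apply: fi; rewrite -[x]ax linearZ linear0; exact: afx.
Qed.

(** The identity of pr(V^n) is a sum of maps that factor through some W m with
    m <= l - 2; one of them acts nontrivially on a given simple module, which
    makes that module a quotient of the corresponding Hom-space. *)
Lemma DQ_complete (S : lmodType (jones J)) : simple_module S ->
  exists m, [/\ m \in Lambda_l l n, nonzero_module (Dmod q n m)
              & lmod_iso S (DQ m)].
Proof.
move=> sS; have [w w0] := sS.1; have l0 := l_gt1 hl.
pose Q (e : 'M[k]_(udim X)) := is_uqhom e /\
  forall a : jones J, uqend_mx a = e -> a *: w = 0.
have [m [i [p [ml hi hp np]]]] : exists m (i : 'M[k]_(udim X, udim (W m)))
    (p : 'M[k]_(udim (W m), udim X)),
    [/\ (m <= l - 2)%N, is_uqhom i, is_uqhom p & ~ Q (i *m p)].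
  apply: contrapT => no.
  have : Q 1%:M.
    apply: (weyl_ideal (q := q) (l := l) (b := l - 2) q0 hl pr_uqmod _ pr_uwt).
    - by lia.
    - split; first exact: uqhom_0.
      move=> a e; have -> : a = 0 by apply: val_inj.
      by rewrite scale0r.
    - move=> x y [hx Qx] [hy Qy]; split; first exact: uqhomD.
      move=> a e.
      have /uqhomP hx' := hx; have /uqhomP hy' := hy.
      have -> : a = (UqEnd hx' : jones J) + UqEnd hy' by apply: val_inj.
      by rewrite scalerDl Qx // Qy // addr0.
    - move=> m i p ml hi hp; apply: contrapT => nQ.
      by apply: no; exists m, i, p.
  move=> [_ /(_ 1 erefl)]; rewrite scale1r => e; by rewrite e eqxx in w0.
have hip : is_uqhom (i *m p) by exact: is_uqhom_comp.
have [a ea aw] : exists2 a : jones J, uqend_mx a = i *m p & a *: w != 0.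
  apply: contrapT => no; apply: np; split=> // a ea; apply/eqP.
  by apply: contrapT => /negP aw; apply: no; exists a.
have hip' (x : DQ m) : uqhom_mx x *m p \in @uqhom_pred k X X.
  by apply/uqhomP/is_uqhom_comp => //; exact: DQ_hom.
pose phi (x : DQ m) : S := (UqEnd (hip' x) : jones J) *: w.
have phiL : linear phi.
  move=> c x y; rewrite /phi scalerA -scalerDl; congr (_ *: w).
  by apply: val_inj; rewrite /= mulmxDl -mulmxA.
pose phi' : {linear DQ m -> S} := HB.pack phi (GRing.isLinear.Build _ _ _ *:%R phi phiL).
have /uqhomP hi' := hi.
pose xi : DQ m := UqHom hi'.
have nphi : phi' xi != 0.
  rewrite (_ : phi' xi = a *: w) //; congr (_ *: w); exact: val_inj.
have nDQ : nonzero_module (DQ m).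
  by exists xi; apply: contraNneq nphi => ->; rewrite linear0.
have nD : nonzero_module (Dmod q n m) by apply/(DQ_nonzero ml).
have iso : lmod_iso S (DQ m).
  by apply: (@schur _ _ _ phi'); [exact: DQ_simple|exact: sS|exists xi].
exists m; split=> //; rewrite !inE ml andbT.
have xi0 : xi != 0 by apply: contraNneq nphi => ->; rewrite linear0.
have [g hg gx] := DQ_split ml xi0.
have rW : retract (W m) (Vpow q n).
  by apply: retract_trans pr_retract; exists (uqhom_mx xi), g.
have [j ej] := uwt_retract (ord0 : 'I_(udim (W m))) rW.
have [b bn eb] := Vpow_uwt q0 j.
have e : m%:Z = n%:Z - (2 * b)%N%:Z by rewrite -eb ej /= muln0 subr0.
by clear -e bn; lia.
Qed.

End JonesModules.

(** * Dimensions *)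

Section HomDimension.
Variables (k : fieldType) (q : k) (l : nat).
Hypothesis q0 : q != 0.
Hypothesis hl : quantum_char q l.
Local Notation W := (weyl q).

Lemma wdim_weyl_drop (a m : nat) :
  wdim (W a) m%:Z = ((a == m) + wdim (W a) (m%:Z + 2))%N.
Proof.
rewrite !(wdim_weyl q0).
have -> : [exists i : 'I_a.+1, a%:Z - (2 * i)%N%:Z == m%:Z + 2] =
    (a != m) && [exists i : 'I_a.+1, a%:Z - (2 * i)%N%:Z == m%:Z].
  apply/existsP/andP=> [[i /eqP e]|[ne /existsP[i /eqP e]]].
    have ia : (i < a.+1)%N := ltn_ord i.
    split; first by lia.
    have h : (i.+1 < a.+1)%N by lia.
    by apply/existsP; exists (Ordinal h); apply/eqP; rewrite /=; lia.
  have ia : (i < a.+1)%N := ltn_ord i.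
  have h : (i.-1 < a.+1)%N by lia.
  by exists (Ordinal h); apply/eqP; rewrite /=; lia.
case: (eqVneq a m) => [->|ne]; last by rewrite add0n.
have -> // : [exists i : 'I_m.+1, m%:Z - (2 * i)%N%:Z == m%:Z].
by apply/existsP; exists ord0; rewrite /= muln0 subr0.
Qed.

(** By induction on the dimension, splitting off Weyl modules of maximal weight a:
    a copy of W m contributes one dimension to the space of maps and one to the
    drop of weight multiplicities from m to m + 2, and W a with a <> m neither. *)
Lemma weyl_hom_dim (X : uqrep k) m : is_uqmod q X ->
  (forall j, uwt X j <= (l - 2)%N%:Z) -> (m <= l - 2)%N ->
  exists d, exists f : 'rV[k]_d -> 'M[k]_(udim X, udim (W m)),
    [/\ wdim X m%:Z = (d + wdim X (m%:Z + 2))%N,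
        forall c x y, f (c *: x + y) = c *: f x + f y, injective f
      & forall u, is_uqhom u <-> exists r, f r = u].
Proof.
have l1 := l_gt1 hl.
have [N leN] := ubnP (udim X); elim: N X leN => // N IH X leN hX wX ml.
case: (posnP (udim X)) => [X0|Xgt].
  have no (i : 'I_(udim X)) : False by have := leq_ltn_trans (leq0n i) (ltn_ord i); move: (udim X) X0 => d ->.
  exists 0%N, (fun=> 0); split.
  - by rewrite !wdim_eq0 // => i; case: (no i).
  - by move=> c x y; rewrite scaler0 addr0.
  - by move=> x y _; rewrite !thinmx0.
  - move=> u; split=> [_|_]; last by have -> : u = 0 by [apply/matrixP=> i; case: (no i)]; exact: uqhom_0.
    by exists 0; apply/matrixP => i; case: (no i).
have [i0 mx] := max_uwt Xgt.
have ge0 := max_uwt_ge0 q0 hX mx.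
have [a ea] : exists a : nat, uwt X i0 = a%:Z by exists `|uwt X i0|%N; lia.
have al : (a <= l - 2)%N by have := wX i0; rewrite ea.
have al' : (a < l)%N by lia.
have [i [p [hi hp pi1]]] := top_weyl_retract q0 hl hX al' mx ea.
have [Y [iY [pY B]]] := retract_biproduct hi hp pi1.
have [_ rY] : retract (W a) X /\ retract Y X.
  by apply: dsum_retract; exists i, p, iY, pY.
have [||d [f [nf lf jf sf]]] := IH Y _ (uqmod_retract hX rY) _ ml.
- by move: leN; rewrite (biproduct_dim B) /=; lia.
- by move=> j; have [j' <-] := uwt_retract j rY.
have [o1 o2] := biproduct_orth B.
have [[_ _ hiY hpY] [_ pY1 s1]] := B.
have hfr r : is_uqhom (f r) by apply/sf; exists r.
case: (eqVneq a m) => [e|ne].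
  subst m.
  exists (1 + d)%N, (fun r => (lsubmx r) 0 0 *: i + iY *m f (rsubmx r)); split.
  - rewrite !(wdim_biproduct _ B) nf [wdim (W a) a%:Z]wdim_weyl_drop eqxx; lia.
  - move=> c x y.
    have -> : lsubmx (c *: x + y) = c *: lsubmx x + lsubmx y by rewrite linearP.
    have -> : rsubmx (c *: x + y) = c *: rsubmx x + rsubmx y by rewrite linearP.
    rewrite lf mulmxDr -scalemxAr [in LHS]mxE [in X in X + _]mxE.
    rewrite scalerDl !scalerDr scalerA -!addrA; congr (_ + _).
    by rewrite addrCA.
  - move=> x y e.
    have e1 : lsubmx x = lsubmx y.
      apply/matrixP => u v; rewrite !ord1.
      have := congr1 (mulmx p) e.
      rewrite !mulmxDr -!scalemxAr !(mulmxA p iY) o2 !mul0mx !addr0 pi1.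
      by move/matrixP/(_ ord0 ord0); rewrite mxE [RHS]mxE !mxE eqxx !mulr1.
    have e2 : rsubmx x = rsubmx y.
      apply: jf; have := congr1 (mulmx pY) e.
      by rewrite !mulmxDr -!scalemxAr !(mulmxA pY iY) o1 pY1 !scaler0 !add0r !mul1mx.
    by rewrite -[x]hsubmxK -[y]hsubmxK e1 e2.
  - move=> u; split=> [hu|[r <-]]; last first.
      by apply: uqhomD; [exact: uqhomZ|exact: is_uqhom_comp].
    have [r er] : exists r, f r = pY *m u by apply/sf; exact: is_uqhom_comp.
    exists (row_mx ((p *m u) ord0 ord0)%:M r).
    rewrite row_mxKl row_mxKr er mxE eqxx mulr1n.
    have hpu : is_uqhom (p *m u) by exact: is_uqhom_comp.
    rewrite -[u in RHS]mul1mx -s1 mulmxDl -!mulmxA; congr (_ + _).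
    by rewrite [in RHS](weyl_end_scalar q0 hpu) mul_mx_scalar.
exists d, (fun r => iY *m f r); split.
- by rewrite !(wdim_biproduct _ B) nf [wdim (W a) m%:Z]wdim_weyl_drop (negPf ne); lia.
- by move=> c x y; rewrite lf mulmxDr scalemxAr.
- by move=> x y e; apply: jf; rewrite -[f x]mul1mx -[f y]mul1mx -pY1 -!mulmxA e.
- move=> u; split=> [hu|[r <-]]; last exact: is_uqhom_comp.
  have [r er] : exists r, f r = pY *m u by apply/sf; exact: is_uqhom_comp.
  exists r; rewrite er -[u in RHS]mul1mx -s1 mulmxDl -!mulmxA.
  have -> : p *m u = 0.
    exact: (weyl_hom_neq q0 hl al' (is_uqhom_comp hp hu) ne).
  by rewrite mulmx0 add0r.
Qed.

Variable n : nat.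

Lemma pr_kdim (J : fusion_pr q l (Vpow q n)) m : (m <= l - 2)%N ->
  wdim (pr_obj J) m%:Z = (kdim (Dmod q n m) + wdim (pr_obj J) (m%:Z + 2))%N.
Proof.
move=> ml; have [d [f [-> lf jf sf]]] := weyl_hom_dim (pr_uqmod J) (fun j => pr_uwt q0 j) ml.
congr (_ + _)%N; apply/esym/kdimE.
have hf r : f r \in @uqhom_pred k (W m) (pr_obj J).
  by apply/uqhomP/sf; exists r.
pose mk r : DQ J m := UqHom (hf r).
have [c1 c2] := @jres_can k q l q0 hl n J m ml.
exists (fun r => jres (mk r)); split.
  have hr (x : DQ J m) : exists r, f r = uqhom_mx x by apply/sf; exact: DQ_hom.
  have [g gP] := choice hr.
  exists (fun y => g (jcores J (repr y))) => [r|y].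
    by rewrite c1; apply: jf; rewrite gP.
  rewrite (_ : mk _ = jcores J (repr y)) ?c2 //.
  by apply: val_inj; rewrite /= gP.
move=> c x y.
have -> : mk (c *: x + y) =
    TL_to_jones J (c *: (1 : TL q n)) *: (mk x : DQ J m) + mk y.
  apply: val_inj; rewrite /= lf.
  by rewrite -scalemxAr mulmx1 -scalemxAl pr_out_in -scalemxAl mul1mx.
by rewrite raddfD /= (jres_scale q0 hl).
Qed.

(** For m <= l - 2 outside Lambda n both multiplicities vanish, the weights of
    V^n being n, n - 2, ..., -n. *)
Lemma pr_jones_dim (J : fusion_pr q l (Vpow q n)) (m : nat) : (m <= l - 2)%N ->
  wdim (pr_obj J) m%:Z = (jones_dim q l n m%:Z + wdim (pr_obj J) (m%:Z + 2))%N.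
Proof.
move=> ml; rewrite /jones_dim; case: ifP => [_|no]; first exact: pr_kdim.
have wt j : exists2 a, (a <= n)%N & uwt (pr_obj J) j = n%:Z - (2 * a)%N%:Z.
  by have [j' <-] := uwt_retract j (pr_retract J); exact: Vpow_uwt.
have {}no : ~~ ((m <= n)%N && (m == n %[mod 2])%N).
  by move: no; rewrite !inE ml andbT => ->.
rewrite !wdim_eq0 // => j; have [a an ->] := wt j; apply: contraNneq no; clear -an; lia.
Qed.

End HomDimension.

Section JonesDimension.
Variables (k : fieldType) (q : k) (l : nat).
Hypothesis q0 : q != 0.
Hypothesis hl : quantum_char q l.

Lemma jones_dim_out n (m : int) : ~~ ((0 <= m) && (m <= (l - 2)%N%:Z)) ->
  jones_dim q l n m = 0%N.
Proof.
case: m => //= m; case: ifP => //; rewrite !inE => /andP[_ h] /negP[]; lia.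
Qed.

(** The range of m extends to -1, where the drop vanishes by the symmetry of the
    weights, and beyond l - 2, where there are no weights. *)
Lemma fusion_split_jones_dim n X (i : 'M[k]_(udim (Vpow q n), udim X)) p (m : int) :
  fusion_split l i p -> -1 <= m ->
  wdim X m = (jones_dim q l n m + wdim X (m + 2))%N.
Proof.
move=> G m1; have [J eJ] := fusion_split_pr q0 hl G.
have [_ wX sX _] := G.
case: (boolP ((0 <= m) && (m <= (l - 2)%N%:Z))) => [|out].
  case: m m1 => // m _ /andP[_ ml]; rewrite -eJ; apply: pr_jones_dim => //.
rewrite jones_dim_out //.
have [->|ne] := eqVneq m (-1); first by rewrite sX.
by rewrite !wdim_eq0 // => j; have := wX j; lia.
Qed.

Lemma jones_dim0 (m : int) : jones_dim q l 0 m = nat_of_bool (m == 0).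
Proof.
case: (ltrP m (-1)) => m1.
  by rewrite jones_dim_out; [case: eqP => // e; move: m1; rewrite e|lia].
have := fusion_split_jones_dim (fusion_split0 l q0) m1; rewrite !(wdim_weyl q0).
have E w : [exists i : 'I_1, 0%:Z - (2 * i)%N%:Z == w] = (w == 0).
  apply/existsP/eqP => [[i /eqP <-]|->]; first by rewrite ord1.
  by exists ord0.
rewrite !E; have [e|] := eqVneq (m + 2) 0; last by rewrite addn0.
by move: m1; rewrite (_ : m = -2) //; move: e; clear; lia.
Qed.

Lemma jones_dimS n (m : int) : 0 <= m -> m <= (l - 2)%N%:Z ->
  jones_dim q l n.+1 m =
    (jones_dim q l n (m - 1)%R + jones_dim q l n (m + 1)%R)%N.
Proof.
move=> m0 ml; have [X [i [p G]]] := fusion_split_exists q0 hl n.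
have [X' [i' [p' [G' e]]]] := fusion_splitS q0 hl G.
have a1 := @fusion_split_jones_dim _ _ _ _ m G'.
have a2 := @fusion_split_jones_dim _ _ _ _ (m - 1) G.
have a3 := @fusion_split_jones_dim _ _ _ _ (m + 1) G.
case: m m0 ml a1 a2 a3 => // m _ ml a1 a2 a3.
have {}e := e m ml; move: a1 a2 a3 e.
rewrite (_ : (m%:Z - 1 + 2) = m%:Z + 1); last by clear; lia.
rewrite (_ : (m%:Z + 1 + 2) = m%:Z + 3); last by clear; lia.
move=> /(_ ltac:(done)) a1 /(_ ltac:(clear; lia)) a2 /(_ ltac:(clear; lia)) a3.
by rewrite a1 a2 a3; clear; lia.
Qed.

Lemma jones_dim_unique (d : nat -> int -> nat) :
  (forall m : int, d 0%N m = nat_of_bool (m == 0)) ->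
  (forall (n : nat) (m : int),
     ~~ ((0 <= m) && (m <= (l - 2)%N%:Z)) -> d n m = 0%N) ->
  (forall (n : nat) (m : int), 0 <= m -> m <= (l - 2)%N%:Z ->
     d n.+1 m = (d n (m - 1)%R + d n (m + 1)%R)%N) ->
  forall (n : nat) (m : int), d n m = jones_dim q l n m.
Proof.
move=> d0 dout dS; elim=> [|n IH] m; first by rewrite d0 jones_dim0.
case: (boolP ((0 <= m) && (m <= (l - 2)%N%:Z))) => [/andP[m0 ml]|out].
  by rewrite dS // jones_dimS // !IH.
by rewrite dout // jones_dim_out.
Qed.

End JonesDimension.

Theorem proposition7p1 (k : fieldType) (q : k) (l : nat)
    (hl : (l.-primitive_root (q ^+ 2) /\ (1 < l)%N)
          \/ (q = 1 /\ l \in [pchar k])) :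
  [/\ forall n : nat, inhabited (fusion_pr q l (Vpow q n)),
      forall (n : nat) (J : fusion_pr q l (Vpow q n)),
        exists DQ : nat -> lmodType (jones J),
        [/\ forall m, m \in Lambda_l l n ->
              is_restriction (TL_to_jones J) (DQ m) (Dmod q n m),
            forall m, m \in Lambda_l l n ->
              nonzero_module (Dmod q n m) -> simple_module (DQ m),
            forall m1 m2, m1 \in Lambda_l l n -> m2 \in Lambda_l l n ->
              nonzero_module (Dmod q n m1) -> nonzero_module (Dmod q n m2) ->
              lmod_iso (DQ m1) (DQ m2) -> m1 = m2
          & forall W : lmodType (jones J), simple_module W ->
              exists m, [/\ m \in Lambda_l l n, nonzero_module (Dmod q n m)
                          & lmod_iso W (DQ m)]],
      forall m : int, jones_dim q l 0 m = nat_of_bool (m == 0),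
      forall (n : nat) (m : int), 0 <= m -> m <= (l - 2)%N%:Z ->
        jones_dim q l n.+1 m =
          (jones_dim q l n (m - 1)%R + jones_dim q l n (m + 1)%R)%N
    & forall d : nat -> int -> nat,
        (forall m : int, d 0%N m = nat_of_bool (m == 0)) ->
        (forall (n : nat) (m : int),
           ~~ ((0 <= m) && (m <= (l - 2)%N%:Z)) -> d n m = 0%N) ->
        (forall (n : nat) (m : int), 0 <= m -> m <= (l - 2)%N%:Z ->
           d n.+1 m = (d n (m - 1)%R + d n (m + 1)%R)%N) ->
        forall (n : nat) (m : int), d n m = jones_dim q l n m].
Proof.
have [q0 hq] := quantum_char_root hl.
split.
- move=> n; have [X [i [p G]]] := fusion_split_exists q0 hq n.
  by have [J _] := fusion_split_pr q0 hq G; exact: inhabits.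
- move=> n J; exists (DQ J); split.
  + by move=> m /andP[_ ml]; exact: jres_restriction.
  + by move=> m /andP[_ ml] /(DQ_nonzero q0 hq J ml); exact: DQ_simple.
  + move=> m1 m2 /andP[_ l1] /andP[_ l2] /(DQ_nonzero q0 hq J l1) nz _.
    exact: (DQ_iso_eq q0 hq).
  + exact: (DQ_complete q0 hq).
- exact: (jones_dim0 q0 hq).
- exact: (jones_dimS q0 hq).
- exact: (jones_dim_unique q0 hq).
Qed.
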